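(* There is an algorithm (an extension of Weiner's right-to-left suffix tree construction) that solves the Right-to-Left Online NF Computation problem: for a string $S$ of length $n$ over a general ordered alphabet of size $\sigma$ and a new character $a\in\Sigma$ prepended to $S$, it updates the list $\mathcal{L}$ storing $\mathsf{PNF}(S)$ by computing $\mathsf{PNF}(aS)\,\triangle\,\mathsf{PNF}(S)$, in $O(\log\sigma)$ amortized time per character, using $O(n)$ space.
   Context: $\mathrm{occ}_X(w)$ is the number of starting positions $i$ with $X[i..i+|w|-1]=w$; a repeat of $X$ is a $w$ with $\mathrm{occ}_X(w)\ge2$. For a repeat $w$ of $X$, $\Phi_X(w) = \{(\alpha,\beta)\in\Sigma\times\Sigma \mid \mathrm{occ}_X(\alpha w\beta)=\mathrm{occ}_X(\alpha w)=\mathrm{occ}_X(w\beta)=1\}$, and the net frequency is $\phi_X(w)=|\Phi_X(w)|$. A repeat is maximal if it is left-maximal (a prefix of $X$ or preceded by two distinct characters in $X$) and right-maximal (a suffix of $X$ or followed by two distinct characters in $X$); $\mathsf{M}(X)$ is the set of maximal repeats. $\mathsf{PNF}(X)=\{(w,\phi_X(w)) \mid w\in\mathsf{M}(X),\ \phi_X(w)\ge1\}$. The Right-to-Left Online NF Computation problem: characters are prepended one at a time to the current string $S$ (which ends with a unique end-marker $\$$); after each new character $a$, the list $\mathcal{L}=\mathsf{PNF}(S)$ must be updated to $\mathsf{PNF}(aS)$ by computing the symmetric difference $(\mathsf{PNF}(aS)\setminus\mathsf{PNF}(S))\cup(\mathsf{PNF}(S)\setminus\mathsf{PNF}(aS))$.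 *)

(* Defs.v *)
From HB Require Import structures.
From mathcomp Require Import all_boot all_order.

Set Implicit Arguments.
Unset Strict Implicit.
Unset Printing Implicit Defensive.

(** * Net frequency *)

Section NetFrequency.
Variable Sigma : finType.
Implicit Types X w : seq Sigma.

(* The empty string occurs at all |X|+1 positions. *)
Definition occ X w : nat :=
  #|[set i : 'I_(size X).+1 | take (size w) (drop i X) == w]|.

Definition repeat X w : bool := 2 <= occ X w.

Definition Phi X w : {set Sigma * Sigma} :=
  [set p | [&& occ X (p.1 :: rcons w p.2) == 1,
               occ X (p.1 :: w) == 1 &
               occ X (rcons w p.2) == 1]].

Definition nf X w : nat := #|Phi X w|.

Definition left_maximal X w : bool :=
  prefix w X ||
  [exists a, exists b, [&& a != b, 0 < occ X (a :: w) & 0 < occ X (b :: w)]].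

Definition right_maximal X w : bool :=
  suffix w X ||
  [exists a, exists b,
     [&& a != b, 0 < occ X (rcons w a) & 0 < occ X (rcons w b)]].

Definition maximal_repeat X w : bool :=
  [&& repeat X w, left_maximal X w & right_maximal X w].

Definition PNF X : {pred seq Sigma * nat} :=
  [pred p | [&& maximal_repeat X p.1, p.2 == nf X p.1 & 1 <= nf X p.1]].

End NetFrequency.

(** * A word RAM over a general ordered alphabet

   Programs are finite texts that do not mention the alphabet. Numbers live in
   registers and in [heap]; characters live in a separate memory [text], where
   they can only be copied and compared. Every command and every evaluation of
   a guard costs one time unit; expressions occurring in a program have a fixed
   size, so this is unit cost per operation up to a constant factor. *)

Inductive binop := OpAdd | OpSub | OpMul | OpDiv.

Inductive expr :=
| Cst of nat
| Reg of nat
| Deref of expr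
| Op of binop & expr & expr.

Inductive test :=
| NumLt of expr & expr
| NumEq of expr & expr
| ChrLt of expr & expr
| ChrEq of expr & expr
| TNot of test
| TAnd of test & test.

Inductive cmd :=
| Skip
| SetReg of nat & expr
| Store of expr & expr
| CopyChr of expr & expr
| Emit of bool & expr & expr & expr
| Seq of cmd & cmd
| If of test & cmd & cmd
| While of test & cmd.

(* [(i, l, f)] denotes the pair (w, f) where w is the length-l prefix of the
   length-i suffix of the current string. Measured from the right end, the
   position i does not change when characters are prepended. *)
Definition entry : Type := (nat * nat * nat)%type.

Record state (Sigma : Type) := State {
  regs : nat -> nat;
  heap : nat -> nat;
  text : nat -> Sigma;
  out : seq (bool * entry)
}.

Definition upd (A : Type) (f : nat -> A) (x : nat) (v : A) : nat -> A :=
  fun y => if y == x then v else f y.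

Section Semantics.
Variables (disp : Order.disp_t) (Sigma : finOrderType disp).
Implicit Types (s : state Sigma) (e : expr) (b : test) (c : cmd).

Definition eval_op (o : binop) (m n : nat) : nat :=
  match o with
  | OpAdd => m + n
  | OpSub => m - n
  | OpMul => m * n
  | OpDiv => m %/ n
  end.

Fixpoint eval s e : nat :=
  match e with
  | Cst k => k
  | Reg x => regs s x
  | Deref e1 => heap s (eval s e1)
  | Op o e1 e2 => eval_op o (eval s e1) (eval s e2)
  end.

Fixpoint holds s b : bool :=
  match b with
  | NumLt e1 e2 => eval s e1 < eval s e2
  | NumEq e1 e2 => eval s e1 == eval s e2
  | ChrLt e1 e2 => (text s (eval s e1) < text s (eval s e2))%O
  | ChrEq e1 e2 => text s (eval s e1) == text s (eval s e2)
  | TNot b1 => ~~ holds s b1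
  | TAnd b1 b2 => holds s b1 && holds s b2
  end.

(* Evaluation on a machine with [M] cells in each memory and words holding the
   integers 0..[W]: all addresses are below [M] and no intermediate value
   exceeds [W]. *)
Fixpoint fits (M W : nat) s e : bool :=
  (eval s e <= W) &&
  match e with
  | Cst _ | Reg _ => true
  | Deref e1 => fits M W s e1 && (eval s e1 < M)
  | Op _ e1 e2 => fits M W s e1 && fits M W s e2
  end.

Definition fits_addr (M W : nat) s e : bool := fits M W s e && (eval s e < M).

Fixpoint fits_test (M W : nat) s b : bool :=
  match b with
  | NumLt e1 e2 | NumEq e1 e2 => fits M W s e1 && fits M W s e2
  | ChrLt e1 e2 | ChrEq e1 e2 => fits_addr M W s e1 && fits_addr M W s e2
  | TNot b1 => fits_test M W s b1
  | TAnd b1 b2 => fits_test M W s b1 && fits_test M W s b2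
  end.

(* [exec M W c s t s']: on the machine with bounds [M] and [W], [c] started in
   [s] halts in [s'] after [t] time units. Exceeding a bound blocks the
   execution. *)
Inductive exec (M W : nat) : cmd -> state Sigma -> nat -> state Sigma -> Prop :=
| ExecSkip s : exec M W Skip s 1 s
| ExecSetReg s x e :
    fits M W s e ->
    exec M W (SetReg x e) s 1
      (State (upd (regs s) x (eval s e)) (heap s) (text s) (out s))
| ExecStore s e1 e2 :
    fits_addr M W s e1 -> fits M W s e2 ->
    exec M W (Store e1 e2) s 1
      (State (regs s) (upd (heap s) (eval s e1) (eval s e2)) (text s) (out s))
| ExecCopyChr s e1 e2 :
    fits_addr M W s e1 -> fits_addr M W s e2 ->
    exec M W (CopyChr e1 e2) s 1
      (State (regs s) (heap s)
         (upd (text s) (eval s e1) (text s (eval s e2))) (out s))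
| ExecEmit s r e1 e2 e3 :
    fits M W s e1 -> fits M W s e2 -> fits M W s e3 ->
    exec M W (Emit r e1 e2 e3) s 1
      (State (regs s) (heap s) (text s)
         (rcons (out s) (r, (eval s e1, eval s e2, eval s e3))))
| ExecSeq s1 s2 s3 t1 t2 c1 c2 :
    exec M W c1 s1 t1 s2 -> exec M W c2 s2 t2 s3 ->
    exec M W (Seq c1 c2) s1 (t1 + t2) s3
| ExecIf s s' t b c1 c2 :
    fits_test M W s b ->
    exec M W (if holds s b then c1 else c2) s t s' ->
    exec M W (If b c1 c2) s t.+1 s'
| ExecWhileFalse s b c :
    fits_test M W s b -> ~~ holds s b ->
    exec M W (While b c) s 1 s
| ExecWhileTrue s1 s2 s3 t1 t2 b c :
    fits_test M W s1 b -> holds s1 b ->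
    exec M W c s1 t1 s2 -> exec M W (While b c) s2 t2 s3 ->
    exec M W (While b c) s1 (t1 + t2).+1 s3.

Lemma exec_det M W c s t1 s1 t2 s2 :
  exec M W c s t1 s1 -> exec M W c s t2 s2 -> t1 = t2 /\ s1 = s2.
Proof.
move=> H; elim: H t2 s2 => {c s t1 s1}.
- by move=> s t2 s2 H; inversion H; subst.
- by move=> s x e _ t2 s2 H; inversion H; subst.
- by move=> s e1 e2 _ _ t2 s2 H; inversion H; subst.
- by move=> s e1 e2 _ _ t2 s2 H; inversion H; subst.
- by move=> s r e1 e2 e3 _ _ _ t2 s2 H; inversion H; subst.
- move=> s1 s2 s3 t1 t2 c1 c2 _ IH1 _ IH2 t s H.
  inversion H as [| | | | |? ? ? ? ? ? ? E1 E2| | |]; subst.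
  have [? ?] := IH1 _ _ E1; subst.
  by have [-> ->] := IH2 _ _ E2.
- move=> s s' t b c1 c2 _ _ IH t2 s2 H.
  inversion H as [| | | | | |? ? ? ? ? ? _ E| |]; subst.
  by have [-> ->] := IH _ _ E.
- move=> s b c _ nb t2 s2 H.
  inversion H as [| | | | | | | |? ? ? ? ? ? ? _ hb]; subst => //.
  by rewrite hb in nb.
- move=> s1 s2 s3 t1 t2 b c _ hb _ IH1 _ IH2 t s H.
  inversion H as [| | | | | | |? ? ? _ nb|? ? ? ? ? ? ? _ _ E1 E2]; subst.
    by rewrite hb in nb.
  have [? ?] := IH1 _ _ E1; subst.
  by have [-> ->] := IH2 _ _ E2.
Qed.

End Semantics.

(** * The right-to-left online problem *)

Section Online.
Variables (disp : Order.disp_t) (Sigma : finOrderType disp).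
Variable (dollar : Sigma).

Definition blank_state : state Sigma :=
  State (fun=> 0) (fun=> 0) (fun=> dollar) [::].

(* The next character arrives in cell 0 of [text], and the output is cleared. *)
Definition feed (a : Sigma) (s : state Sigma) : state Sigma :=
  State (regs s) (heap s) (upd (text s) 0 a) [::].

(* [online_run init update C S s t]: started on the string "$" and fed the
   other characters of S from right to left, the algorithm is in state [s]
   after total time [t]. While the current string has length n, the execution
   is confined to C * n cells per memory and to words of C * log2 (n+1) bits. *)
Inductive online_run (init update : cmd) (C : nat) :
  seq Sigma -> state Sigma -> nat -> Prop :=
| RunInit s t :
    exec (C * 1) (2 ^ C) init blank_state t s ->
    online_run init update C [:: dollar] s t
| RunPrepend a S s t s' t' :
    a != dollar ->
    online_run init update C S s t ->
    exec (C * (size S).+1) ((size S).+2 ^ C) update (feed a s) t' s' ->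
    online_run init update C (a :: S) s' (t + t').

Definition decode (S : seq Sigma) (x : entry) : seq Sigma * nat :=
  (take x.1.2 (drop (size S - x.1.1) S), x.2).

Definition valid_entry (S : seq Sigma) (x : entry) : bool :=
  x.1.2 <= x.1.1 <= size S.

Definition enumerates (S : seq Sigma) (xs : seq entry)
    (P : {pred seq Sigma * nat}) : Prop :=
  [/\ all (valid_entry S) xs,
      uniq (map (decode S) xs)
    & map (decode S) xs =i P].

(* Null-terminated linked list: a node at address p consists of the cells
   p, p+1, p+2 (the entry) and p+3 (the address of the next node). *)
Inductive linked_list (h : nat -> nat) : nat -> seq entry -> Prop :=
| LinkedNil : linked_list h 0 [::]
| LinkedCons p xs :
    p != 0 -> linked_list h (h (p + 3)) xs ->
    linked_list h p ((h p, h (p + 1), h (p + 2)) :: xs).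

(* The list L is the linked list whose head address is in register 0. *)
Definition stores_PNF (S : seq Sigma) (s : state Sigma) : Prop :=
  exists2 xs, linked_list (heap s) (regs s 0) xs & enumerates S xs (PNF S).

Definition emitted (r : bool) (s : state Sigma) : seq entry :=
  [seq x.2 | x <- out s & x.1 == r].

(* The two halves of the symmetric difference are output with the tags [true]
   (entries entering the list) and [false] (entries leaving it). *)
Definition emits_PNF_diff (a : Sigma) (S : seq Sigma) (s : state Sigma) : Prop :=
  enumerates (a :: S) (emitted true s) [predD PNF (a :: S) & PNF S] /\
  enumerates (a :: S) (emitted false s) [predD PNF S & PNF (a :: S)].

End Online.

(* Main.v *)
(** For the suffix of length m let l(m) be the length of its longest prefix that
    occurs elsewhere, that is, the string depth of the parent of its leaf in the
    suffix tree. The net frequency of a repeat w is the number of m such that w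
    is that prefix and l(m + 1) <= l(m). So the net frequency of a node counts
    its flagged leaf children, and a repeat of positive net frequency is
    automatically an explicit node and a maximal repeat.

    Prepending a character adds the leaf of the new string of length N and
    changes the parent of at most one other leaf j (when an edge is split); it
    can only change the flags of j, j - 1 and N - 1, hence the frequencies of at
    most four nodes.

    The new leaf is found as in Weiner's algorithm, with inverse suffix links at
    explicit nodes only: climb from the parent of the last leaf to the lowest node
    having a link by the new character. The climb is paid for by the number of
    explicit nodes on the path of the current string, which grows by at most 2.
    An AA tree numbers the distinct characters as they arrive, and the links and
    children of a node are kept in a digital search tree over the bits of these
    numbers, so that each step costs O(log sigma). *)

Require Import Defs.
From HB Require Import structures.
From mathcomp Require Import all_boot all_order zify.
From Stdlib Require Import FunctionalExtensionality.

Set Implicit Arguments.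
Unset Strict Implicit.
Unset Printing Implicit Defensive.

(** * Programs over arrays *)

(** Links between explicit nodes find the deepest explicit node [y] above the new leaf, but not the
    depth at which the edge from [y] to its child [q] must be split. The tail of the new node helps:
    it is already explicit, it lies on the path of the old string strictly below the place where the
    climb stopped, and it is the highest node on that path at which the old string and the text of
    [q] without its first character continue differently. A second climb of the same length finds it
    by comparing one pair of character numbers per node, so a single potential pays for both climbs.
    The machine blocks on any oversized address or word. Correctness is therefore proved for array
    programs without bounds, and transferred by a type check that bounds each register and array by
    a constant multiple of the string length. Clamped counters make this check independent of the
    invariants. *)

(* The heap is viewed as 32 interleaved arrays: cell [i] of array [f] lives at
   address [32 * i + f]. *)
Inductive aexpr :=
| ACst of nat
| AReg of nat
| AFld of nat & aexpr
| AAdd of aexpr & aexpr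
| ASub of aexpr & aexpr
| AMul of nat & aexpr
| AHalf of aexpr.

Inductive atest :=
| ALt of aexpr & aexpr
| AEq of aexpr & aexpr
| ACLt of aexpr & aexpr
| ACEq of aexpr & aexpr
| ANot of atest
| AAnd of atest & atest.

Inductive acmd :=
| ASkip
| ASet of nat & aexpr
| ASto of nat & aexpr & aexpr
| ACpy of aexpr & aexpr
| AEmit of bool & aexpr & aexpr & aexpr
| ASeq of acmd & acmd
| AIf of atest & acmd & acmd
| AWhile of atest & acmd.

Definition caddr (f : nat) (e : expr) : expr :=
  Op OpAdd (Op OpMul (Cst 32) e) (Cst f).

Fixpoint cexpr (e : aexpr) : expr :=
  match e with
  | ACst k => Cst k
  | AReg x => Reg x
  | AFld f e1 => Deref (caddr f (cexpr e1))
  | AAdd e1 e2 => Op OpAdd (cexpr e1) (cexpr e2)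
  | ASub e1 e2 => Op OpSub (cexpr e1) (cexpr e2)
  | AMul k e1 => Op OpMul (Cst k) (cexpr e1)
  | AHalf e1 => Op OpDiv (cexpr e1) (Cst 2)
  end.

Fixpoint ctest (b : atest) : test :=
  match b with
  | ALt e1 e2 => NumLt (cexpr e1) (cexpr e2)
  | AEq e1 e2 => NumEq (cexpr e1) (cexpr e2)
  | ACLt e1 e2 => ChrLt (cexpr e1) (cexpr e2)
  | ACEq e1 e2 => ChrEq (cexpr e1) (cexpr e2)
  | ANot b1 => TNot (ctest b1)
  | AAnd b1 b2 => TAnd (ctest b1) (ctest b2)
  end.

Fixpoint compile (c : acmd) : cmd :=
  match c with
  | ASkip => Skip
  | ASet x e => SetReg x (cexpr e)
  | ASto f e1 e2 => Store (caddr f (cexpr e1)) (cexpr e2)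
  | ACpy e1 e2 => CopyChr (cexpr e1) (cexpr e2)
  | AEmit r e1 e2 e3 => Emit r (cexpr e1) (cexpr e2) (cexpr e3)
  | ASeq c1 c2 => Seq (compile c1) (compile c2)
  | AIf b c1 c2 => If (ctest b) (compile c1) (compile c2)
  | AWhile b c1 => While (ctest b) (compile c1)
  end.

Record astate (Sigma : Type) := AState {
  rg : nat -> nat;
  ar : nat -> nat -> nat;
  ch : nat -> Sigma;
  ou : seq (bool * entry)
}.

Definition conc (Sigma : Type) (s : astate Sigma) : state Sigma :=
  State (rg s) (fun p => ar s (p %% 32) (p %/ 32)) (ch s) (ou s).

(** * Semantics of array programs and their compilation within the machine bounds *)

Section ArraySemantics.
Variables (disp : Order.disp_t) (Sigma : finOrderType disp).
Implicit Types (s : astate Sigma) (e : aexpr) (b : atest) (c : acmd).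

Fixpoint aeval s e : nat :=
  match e with
  | ACst k => k
  | AReg x => rg s x
  | AFld f e1 => ar s f (aeval s e1)
  | AAdd e1 e2 => aeval s e1 + aeval s e2
  | ASub e1 e2 => aeval s e1 - aeval s e2
  | AMul k e1 => k * aeval s e1
  | AHalf e1 => (aeval s e1)./2
  end.

Fixpoint aholds s b : bool :=
  match b with
  | ALt e1 e2 => aeval s e1 < aeval s e2
  | AEq e1 e2 => aeval s e1 == aeval s e2
  | ACLt e1 e2 => (ch s (aeval s e1) < ch s (aeval s e2))%O
  | ACEq e1 e2 => ch s (aeval s e1) == ch s (aeval s e2)
  | ANot b1 => ~~ aholds s b1
  | AAnd b1 b2 => aholds s b1 && aholds s b2
  end.

Definition set_rg s x v := AState (upd (rg s) x v) (ar s) (ch s) (ou s).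
Definition set_ar s f i v :=
  AState (rg s) (upd (ar s) f (upd (ar s f) i v)) (ch s) (ou s).
Definition set_ch s i v := AState (rg s) (ar s) (upd (ch s) i v) (ou s).
Definition put_ou s x := AState (rg s) (ar s) (ch s) (rcons (ou s) x).

Inductive aexec : acmd -> astate Sigma -> nat -> astate Sigma -> Prop :=
| AExecSkip s : aexec ASkip s 1 s
| AExecSet s x e : aexec (ASet x e) s 1 (set_rg s x (aeval s e))
| AExecSto s f e1 e2 :
    aexec (ASto f e1 e2) s 1 (set_ar s f (aeval s e1) (aeval s e2))
| AExecCpy s e1 e2 :
    aexec (ACpy e1 e2) s 1 (set_ch s (aeval s e1) (ch s (aeval s e2)))
| AExecEmit s r e1 e2 e3 :
    aexec (AEmit r e1 e2 e3) s 1
      (put_ou s (r, (aeval s e1, aeval s e2, aeval s e3)))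
| AExecSeq s1 s2 s3 t1 t2 c1 c2 :
    aexec c1 s1 t1 s2 -> aexec c2 s2 t2 s3 -> aexec (ASeq c1 c2) s1 (t1 + t2) s3
| AExecIf s s' t b c1 c2 :
    aexec (if aholds s b then c1 else c2) s t s' -> aexec (AIf b c1 c2) s t.+1 s'
| AExecWhileFalse s b c : ~~ aholds s b -> aexec (AWhile b c) s 1 s
| AExecWhileTrue s1 s2 s3 t1 t2 b c :
    aholds s1 b -> aexec c s1 t1 s2 -> aexec (AWhile b c) s2 t2 s3 ->
    aexec (AWhile b c) s1 (t1 + t2).+1 s3.

Section Typing.
(* A bound discipline: register [x] holds at most [rho x * B] and the cells of
   array [f] at most [eta f * B]; [Q] caps the coefficients of all
   intermediate values and addresses. *)
Variables (rho eta : nat -> nat) (Q : nat).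

(** A constant counts as its own coefficient because [B] is positive, and a truncated subtraction is
    bounded by its first argument. No state occurs, so a whole program is checked by computation. *)
Fixpoint coef e : nat :=
  match e with
  | ACst k => k
  | AReg x => rho x
  | AFld f _ => eta f
  | AAdd e1 e2 => coef e1 + coef e2
  | ASub e1 _ => coef e1
  | AMul k e1 => k * coef e1
  | AHalf e1 => coef e1
  end.

Definition wt_addr f e := (f < 32) && (32 * coef e + f <= Q).

Fixpoint wt_expr e : bool :=
  (coef e <= Q) &&
  match e with
  | ACst k => true
  | AReg x => true
  | AFld f e1 => wt_expr e1 && wt_addr f e1
  | AAdd e1 e2 | ASub e1 e2 => wt_expr e1 && wt_expr e2
  | AMul k e1 => wt_expr e1 && (k <= Q)
  | AHalf e1 => wt_expr e1 && (2 <= Q)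
  end.

Fixpoint wt_test b : bool :=
  match b with
  | ALt e1 e2 | AEq e1 e2 | ACLt e1 e2 | ACEq e1 e2 => wt_expr e1 && wt_expr e2
  | ANot b1 => wt_test b1
  | AAnd b1 b2 => wt_test b1 && wt_test b2
  end.

Fixpoint wt_cmd c : bool :=
  match c with
  | ASkip => true
  | ASet x e => wt_expr e && (coef e <= rho x)
  | ASto f e1 e2 =>
      [&& wt_expr e1, wt_expr e2, wt_addr f e1 & coef e2 <= eta f]
  | ACpy e1 e2 => wt_expr e1 && wt_expr e2
  | AEmit _ e1 e2 e3 => [&& wt_expr e1, wt_expr e2 & wt_expr e3]
  | ASeq c1 c2 => wt_cmd c1 && wt_cmd c2
  | AIf b c1 c2 => [&& wt_test b, wt_cmd c1 & wt_cmd c2]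
  | AWhile b c1 => wt_test b && wt_cmd c1
  end.

Variables (B M W : nat).
Hypotheses (B_gt0 : 0 < B) (QM : Q * B < M) (QW : Q * B <= W) (Q32 : 32 <= Q).

Definition bounded s : Prop :=
  (forall x, rg s x <= rho x * B) /\ (forall f i, ar s f i <= eta f * B).

Lemma coefP s e : bounded s -> aeval s e <= coef e * B.
Proof.
case=> bR bA; elim: e => //= [k|e1 IH1 e2 IH2|e1 IH1 e2 IH2|k e IH|e IH].
- exact: leq_pmulr.
- by rewrite mulnDl leq_add.
- exact: leq_trans (leq_subr _ _) IH1.
- by rewrite -mulnA leq_mul2l IH orbT.
- by apply: leq_trans IH; rewrite -divn2 leq_div.
Qed.

Lemma coef_le s e : bounded s -> coef e <= Q -> aeval s e <= W.
Proof.
move=> bs ce; apply: leq_trans (coefP e bs) (leq_trans _ QW).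
by rewrite leq_mul2r ce orbT.
Qed.

Lemma const_le k : k <= Q -> k <= W.
Proof. by move=> kQ; apply: leq_trans QW; apply: leq_trans kQ (leq_pmulr _ _). Qed.

Lemma aeval_cexpr s e : wt_expr e -> eval (conc s) (cexpr e) = aeval s e.
Proof.
elim: e => //= [f e IH|e1 IH1 e2 IH2|e1 IH1 e2 IH2|k e IH|e IH] /andP[_].
- case/andP=> we /andP[f32 _]; rewrite (IH we) mulnC modnMDl modn_small //.
  by rewrite divnMDl // divn_small // addn0.
- by case/andP=> w1 w2; rewrite (IH1 w1) (IH2 w2).
- by case/andP=> w1 w2; rewrite (IH1 w1) (IH2 w2).
- by case/andP=> we _; rewrite (IH we).
- by case/andP=> we _; rewrite (IH we) divn2.
Qed.

Lemma wt_coef e : wt_expr e -> coef e <= Q.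
Proof. by case: e => /= *; lia. Qed.

Lemma addr_le s f e :
  bounded s -> wt_addr f e -> 32 * aeval s e + f <= Q * B.
Proof.
move=> bs /andP[f32 aQ]; have cle := coefP e bs.
apply: leq_trans (_ : (32 * coef e + f) * B <= _);
  last by rewrite leq_mul2r aQ orbT.
by rewrite mulnDl -mulnA leq_add ?leq_pmulr // leq_mul2l cle orbT.
Qed.

Lemma fits_cexpr s e : bounded s -> wt_expr e -> fits M W (conc s) (cexpr e).
Proof.
move=> bs; elim: e => [k|x|f e IH|e1 IH1 e2 IH2|e1 IH1 e2 IH2|k e IH|e IH] we;
  have := coef_le bs (wt_coef we); rewrite -(aeval_cexpr s we) /= => -> //=;
  case/andP: we => _; rewrite -/(wt_expr _).
- case/andP=> we1 wa; case/andP: (wa) => f32 aQ.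
  have := addr_le bs wa; rewrite -(aeval_cexpr s we1) => aB.
  have W32 := const_le Q32; rewrite IH //=; lia.
- by case/andP=> w1 w2; rewrite IH1 ?IH2.
- by case/andP=> w1 w2; rewrite IH1 ?IH2.
- by case/andP=> w1 w2; rewrite IH // const_le.
- by case/andP=> w1 w2; rewrite IH // const_le.
Qed.

Lemma fits_addr_caddr s f e :
  bounded s -> wt_expr e -> wt_addr f e ->
  fits_addr M W (conc s) (caddr f (cexpr e)).
Proof.
move=> bs we wa; case/andP: (wa) => f32 aQ.
have aB := addr_le bs wa.
have W32 := const_le Q32.
rewrite /fits_addr /= fits_cexpr // aeval_cexpr //; lia.
Qed.

Lemma fits_addr_cexpr s e :
  bounded s -> wt_expr e -> fits_addr M W (conc s) (cexpr e).
Proof.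
move=> bs we; rewrite /fits_addr fits_cexpr // aeval_cexpr //.
apply: leq_ltn_trans (coefP e bs) (leq_ltn_trans _ QM).
by rewrite leq_mul2r wt_coef ?orbT.
Qed.

Lemma holds_ctest s b : wt_test b -> holds (conc s) (ctest b) = aholds s b.
Proof.
elim: b => //= [e1 e2|e1 e2|e1 e2|e1 e2|b IH|b1 IH1 b2 IH2].
- by case/andP=> w1 w2; rewrite !aeval_cexpr.
- by case/andP=> w1 w2; rewrite !aeval_cexpr.
- by case/andP=> w1 w2; rewrite !aeval_cexpr.
- by case/andP=> w1 w2; rewrite !aeval_cexpr.
- by move=> /IH ->.
- by case/andP=> /IH1-> /IH2->.
Qed.

Lemma fits_ctest s b : bounded s -> wt_test b -> fits_test M W (conc s) (ctest b).
Proof.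
move=> bs; elim: b => //= [e1 e2|e1 e2|e1 e2|e1 e2|b1 IH1 b2 IH2] /andP[w1 w2].
- by rewrite !fits_cexpr.
- by rewrite !fits_cexpr.
- by rewrite !fits_addr_cexpr.
- by rewrite !fits_addr_cexpr.
- by rewrite IH1 // IH2.
Qed.

Lemma conc_set_ar s f i v : f < 32 ->
  conc (set_ar s f i v) =
  State (rg s) (upd (heap (conc s)) (32 * i + f) v) (ch s) (ou s).
Proof.
move=> f32; rewrite /conc /set_ar /=; congr State.
apply: functional_extensionality => p; rewrite /upd.
have := divn_eq p 32; have := ltn_pmod p (isT : 0 < 32).
set x := p %% 32; set y := p %/ 32 => x32 ->.
case: (x =P f) => [->|nxf]; last by case: eqP => // E; exfalso; lia.
by case: eqP => [->|nyi]; case: eqP => // E; exfalso; lia.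
Qed.

(** [aexec] checks no bounds. Boundedness of the state is an invariant of well-typed commands and
    yields every side condition of [exec]; the running time is the same, command by command. *)
Lemma exec_compile c s t s' :
  aexec c s t s' -> wt_cmd c -> bounded s ->
  exec M W (compile c) (conc s) t (conc s') /\ bounded s'.
Proof.
elim=> {c s t s'} /=.
- by move=> s _ bs; split=> //; constructor.
- move=> s x e /andP[we cx] bs; split.
    by rewrite /conc /= -aeval_cexpr //; apply: ExecSetReg; apply: fits_cexpr.
  case: (bs) => bR bA; split=> //= y; rewrite /upd; case: eqP => // ->.
  by apply: leq_trans (coefP e bs) _; rewrite leq_mul2r cx orbT.
- move=> s f e1 e2 /and4P[w1 w2 wa ce] bs; split.
    case/andP: (wa) => f32 _; rewrite conc_set_ar // -!aeval_cexpr //.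
    by apply: (@ExecStore _ _ M W (conc s) (caddr f (cexpr e1)));
      [apply: fits_addr_caddr | apply: fits_cexpr].
  case: (bs) => bR bA; split=> //= g i; rewrite /upd; case: (g =P f) => // ->.
  case: eqP => // _.
  by apply: leq_trans (coefP e2 bs) _; rewrite leq_mul2r ce orbT.
- move=> s e1 e2 /andP[w1 w2] bs; split=> //.
  rewrite /conc /= -!aeval_cexpr //.
  by apply: (@ExecCopyChr _ _ M W (conc s)); apply: fits_addr_cexpr.
- move=> s r e1 e2 e3 /and3P[w1 w2 w3] bs; split=> //.
  rewrite /conc /= -!aeval_cexpr //.
  by apply: (@ExecEmit _ _ M W (conc s)); apply: fits_cexpr.
- move=> s1 s2 s3 t1 t2 c1 c2 _ IH1 _ IH2 /andP[w1 w2] bs.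
  have [E1 b2] := IH1 w1 bs; have [E2 b3] := IH2 w2 b2.
  by split=> //; apply: ExecSeq E1 E2.
- move=> s s' t b c1 c2 _ IH /and3P[wb w1 w2] bs.
  have [|E b'] := IH _ bs; first by case: ifP.
  split=> //; apply: ExecIf; first exact: fits_ctest.
  by rewrite holds_ctest // -if_arg; move: E; case: ifP.
- move=> s b c nb /andP[wb wc] bs; split=> //.
  by apply: ExecWhileFalse; [apply: fits_ctest | rewrite holds_ctest].
- move=> s1 s2 s3 t1 t2 b c hb _ IH1 _ IH2 /andP[wb wc] bs.
  have [E1 b2] := IH1 wc bs.
  have [|E2 b3] := IH2 _ b2; first by rewrite wb.
  split=> //; apply: ExecWhileTrue E1 E2; first exact: fits_ctest.
  by rewrite holds_ctest.
Qed.

End Typing.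

(** * Total correctness with time bounds *)

Definition wpb c s (T : nat) (P : astate Sigma -> Prop) : Prop :=
  exists t s', [/\ aexec c s t s', t <= T & P s'].

Lemma wpb_conseq c s T T' (P P' : astate Sigma -> Prop) :
  wpb c s T P -> T <= T' -> (forall s', P s' -> P' s') -> wpb c s T' P'.
Proof.
by move=> [t [s' [E tT p]]] TT' PP'; exists t, s'; split=> //;
  [apply: leq_trans TT' | apply: PP'].
Qed.

Lemma wpb_seq c1 c2 s T1 T2 P :
  wpb c1 s T1 (fun s1 => wpb c2 s1 T2 P) -> wpb (ASeq c1 c2) s (T1 + T2) P.
Proof.
move=> [t1 [s1 [E1 t1T [t2 [s2 [E2 t2T p]]]]]].
by exists (t1 + t2), s2; split=> //; [apply: AExecSeq E1 E2 | apply: leq_add].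
Qed.

Lemma wpb_if b c1 c2 s T P :
  wpb (if aholds s b then c1 else c2) s T P -> wpb (AIf b c1 c2) s T.+1 P.
Proof. by move=> [t [s' [E tT p]]]; exists t.+1, s'; split=> //; constructor. Qed.

Lemma wpb_while b c (I : nat -> astate Sigma -> Prop) T0 k s P :
  I k s ->
  (forall k s, I k s -> ~~ aholds s b -> P s) ->
  (forall k s, I k s -> aholds s b ->
     exists2 k', k = k'.+1 & wpb c s T0 (I k')) ->
  wpb (AWhile b c) s (k * T0.+1).+1 P.
Proof.
move=> Ik Pend step; elim: k s Ik => [|k IH] s Ik.
  case hb: (aholds s b); first by have [k' //] := step _ _ Ik hb.
  by exists 1, s; split=> //; [constructor; rewrite hb | apply: Pend Ik _; rewrite hb].
case hb: (aholds s b); last first.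
  by exists 1, s; split=> //; [constructor; rewrite hb | apply: Pend Ik _; rewrite hb].
have [_ [<-] [t1 [s1 [E1 t1T Ik1]]]] := step _ _ Ik hb.
have [t2 [s2 [E2 t2T p]]] := IH _ Ik1.
exists (t1 + t2).+1, s2; split=> //; first exact: AExecWhileTrue E1 E2.
lia.
Qed.

(** Symbolic execution of loop-free code. A loop gets the precondition [False], which forces it
    through [wpb_while]. *)
Fixpoint sym c s (P : astate Sigma -> Prop) : Prop :=
  match c with
  | ASkip => P s
  | ASet x e => P (set_rg s x (aeval s e))
  | ASto f e1 e2 => P (set_ar s f (aeval s e1) (aeval s e2))
  | ACpy e1 e2 => P (set_ch s (aeval s e1) (ch s (aeval s e2)))
  | AEmit r e1 e2 e3 => P (put_ou s (r, (aeval s e1, aeval s e2, aeval s e3)))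
  | ASeq c1 c2 => sym c1 s (fun s1 => sym c2 s1 P)
  | AIf b c1 c2 => if aholds s b then sym c1 s P else sym c2 s P
  | AWhile _ _ => False
  end.

Fixpoint cost c : nat :=
  match c with
  | ASeq c1 c2 => cost c1 + cost c2
  | AIf _ c1 c2 => (maxn (cost c1) (cost c2)).+1
  | _ => 1
  end.

Lemma sym_wpb c s P : sym c s P -> wpb c s (cost c) P.
Proof.
elim: c s P => //=.
- by move=> s P p; exists 1, s; split=> //; constructor.
- by move=> x e s P p; do 2!eexists; split; [constructor | | exact: p].
- by move=> f e1 e2 s P p; do 2!eexists; split; [constructor | | exact: p].
- by move=> e1 e2 s P p; do 2!eexists; split; [constructor | | exact: p].
- by move=> r e1 e2 e3 s P p; do 2!eexists; split; [constructor | | exact: p].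
- move=> c1 IH1 c2 IH2 s P /IH1 H1; apply: wpb_seq.
  by apply: wpb_conseq H1 _ _ => // s' /IH2.
- move=> b c1 IH1 c2 IH2 s P p; apply: wpb_if.
  by case: ifP p => _ => [/IH1|/IH2] H; apply: wpb_conseq H _ _ => //;
    rewrite ?leq_maxl ?leq_maxr.
Qed.

Lemma wpb_sym c s T P : sym c s P -> cost c <= T -> wpb c s T P.
Proof. by move=> /sym_wpb H cT; apply: wpb_conseq H cT _. Qed.

Fixpoint mod_rg c : seq nat :=
  match c with
  | ASet x _ => [:: x]
  | ASeq c1 c2 | AIf _ c1 c2 => mod_rg c1 ++ mod_rg c2
  | AWhile _ c1 => mod_rg c1
  | _ => [::]
  end.

Fixpoint mod_ar c : seq nat :=
  match c with
  | ASto f _ _ => [:: f]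
  | ASeq c1 c2 | AIf _ c1 c2 => mod_ar c1 ++ mod_ar c2
  | AWhile _ c1 => mod_ar c1
  | _ => [::]
  end.

Fixpoint mod_ch c : bool :=
  match c with
  | ACpy _ _ => true
  | ASeq c1 c2 | AIf _ c1 c2 => mod_ch c1 || mod_ch c2
  | AWhile _ c1 => mod_ch c1
  | _ => false
  end.

Fixpoint mod_ou c : bool :=
  match c with
  | AEmit _ _ _ _ => true
  | ASeq c1 c2 | AIf _ c1 c2 => mod_ou c1 || mod_ou c2
  | AWhile _ c1 => mod_ou c1
  | _ => false
  end.

(** A syntactic frame rule: specifications mention only what changes, and the rest follows by
    computing which registers and arrays a program writes. *)
Definition framed c s s' : Prop :=
  [/\ forall x, x \notin mod_rg c -> rg s' x = rg s x,
      forall f, f \notin mod_ar c -> ar s' f = ar s f,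
      ~~ mod_ch c -> ch s' = ch s & ~~ mod_ou c -> ou s' = ou s].

Lemma aexec_framed c s t s' : aexec c s t s' -> framed c s s'.
Proof.
elim=> {c s t s'} //=.
- by move=> s x e; split=> //= y; rewrite inE /upd => /negPf->.
- by move=> s f e1 e2; split=> //= g; rewrite inE /upd => /negPf->.
- move=> s1 s2 s3 t1 t2 c1 c2 _ [r1 a1 h1 o1] _ [r2 a2 h2 o2]; split=> /=.
  + by move=> x; rewrite mem_cat negb_or => /andP[x1 x2]; rewrite r2 ?r1.
  + by move=> x; rewrite mem_cat negb_or => /andP[x1 x2]; rewrite a2 ?a1.
  + by rewrite negb_or => /andP[x1 x2]; rewrite h2 ?h1.
  + by rewrite negb_or => /andP[x1 x2]; rewrite o2 ?o1.
- move=> s s' t b c1 c2 _ [r1 a1 h1 o1]; split=> /=.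
  + move=> x; rewrite mem_cat negb_or => /andP[x1 x2]; apply: r1.
    by case: ifP.
  + move=> x; rewrite mem_cat negb_or => /andP[x1 x2]; apply: a1.
    by case: ifP.
  + by rewrite negb_or => /andP[x1 x2]; apply: h1; case: ifP.
  + by rewrite negb_or => /andP[x1 x2]; apply: o1; case: ifP.
- move=> s1 s2 s3 t1 t2 b c _ _ [r1 a1 h1 o1] _ [/= r2 a2 h2 o2].
  split=> /= [x xc|f fc|hc|oc].
  + by rewrite r2 ?r1.
  + by rewrite a2 ?a1.
  + by rewrite h2 ?h1.
  + by rewrite o2 ?o1.
Qed.

Lemma wpb_framed c s T P :
  wpb c s T P -> wpb c s T (fun s' => P s' /\ framed c s s').
Proof.
move=> [t [s' [E tT p]]]; exists t, s'; split=> //; split=> //.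
exact: aexec_framed E.
Qed.

End ArraySemantics.

(** * Suffixes, branching words and net occurrences *)

Section Strings.
Variables (Sigma : finType) (dollar : Sigma).
Implicit Types (S w : seq Sigma) (a b c : Sigma).

(* As in [entry], suffixes and positions are numbered by their distance from
   the right end. *)
Definition suf S m := drop (size S - m) S.
Definition chr S m := nth dollar S (size S - m).

Lemma suf_cons a S m : m <= size S -> suf (a :: S) m = suf S m.
Proof. by move=> mS; rewrite /suf /= subSn. Qed.

Lemma chr_cons a S m : m <= size S -> chr (a :: S) m = chr S m.
Proof. by move=> mS; rewrite /chr /= subSn. Qed.

Lemma chr_cons_size a S : chr (a :: S) (size S).+1 = a.
Proof. by rewrite /chr /= subnn. Qed.

Lemma size_suf S m : m <= size S -> size (suf S m) = m.
Proof. by move=> mS; rewrite size_drop subKn. Qed.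

Lemma suf_size S : suf S (size S) = S.
Proof. by rewrite /suf subnn drop0. Qed.

Lemma nth_suf S m i : i <= m -> m <= size S ->
  nth dollar (suf S m) i = chr S (m - i).
Proof. by move=> im mS; rewrite nth_drop /chr; congr nth; lia. Qed.

Lemma suf_S S m : m < size S -> suf S m.+1 = chr S m.+1 :: suf S m.
Proof.
move=> mS; rewrite /suf /chr (drop_nth dollar); last by lia.
by congr (_ :: drop _ _); lia.
Qed.

Lemma chr_mem S m : 0 < m -> m <= size S -> chr S m \in S.
Proof.
move=> m0 mS; apply: mem_nth; rewrite ltn_subrL m0.
exact: leq_trans m0 mS.
Qed.

Lemma take_suf_S S m d : d < m -> m <= size S ->
  take d.+1 (suf S m) = rcons (take d (suf S m)) (chr S (m - d)).
Proof.
by move=> dm mS; rewrite (take_nth dollar) ?nth_suf ?size_suf // ltnW.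
Qed.

Lemma prefix_eq_take w s : prefix w s -> w = take (size w) s.
Proof. by rewrite prefixE => /eqP->. Qed.

Lemma prefix_take_le (s : seq Sigma) i j : i <= j -> prefix (take i s) (take j s).
Proof. by move=> ij; rewrite -(take_takel s ij) prefix_take. Qed.

Lemma prefix_le_take w u s : prefix w s -> prefix u s -> size w <= size u ->
  prefix w u.
Proof.
move=> /prefix_eq_take Ew /prefix_eq_take Eu h.
by rewrite prefixE Eu take_takel // -Ew.
Qed.

Lemma infix_sufP w S :
  reflect (exists2 m, m <= size S & prefix w (suf S m)) (infix w S).
Proof.
apply: (iffP idP) => [/infixP|].
  move=> [p [s ->]].
  exists (size (w ++ s)); first by rewrite [X in _ <= X]size_cat leq_addl.
  rewrite /suf [size (p ++ _)]size_cat addnK drop_size_cat //.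
  exact: prefix_prefix.
case=> m mS /prefixP[s E]; apply/infixP.
by exists (take (size S - m) S), s; rewrite -E cat_take_drop.
Qed.

(** These words are the internal nodes of the suffix tree. The empty word is included so that the
    root is explicit even when only one character has been read. *)
Definition branching S w : bool :=
  (w == [::]) ||
  [exists b, exists c, [&& b != c, infix (rcons w b) S & infix (rcons w c) S]].

Lemma branchingP S w :
  reflect (w = [::] \/
           exists b c, [/\ b != c, infix (rcons w b) S & infix (rcons w c) S])
          (branching S w).
Proof.
apply: (iffP orP) => [[/eqP->|/existsP[b /existsP[c /and3P[bc bS cS]]]]|].
- by left.
- by right; exists b, c.
case=> [->|[b [c [bc bS cS]]]]; first by left.
by right; apply/existsP; exists b; apply/existsP; exists c; rewrite bc bS cS.
Qed.

Lemma branching_nil S : branching S [::].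
Proof. by []. Qed.

(** Suffix links lead from explicit nodes to explicit nodes; the amortized analysis rests on
    this. *)
Lemma branching_behead S a w : branching S (a :: w) -> branching S w.
Proof.
case/branchingP=> // [[b [c [bc]]]]; rewrite !rcons_cons => bS cS.
by apply/branchingP; right; exists b, c; rewrite (consl_infix bS) (consl_infix cS).
Qed.

Lemma branching_consW S a w : branching S w -> branching (a :: S) w.
Proof.
case/branchingP=> [->|[b [c [bc bS cS]]]] //.
by apply/branchingP; right; exists b, c; rewrite !infix_consl bS cS !orbT.
Qed.

Lemma infix_take_suf S m d : m <= size S -> infix (take d (suf S m)) S.
Proof. by move=> mS; apply/infix_sufP; exists m => //; apply: prefix_take. Qed.

Lemma branching_split S m m' d : d < m <= size S -> d < m' <= size S ->
  take d (suf S m) = take d (suf S m') -> chr S (m - d) != chr S (m' - d) ->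
  branching S (take d (suf S m)).
Proof.
move=> /andP[dm mS] /andP[dm' m'S] E nc; apply/branchingP; right.
exists (chr S (m - d)), (chr S (m' - d)); split=> //.
  by rewrite -take_suf_S // infix_take_suf.
by rewrite E -take_suf_S // infix_take_suf.
Qed.

Lemma branching_repeat S w : 0 < size S -> branching S w ->
  exists m m', [/\ m <= size S, m' <= size S, m != m', prefix w (suf S m)
                 & prefix w (suf S m')].
Proof.
move=> S0 /branchingP[->|[b [c [bc /infix_sufP[m mS bm] /infix_sufP[m' mS' cm]]]]].
  by exists 0, 1; rewrite !prefix0s.
exists m, m'; split=> //.
- apply/eqP=> E; subst m'; move/prefix_eq_take: bm; move/prefix_eq_take: cm.
  by rewrite !size_rcons => <- /rcons_inj[E]; rewrite E eqxx in bc.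
- by apply: prefix_trans bm; apply: prefix_rcons.
- by apply: prefix_trans cm; apply: prefix_rcons.
Qed.

Lemma split_point (s t : seq Sigma) : ~~ prefix s t -> ~~ prefix t s ->
  exists d, [/\ d < size s, d < size t, take d s = take d t
              & nth dollar s d != nth dollar t d].
Proof.
elim: s t => [|x s IH] [|y t] //=; rewrite ?prefix0s //.
case: (x =P y) => [->|/eqP nxy]; last by exists 0.
rewrite eqxx /= => st ts; have [d [ds dt E n]] := IH _ st ts.
by exists d.+1; split=> //=; rewrite E.
Qed.

Definition terminated S := exists2 T, S = rcons T dollar & dollar \notin T.

Lemma terminated_cons a S : a != dollar -> terminated S -> terminated (a :: S).
Proof.
move=> ad [T -> dT]; exists (a :: T) => //.
by rewrite inE negb_or eq_sym ad.
Qed.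

Lemma terminated_size S : terminated S -> 0 < size S.
Proof. by move=> [T -> _]; rewrite size_rcons. Qed.

Lemma terminated_chr S m : terminated S -> 0 < m <= size S ->
  (chr S m == dollar) = (m == 1).
Proof.
move=> [T -> dT] /andP[m0]; rewrite size_rcons => mT.
rewrite /chr size_rcons nth_rcons; case: (m =P 1) => [->|/eqP m1].
  by rewrite subn1 /= ltnn !eqxx.
have lt : (size T).+1 - m < size T by lia.
rewrite lt; apply/negP => /eqP E; move/negP: dT; apply.
by rewrite -E mem_nth.
Qed.

Lemma suf_not_prefix S m m' : terminated S -> 0 < m <= size S -> m' <= size S ->
  m != m' -> ~~ prefix (suf S m) (suf S m').
Proof.
move=> tS /andP[m0 mS] mS' nm; apply/negP=> p.
have sz := size_prefix p; rewrite !size_suf // in sz.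
(* Index [m.-1] of the suffix of length [m] holds the end-marker; in the suffix of length [m'] the
   same index holds it only if [m' = m]. *)
have E : nth dollar (suf S m) m.-1 = nth dollar (suf S m') m.-1.
  case/prefixP: p => s ->; rewrite nth_cat size_suf //.
  by rewrite (_ : m.-1 < m) //; lia.
rewrite !nth_suf // in E; try lia.
have /eqP e1 : chr S (m - m.-1) == dollar by rewrite terminated_chr //; lia.
have : chr S (m' - m.-1) == dollar by rewrite -E e1.
by rewrite terminated_chr //; lia.
Qed.

Lemma suf_split S m m' : terminated S -> 0 < m <= size S -> 0 < m' <= size S ->
  m != m' ->
  exists d, [/\ d < m, d < m', take d (suf S m) = take d (suf S m')
              & chr S (m - d) != chr S (m' - d)].
Proof.
move=> tS /andP[m0 mS] /andP[m0' mS'] nm.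
have [||d [dm dm' E n]] := @split_point (suf S m) (suf S m').
- by apply: suf_not_prefix => //; rewrite m0.
- by apply: suf_not_prefix => //; [rewrite m0'|rewrite eq_sym].
rewrite !size_suf // in dm dm'; exists d; split=> //.
by move: n; rewrite !nth_suf // ltnW.
Qed.

(** [D] is the length of the longest prefix of [a :: S] that occurs in [S]. A shorter prefix gains
    no right extension, since its extended form is in [S] already, and a longer one occurs just
    once; hence at most one word starts to branch. *)
Lemma branching_cons a S D w : a != dollar -> terminated S ->
  D <= size S -> infix (take D (a :: S)) S -> ~~ infix (take D.+1 (a :: S)) S ->
  branching (a :: S) w <-> branching S w \/ w = take D (a :: S).
Proof.
move=> ad tS DS inD ninD; set X := a :: S.
have tX : terminated X by apply: terminated_cons.
have old u : infix u S -> prefix u X -> size u <= D.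
  move=> uS /prefix_eq_take uX; rewrite leqNgt; apply/negP=> Du.
  move/negP: ninD; apply; rewrite -/X.
  apply: prefix_infix_trans uS; rewrite uX; exact: prefix_take_le.
have key u x y : infix (rcons u x) X -> ~~ infix (rcons u x) S ->
    infix (rcons u y) X -> x != y -> u = take D X.
  rewrite {1 3}/X !infix_consl => /orP[px|->//] nx /orP[py|iy] xy.
    move/prefix_eq_take: px; move/prefix_eq_take: py.
    by rewrite !size_rcons => <- /rcons_inj[E]; rewrite E eqxx in xy.
  have pu : prefix u X by apply: prefix_trans px; apply: prefix_rcons.
  have iu : infix u S by apply: prefix_infix_trans iy; apply: prefix_rcons.
  have lu := old _ iu pu.
  suff -> : D = size u by apply: prefix_eq_take.
  apply/eqP; rewrite eqn_leq lu andbT leqNgt; apply/negP=> uD.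
  move/negP: nx; apply; apply: prefix_infix_trans inD.
  rewrite (prefix_eq_take px) size_rcons; exact: prefix_take_le.
split.
  case/branchingP=> [->|[x [y [xy ix iy]]]]; first by left.
  case: (boolP (infix (rcons w x) S)) => jx; last by right; apply: key ix jx iy xy.
  case: (boolP (infix (rcons w y) S)) => jy.
    by left; apply/branchingP; right; exists x, y.
  by right; apply: key iy jy ix _; rewrite eq_sym.
case=> [|->]; first exact: branching_consW.
have [->|D0] := posnP D; first by rewrite take0.
case/infix_sufP: (inD) => m mS pm.
have szD : size (take D X) = D by rewrite size_takel //= ltnW.
have Em : take D X = take D (suf S m) by rewrite {1}(prefix_eq_take pm) szD.
(* If the occurrence reached the end of [S], a suffix of [S] would be a proper prefix of [X],
   against the end-marker. *)
have Dm : D < m.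
  have sz := size_prefix pm; rewrite szD size_suf // in sz.
  rewrite ltn_neqAle sz andbT; apply/eqP=> E; subst m.
  have E2 : take D X = suf S D.
    by rewrite Em take_oversize // size_suf.
  have nE : D != size X by rewrite /= neq_ltn ltnS DS.
  have DX : 0 < D <= size X by rewrite D0 /= leqW.
  have := suf_not_prefix tX DX (leqnn _) nE.
  by rewrite suf_size suf_cons // -E2 prefix_take.
have ne : chr X ((size X) - D) != chr X (m - D).
  apply/negP=> /eqP E; move/negP: ninD; apply; apply/infix_sufP; exists m => //.
  rewrite -(suf_size (a :: S)) take_suf_S //= ?ltnS // suf_size -/X.
  rewrite (_ : (size S).+1 = size X) // E chr_cons; last by lia.
  by rewrite Em -take_suf_S // prefix_take.
have := @branching_split X (size X) m D; rewrite suf_size; apply=> //.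
- by rewrite /= ltnS DS leqnn.
- by rewrite Dm /= ltnW.
by rewrite suf_cons.
Qed.

(** * Occurrences and net frequency *)

Lemma occ_ge2P S w :
  reflect (exists m m', [/\ m <= size S, m' <= size S, m != m',
             prefix w (suf S m) & prefix w (suf S m')]) (1 < occ S w).
Proof.
apply: (iffP card_gt1P) => [[i [j [iA jA nij]]]|[m [m' [mS mS' nm pm pm']]]].
  rewrite !inE -!prefixE in iA jA.
  have iS := ltn_ord i; have jS := ltn_ord j.
  exists (size S - i), (size S - j); rewrite /suf !subKn; try lia.
  split=> //; try lia.
  by apply: contra nij => /eqP E; apply/eqP/val_inj => /=; lia.
have lt k : k <= size S -> size S - k < (size S).+1 by lia.
exists (Ordinal (lt m mS)), (Ordinal (lt m' mS')); rewrite !inE -!prefixE /=.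
by split=> //; apply: contra nm => /eqP [E]; apply/eqP; lia.
Qed.

Lemma occ_eq1P S w :
  reflect (exists m, [/\ m <= size S, prefix w (suf S m) &
             forall m', m' <= size S -> prefix w (suf S m') -> m' = m])
          (occ S w == 1).
Proof.
have lt k : k <= size S -> size S - k < (size S).+1 by lia.
apply: (iffP idP) => [/cards1P[i E]|[m [mS pm um]]].
  have : i \in [set i] by rewrite inE.
  rewrite -E inE -prefixE => pi; have iS := ltn_ord i.
  exists (size S - i); rewrite /suf subKn; last by lia.
  split=> //; first by lia.
  move=> m' mS' pm'; have : Ordinal (lt _ mS') \in [set i].
    by rewrite -E inE -prefixE.
  by rewrite inE => /eqP/(congr1 val) /= <-; lia.
apply/cards1P; exists (Ordinal (lt _ mS)).
apply/setP=> i; rewrite !inE -prefixE; have iS := ltn_ord i.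
apply/idP/eqP => [pi|-> //].
apply/val_inj => /=; rewrite -(um (size S - i)); try lia.
by rewrite /suf subKn //; lia.
Qed.

Definition uniquely S w m : Prop :=
  forall m', m' <= size S -> prefix w (suf S m') -> m' = m.

(* [l m] is the length of the longest prefix of the [m]-th suffix occurring
   elsewhere (the string depth of the parent of leaf [m]). *)
Definition repeat_lengths S (l : nat -> nat) : Prop :=
  forall m, 0 < m <= size S ->
  [/\ l m < m,
      exists m', [/\ m' <= size S, m' != m & prefix (take (l m) (suf S m)) (suf S m')]
    & uniquely S (take (l m).+1 (suf S m)) m].

(* The right extension of [w] at [m] is unique by maximality of [l m], the left
   one because it is longer than [l (m + 1)]. *)
Definition net S l w m : bool :=
  (take (l m) (suf S m) == w) && (l m.+1 <= l m).

Lemma uniquely_prefix S u w m : prefix u w -> uniquely S u m -> uniquely S w m.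
Proof. by move=> uw uu m' mS pm; apply: uu => //; apply: prefix_trans uw pm. Qed.

Lemma net_unique S l w m : repeat_lengths S l -> 0 < m < size S -> net S l w m ->
  [/\ size w = l m, prefix w (suf S m), uniquely S (rcons w (chr S (m - l m))) m
    & uniquely S (chr S m.+1 :: w) m.+1].
Proof.
move=> rl /andP[m0 mS] /andP[/eqP<- ll].
have [|lm _ um] := rl m; first by rewrite m0 ltnW.
have [|lm' _ um'] := rl m.+1; first by [].
split; first by rewrite size_takel // size_suf ltnW // ltnW.
- exact: prefix_take.
- by rewrite -take_suf_S // ltnW.
apply: uniquely_prefix um'; rewrite suf_S //= eqxx /=.
exact: prefix_take_le.
Qed.

(** The pairs in [Phi] correspond to net occurrences: a position gives the characters on both sides,
    and a pair gives the position back because [x :: w] occurs once. The range stops before the full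
    length since a net occurrence has a left neighbour. *)
Lemma nf_count S l w : terminated S -> repeat_lengths S l -> repeat S w ->
  nf S w = count (net S l w) (iota 1 (size S).-1).
Proof.
move=> tS rl /occ_ge2P rw.
pose f m := (chr S m.+1, chr S (m - l m)).
have dom m : m \in iota 1 (size S).-1 -> 0 < m < size S.
  by rewrite mem_iota; have := terminated_size tS; lia.
have U : uniq [seq f m | m <- iota 1 (size S).-1 & net S l w m].
  rewrite map_inj_in_uniq ?filter_uniq ?iota_uniq // => m m'.
  rewrite !mem_filter => /andP[nm /dom dm] /andP[nm' /dom dm'] [E _].
  have [_ _ _ u] := net_unique rl dm nm.
  have [_ p' _ _] := net_unique rl dm' nm'.
  have : m'.+1 = m.+1; last by case.
  case/andP: dm' => m0' mS'; apply: u => //.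
  by rewrite E suf_S //= eqxx.
rewrite -size_filter -(size_map f) -(card_uniqP U) /nf.
apply: eq_card => -[x y]; rewrite inE /=; apply/and3P/mapP.
  case=> /occ_eq1P[k [kS pk uk]] /occ_eq1P[k' [kS' pk' uk']] /occ_eq1P[m [mS pm um]].
  case: k kS pk uk => [|k] kS pk uk; first by have := size_prefix pk; rewrite size_suf.
  rewrite suf_S //= in pk; case/andP: pk => /eqP xk pk.
  have ? : k = m by apply: um => //; rewrite ltnW.
  subst k; have pw : prefix w (suf S m) by apply: prefix_trans pk; apply: prefix_rcons.
  have sw := size_prefix pm; rewrite size_rcons size_suf // in sw.
  have m0 : 0 < m by lia.
  have [|lm [m' [mS' nm' pm']] ulm] := rl m; first by rewrite m0.
  have wE := prefix_eq_take pw.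
  (* [w] repeats, so it is no longer than the longest repeated prefix; followed by [y] it is unique,
     so it is no shorter. *)
  have sl : size w = l m.
    apply/eqP; rewrite eqn_leq; apply/andP; split.
      rewrite leqNgt; apply/negP=> lw.
      case: rw => m1 [m2 [m1S m2S n12 p1 p2]].
      have pre : prefix (take (l m).+1 (suf S m)) w by rewrite wE prefix_take_le.
      have e1 := ulm _ m1S (prefix_trans pre p1).
      have e2 := ulm _ m2S (prefix_trans pre p2).
      by rewrite e1 e2 eqxx in n12.
    rewrite -ltnS ltnNge; apply/negP=> lw; case/eqP: nm'; apply: um => //.
    rewrite (prefix_eq_take pm) size_rcons.
    by apply: prefix_trans pm'; apply: prefix_take_le.
  have yE : y = chr S (m - l m).
    have := prefix_eq_take pm; rewrite size_rcons take_suf_S // -wE sl.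
    by move/rcons_inj => [].
  exists m; last by rewrite /f -yE xk.
  rewrite mem_filter mem_iota /net -sl -wE eqxx /=; apply/andP; split; last by lia.
  (* A larger [l m.+1] would make [x :: w] a prefix of a repeated word, but [x :: w] occurs only
     once. *)
  have [|lm1 [m1 [m1S nm1 pm1]] ulm1] := rl m.+1; first by [].
  rewrite sl leqNgt; apply/negP=> ll.
  have E1 : k' = m.+1 by symmetry; apply: uk' => //; rewrite suf_S //= xk eqxx.
  case/eqP: nm1; rewrite -E1; apply: uk' => //.
  apply: prefix_trans pm1; rewrite suf_S // xk {1}wE sl.
  by case: (l m.+1) ll => //= ? ?; rewrite eqxx prefix_take_le.
case=> m; rewrite mem_filter => /andP[nm /dom dm] [-> ->].
have [sw pw u1 u2] := net_unique rl dm nm; case/andP: dm => m0 mS.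
have [|lm _ _] := rl m; first by rewrite m0 ltnW.
have pw1 : prefix (rcons w (chr S (m - l m))) (suf S m).
  by rewrite {1}(prefix_eq_take pw) sw -take_suf_S ?prefix_take // ltnW.
split; apply/occ_eq1P.
- exists m.+1; split=> //; first by rewrite suf_S //= eqxx.
  by apply: uniquely_prefix u2; rewrite /= eqxx prefix_rcons.
- by exists m.+1; split=> //; rewrite suf_S //= eqxx.
- by exists m; split=> //; rewrite ltnW.
Qed.

(** A net occurrence is the only one with its left neighbour and the only one with its right
    neighbour, so on each side a second occurrence of [w] has a different neighbour or touches the
    end of [S]. *)
Lemma nf_gt0_maximal S w : repeat S w -> 0 < nf S w -> maximal_repeat S w.
Proof.
move=> rw /card_gt0P[[x y]]; rewrite inE /= => /and3P[_ /occ_eq1P[k [kS pk uk]]].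
case/occ_eq1P=> k' [kS' pk' uk']; rewrite /maximal_repeat rw /=.
case/occ_ge2P: rw => m [m' [mS mS' nm pm pm']].
have occ0 u i : i <= size S -> prefix u (suf S i) -> 0 < occ S u.
  move=> iS pu; have lt : size S - i < (size S).+1 by lia.
  by apply/card_gt0P; exists (Ordinal lt); rewrite inE -prefixE.
apply/andP; split.
  case: k kS pk uk => [|k] kS pk uk; first by have := size_prefix pk; rewrite size_suf.
  have [i [iS ni pi]] : exists i, [/\ i <= size S, i != k & prefix w (suf S i)].
    case: (m =P k) => [E|/eqP E]; last by exists m.
    by exists m'; split=> //; rewrite -E eq_sym.
  have [/eqP E|ltS] := boolP (i == size S).
    by rewrite /left_maximal -(suf_size S) -E pi.
  rewrite /left_maximal; apply/orP; right.
  have iS1 : i < size S by rewrite ltn_neqAle ltS.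
  have pi1 : prefix (chr S i.+1 :: w) (suf S i.+1) by rewrite suf_S //= eqxx.
  apply/existsP; exists x; apply/existsP; exists (chr S i.+1); apply/and3P; split.
  - apply: contra ni => /eqP E; apply/eqP; apply: succn_inj.
    by apply: uk => //; rewrite E.
  - exact: occ0 pk.
  - exact: occ0 pi1.
have [i [iS ni pi]] : exists i, [/\ i <= size S, i != k' & prefix w (suf S i)].
  case: (m =P k') => [E|/eqP E]; last by exists m.
  by exists m'; split=> //; rewrite -E eq_sym.
have si := size_prefix pi; rewrite size_suf // in si.
have [/eqP E|ltS] := boolP (size w == i).
  rewrite /right_maximal; apply/orP; left.
  rewrite (prefix_eq_take pi) E take_oversize ?size_suf // /suf.
  by apply/suffixP; exists (take (size S - i) S); rewrite cat_take_drop.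
rewrite /right_maximal; apply/orP; right.
have wi : size w < i by rewrite ltn_neqAle ltS.
have pi1 : prefix (rcons w (chr S (i - size w))) (suf S i).
  by rewrite {1}(prefix_eq_take pi) -take_suf_S ?prefix_take.
apply/existsP; exists y; apply/existsP; exists (chr S (i - size w)).
apply/and3P; split.
- by apply: contra ni => /eqP E; apply/eqP; apply: uk' => //; rewrite E.
- exact: occ0 pk'.
- exact: occ0 pi1.
Qed.

Lemma PNFE S w f : (w, f) \in PNF S = [&& repeat S w, f == nf S w & 0 < nf S w].
Proof.
rewrite inE /=; apply/and3P/and3P => -[h1 h2 h3]; split=> //.
  by case/and3P: h1.
exact: nf_gt0_maximal.
Qed.

End Strings.

(** * Dictionaries *)

Infix ";;" := ASeq (at level 60, right associativity).

Definition upd2 (m : nat -> nat -> nat) v k x := upd m v (upd (m v) k x).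

Lemma upd_same (A : Type) (f : nat -> A) x v : upd f x v x = v.
Proof. by rewrite /upd eqxx. Qed.

Lemma upd_other (A : Type) (f : nat -> A) x v y : y <> x -> upd f x v y = f y.
Proof. by rewrite /upd => /eqP/negPf->. Qed.

Lemma upd2_same m v k x : upd2 m v k x v k = x.
Proof. by rewrite /upd2 !upd_same. Qed.

Lemma upd2_other m v k x v' k' : (v', k') <> (v, k) -> upd2 m v k x v' k' = m v' k'.
Proof.
rewrite /upd2 /upd => ne; case: (v' =P v) => // ev.
by case: (k' =P k) => // ek; subst.
Qed.

Lemma subn_half_odd n : n - 2 * n./2 = odd n.
Proof. lia. Qed.

Lemma modn_pow2S x y d : x = y %[mod 2 ^ d] ->
  odd (x %/ 2 ^ d) = odd (y %/ 2 ^ d) -> x = y %[mod 2 ^ d.+1].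
Proof.
have E z : z %% 2 ^ d.+1 = odd (z %/ 2 ^ d) * 2 ^ d + z %% 2 ^ d.
  have p : 0 < 2 ^ d by rewrite expn_gt0.
  have lt := ltn_pmod z p.
  rewrite {1}(divn_eq z (2 ^ d)) -{1}(odd_double_half (z %/ 2 ^ d)).
  set q := (z %/ 2 ^ d)./2; set b := odd _; set r := z %% _.
  have -> : (b + q.*2) * 2 ^ d + r = q * 2 ^ d.+1 + (b * 2 ^ d + r).
    by rewrite expnS -muln2; lia.
  rewrite modnMDl modn_small // expnS.
  by move: lt; rewrite -/r; case: b; rewrite ?mul1n ?mul0n; lia.
by move=> h1 h2; rewrite !E h1 h2.
Qed.

(* Each dictionary is a digital search tree: an entry [e] at depth [d] agrees
   with every key searched through it on the [d] low-order bits, so no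
   rebalancing is needed. Slot [3 v] of [h] holds the root of dictionary [v],
   slots [3 e + 1] and [3 e + 2] the children of entry [e]. *)
Fixpoint dslot (h : nat -> nat) v k d : nat :=
  if d is d'.+1 then 3 * h (dslot h v k d') + 1 + odd (k %/ 2 ^ d') else 3 * v.

(* [ow] and [dep] (owner and depth of an entry) are ghosts. *)
Record dict_inv (h key val : nat -> nat) (D Kmax : nat) (ow dep : nat -> nat)
    (m : nat -> nat -> nat) : Prop := DictInv {
  di_pos : 0 < D;
  di_root : forall v, h (3 * v) <> 0 ->
    [/\ h (3 * v) < D, ow (h (3 * v)) = v & dep (h (3 * v)) = 0];
  di_child : forall e (b : bool), let f := h (3 * e + 1 + b) in f <> 0 ->
    [/\ 0 < e < D, f < D, ow f = ow e, dep f = (dep e).+1 &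
        key f = key e %[mod 2 ^ dep e] /\ odd (key f %/ 2 ^ dep e) = b];
  di_find : forall e, 0 < e < D ->
    h (dslot h (ow e) (key e) (dep e)) = e /\
    (forall i, i < dep e -> h (dslot h (ow e) (key e) i) <> 0);
  di_uniq : forall e e', 0 < e < D -> 0 < e' < D -> ow e = ow e' ->
    key e = key e' -> e = e';
  di_val : forall e, 0 < e < D -> m (ow e) (key e) = val e /\ val e <> 0;
  di_some : forall v k, m v k <> 0 -> exists e, [/\ 0 < e < D, ow e = v & key e = k];
  di_key : forall e, 0 < e < D -> key e <= Kmax;
  di_val0 : val 0 = 0 }.

(** The slot [s] is recorded even when the search fails: it is then the empty slot that a new entry
    will fill. *)
Definition found (h key : nat -> nat) (D : nat) (ow : nat -> nat)
    (m : nat -> nat -> nat) v k s e : Prop :=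
  exists d, [/\ s = dslot h v k d, h s = e,
    forall i, i < d -> h (dslot h v k i) <> 0,
    e <> 0 -> [/\ 0 < e < D, ow e = v & key e = k]
  & e = 0 -> m v k = 0].

Section Dictionary.
Variables (h key val : nat -> nat) (D Kmax : nat) (ow dep : nat -> nat).
Variable m : nat -> nat -> nat.
Hypothesis inv : dict_inv h key val D Kmax ow dep m.

Lemma dslot_label v k d : (forall i, i <= d -> h (dslot h v k i) <> 0) ->
  let f := h (dslot h v k d) in
  [/\ 0 < f < D, ow f = v, dep f = d & key f = k %[mod 2 ^ d]].
Proof.
elim: d => [|d IH] nz /=.
  have [|lt o dp] := di_root inv (v := v); first exact: (nz 0).
  split=> //; last by rewrite expn0 !modn1.
  by rewrite lt andbT lt0n; apply/eqP; apply: (nz 0).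
have [|eD oe de ke] := IH; first by move=> i id; apply: nz; apply: leqW.
set e := h (dslot h v k d) in eD oe de ke *.
have [|_ fD of_ df [kf bf]] :=
  @di_child _ _ _ _ _ _ _ _ inv e (odd (k %/ 2 ^ d)).
  exact: (nz d.+1).
split; rewrite ?of_ ?df ?de //.
  by rewrite fD andbT lt0n; apply/eqP; apply: (nz d.+1).
rewrite de in kf bf; apply: modn_pow2S; first by rewrite kf.
by rewrite bf.
Qed.

Lemma found_val v k s e : found h key D ow m v k s e -> val e = m v k.
Proof.
move=> [d [_ _ _ he h0]]; case: (e =P 0) => [e0|/he[eD <- <-]].
  by rewrite e0 (di_val0 inv) h0.
by have [] := di_val inv eD.
Qed.

Lemma dict_insert v k s x : found h key D ow m v k s 0 -> x <> 0 -> k <= Kmax ->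
  exists ow' dep', dict_inv (upd h s D) (upd key D k) (upd val D x) D.+1 Kmax
    ow' dep' (upd2 m v k x).
Proof.
move=> [d [Es hs nz _ m0]] x0 kK; have D0 := di_pos inv.
pose h' := upd h s D.
(* The slot [s] was empty, so a path whose earlier slots are all filled does not pass through it and
   survives the update. *)
have slot_same v' k' j : (forall i, i < j -> h (dslot h v' k' i) <> 0) ->
    dslot h' v' k' j = dslot h v' k' j.
  elim: j => //= j IH nz'; rewrite IH; last by move=> i ij; apply: nz'; apply: leqW.
  by rewrite /h' upd_other // => E; have := nz' j (leqnn _); rewrite E.
(* Below the root, the filled slot is a child slot of a known entry; root slots and child slots
   differ modulo 3. *)
have par : d <> 0 -> exists e, [/\ s = 3 * e + 1 + odd (k %/ 2 ^ d.-1), 0 < e < D,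
    ow e = v, dep e = d.-1 & key e = k %[mod 2 ^ d.-1]].
  case: d Es nz => // d Es nz _; exists (h (dslot h v k d)).
  have [|eD oe de ke] := @dslot_label v k d; first by move=> i id; apply: nz.
  by split.
have nm e : 0 < e < D -> ow e = v -> key e = k -> False.
  by move=> eD oe ke; have [] := di_val inv eD; rewrite oe ke m0 // => <-.
exists (upd ow D v), (upd dep D d); split.
- by [].
- move=> u; rewrite -/h' /h'; case: (3 * u =P s) => [E|nE].
    rewrite E upd_same => _; rewrite !upd_same.
    case: (d =P 0) => [d0|/par[e [se _ _ _ _]]]; last by exfalso; lia.
    by split=> //; move: Es; rewrite d0 /=; lia.
  rewrite upd_other // => nz'; have [lt o dp] := di_root inv nz'.
  by rewrite !upd_other; [split=> //; exact: leqW | lia | lia].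
- move=> e b; case: (3 * e + 1 + b =P s) => [E|nE] /=.
    rewrite E upd_same => _; case: (d =P 0) => [d0|].
      by move: Es; rewrite d0 /=; lia.
    move=> dn; have [e' [se eD oe de ke]] := par dn.
    have [ee bb] : e = e' /\ b = odd (k %/ 2 ^ d.-1).
      by move: E; rewrite se; case: (b); case: (odd _); lia.
    subst e'; rewrite !upd_same !(@upd_other _ _ D _ e); try lia.
    rewrite oe de bb ke; split=> //; [lia|lia].
  rewrite upd_other // => nz'; have [eD fD of_ df [kf bf]] := di_child inv nz'.
  by rewrite !upd_other; try lia; split=> //; lia.
- move=> e eD; case: (e =P D) => [->|nE].
    rewrite !upd_same -/h' slot_same // -Es; split; first exact: upd_same.
    move=> i id; rewrite slot_same; last by move=> j ji; apply: nz; lia.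
    rewrite /h' upd_other; first exact: nz.
    by move=> E; have := nz i id; rewrite E.
  have {}eD : 0 < e < D by lia.
  rewrite !(@upd_other _ _ D _ e) // -/h'.
  have [he nze] := di_find inv eD; rewrite slot_same //; split.
    by rewrite /h' upd_other // => E; move: he; rewrite E hs; lia.
  move=> i id; rewrite slot_same; last by move=> j ji; apply: nze; lia.
  rewrite /h' upd_other; first exact: nze.
  by move=> E; have := nze i id; rewrite E.
- move=> e e' eD eD'; rewrite /upd.
  case: (e =P D) => [->|nE]; case: (e' =P D) => [->|nE'] //.
  + by move=> o1 k1; exfalso; apply: (@nm e'); rewrite ?o1 ?k1 //; lia.
  + by move=> o1 k1; exfalso; apply: (@nm e); rewrite ?o1 ?k1 //; lia.
  by apply: (di_uniq inv); lia.
- move=> e eD; case: (e =P D) => [->|nE]; first by rewrite !upd_same upd2_same.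
  have {}eD : 0 < e < D by lia.
  rewrite !(@upd_other _ _ D _ e) // upd2_other; first exact: (di_val inv).
  by case=> o1 k1; apply: (@nm e).
- move=> v' k'; case: ((v', k') =P (v, k)) => [[-> ->]|ne].
    by exists D; rewrite !upd_same; split=> //; lia.
  rewrite upd2_other // => /(di_some inv)[e [eD oe ke]].
  by exists e; rewrite !upd_other; try lia; split=> //; lia.
- move=> e eD; rewrite /upd; case: eqP => // nE.
  by apply: (di_key inv); lia.
- by rewrite upd_other; [exact: (di_val0 inv) | lia].
Qed.

Lemma dict_change v k s e x : found h key D ow m v k s e -> e <> 0 -> x <> 0 ->
  dict_inv h key (upd val e x) D Kmax ow dep (upd2 m v k x).
Proof.
move=> [d [_ _ _ he _]] e0 x0; have [eD oe ke] := he e0.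
case: inv => i1 i2 i3 i4 i5 i6 i7 i8 i9; split=> //.
- move=> f fD; case: (f =P e) => [->|nE].
    by rewrite oe ke upd_same upd2_same.
  rewrite upd_other // upd2_other; first exact: i6.
  by case=> o1 k1; apply: nE; apply: i5; rewrite ?oe ?ke.
- move=> v' k'; case: ((v', k') =P (v, k)) => [[-> ->]|ne]; first by exists e.
  by rewrite upd2_other //; apply: i7.
- by rewrite upd_other; lia.
Qed.

End Dictionary.

(* Searches key [r7] in dictionary [r6]; returns the last slot in [r8] and its
   entry (0 if none) in [r9]. *)
Definition find_step : acmd :=
  ASet 8 (AAdd (AAdd (AMul 3 (AReg 9)) (ACst 1))
               (ASub (AReg 10) (AMul 2 (AHalf (AReg 10))))) ;;
  ASet 10 (AHalf (AReg 10)) ;;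
  ASet 9 (AFld 10 (AReg 8)).

Definition dict_find : acmd :=
  ASet 8 (AMul 3 (AReg 6)) ;;
  ASet 10 (AReg 7) ;;
  ASet 9 (AFld 10 (AReg 8)) ;;
  AWhile (AAnd (ANot (AEq (AReg 9) (ACst 0)))
               (ANot (AEq (AFld 11 (AReg 9)) (AReg 7)))) find_step.

(* Counters are clamped, [b - (b - e) = min b e], so that the static bounds on
   registers and arrays are evident from the program text. *)
Definition AMin (e b : aexpr) : aexpr := ASub b (ASub b e).

Definition dict_add : acmd :=
  ASto 10 (AReg 8) (AReg 4) ;;
  ASto 11 (AReg 4) (AReg 7) ;;
  ASto 12 (AReg 4) (AReg 11) ;;
  ASet 4 (AMin (AAdd (AReg 4) (ACst 1)) (AMul 4 (AReg 1))).

Section DictProgram.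
Variables (disp : Order.disp_t) (Sigma : finOrderType disp).
Implicit Types s : astate Sigma.

Definition dict_state s Kmax ow dep m :=
  dict_inv (ar s 10) (ar s 11) (ar s 12) (rg s 4) Kmax ow dep m.

Lemma dict_find_spec s Kmax L ow dep m :
  dict_state s Kmax ow dep m -> Kmax < 2 ^ L -> rg s 7 <= Kmax ->
  wpb dict_find s (4 * L + 4) (fun s' =>
    found (ar s 10) (ar s 11) (rg s 4) ow m (rg s 6) (rg s 7) (rg s' 8) (rg s' 9)).
Proof.
move=> inv KL kK.
pose v := rg s 6; pose k := rg s 7; pose h := ar s 10.
have -> : 4 * L + 4 = 1 + (1 + (1 + (L * 4).+1)) by lia.
do 3![apply: wpb_seq; apply: wpb_sym => //=].
pose I (j : nat) s' := framed dict_find s s' /\ exists d,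
  [/\ j + d = L, rg s' 8 = dslot h v k d, rg s' 9 = h (rg s' 8),
      rg s' 10 = k %/ 2 ^ d & forall i, i < d ->
        h (dslot h v k i) <> 0 /\ ar s 11 (h (dslot h v k i)) <> k].
have fr s' (F : framed dict_find s s') :
    [/\ rg s' 6 = v, rg s' 7 = k, rg s' 4 = rg s 4, ar s' 10 = h & ar s' 11 = ar s 11].
  by case: F => R A _ _; split; rewrite ?R ?A.
apply: (wpb_while (I := I)) => [|j s' [F [d [jd E8 E9 E10 nz]]] nb|
                                 j s' [F [d [jd E8 E9 E10 nz]]] /= hb].
- split; last by exists 0; rewrite addn0 expn0 divn1.
  split=> //= x; rewrite !inE !negb_or => H; rewrite /upd.
  by repeat (case: eqP => [E|_]; first by rewrite E in H).
- have [E6 E7 E4 A10 A11] := fr _ F.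
  exists d; rewrite -/h -/v -/k; split=> //; first by move=> i /nz[].
    move=> e0; have [|eD oe de ke] := @dslot_label _ _ _ _ _ _ _ _ inv v k d.
      move=> i; rewrite leq_eqVlt => /orP[/eqP->|/nz[] //].
      by rewrite -/h -E8 -E9.
    rewrite -/h -E8 -E9 in eD oe; split=> //.
    move: nb; rewrite /= A11 E7.
    by case: (rg s' 9 =P 0) => //= _; rewrite negbK => /eqP.
  (* An entry with key [k] lies on the search path at its own depth. Above the stop it would have
     been met; at the stop or below, the slot would be filled. *)
  move=> e0; case: (m v k =P 0) => // /(di_some inv)[e [eD oe ke]].
  have [he nze] := di_find inv eD; rewrite oe ke -/h in he nze.
  have [lt|gt|E] := ltngtP (dep e) d.
  + by have [_] := nz _ lt; rewrite he ke.
  + by case: (nze _ gt); rewrite -E8 -E9.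
  + by move: he; rewrite E -E8 -E9 e0; lia.
- have [E6 E7 E4 A10 A11] := fr _ F.
  case/andP: hb => /eqP e0 /eqP ek; rewrite A11 E7 in ek.
  have nz' i : i < d.+1 -> h (dslot h v k i) <> 0 /\ ar s 11 (h (dslot h v k i)) <> k.
    rewrite ltnS leq_eqVlt => /orP[/eqP->|/nz //].
    by rewrite -E8 -E9.
  have [|eD oe de ke] := @dslot_label _ _ _ _ _ _ _ _ inv v k d.
    by move=> i id; have [] := nz' i.
  rewrite -/h -E8 -E9 in eD oe ke.
  (* The entry agrees with [k] on [d] bits; with [L <= d] both keys are below [2 ^ d] and would
     coincide. *)
  have dL : d < L.
    rewrite ltnNge; apply/negP=> Ld; apply: ek.
    have lt x : x <= Kmax -> x < 2 ^ d.
      by move=> xK; apply: leq_ltn_trans xK (leq_trans KL _); rewrite leq_pexp2l.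
    by move: ke; rewrite !modn_small ?lt // (di_key inv).
  exists j.-1; first by lia.
  apply: wpb_sym => //=; split.
    case: F => R A C O; split=> //= x; rewrite /upd => H; move: (H) => {H}.
    rewrite !inE !negb_or => H.
    repeat (case: eqP => [E|_]; first by rewrite E in H).
    by apply: R; rewrite !inE !negb_or.
  exists d.+1; split=> //=.
  + by lia.
  + by rewrite E10 subn_half_odd E9 E8.
  + by rewrite A10.
  + by rewrite /upd /= E10 -divn2 -divnMA mulnC -expnS.

Qed.

Lemma dict_add_spec s Kmax ow dep m :
  dict_state s Kmax ow dep m ->
  found (ar s 10) (ar s 11) (rg s 4) ow m (rg s 6) (rg s 7) (rg s 8) 0 ->
  rg s 11 <> 0 -> rg s 7 <= Kmax -> rg s 4 < 4 * rg s 1 ->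
  wpb dict_add s 4 (fun s' => rg s' 4 = (rg s 4).+1 /\ exists ow' dep',
    dict_state s' Kmax ow' dep' (upd2 m (rg s 6) (rg s 7) (rg s 11))).
Proof.
move=> inv F x0 kK D4; apply: wpb_sym => //=.
have E : 4 * rg s 1 - (4 * rg s 1 - (rg s 4 + 1)) = (rg s 4).+1 by lia.
split; first exact: E.
have [ow' [dep' inv']] := dict_insert inv F x0 kK.
by exists ow', dep'; rewrite /dict_state /= /upd /= -/(upd _ _ _) E.
Qed.

End DictProgram.

Import Order.TTheory.

(** * Numbering the alphabet with an AA tree *)

(** The empty tree stands for node 0 of level 0, a sentinel that can be read like any other node. *)
Inductive tr := TE | TN of nat & nat & tr & tr.

Definition tix t := if t is TN i _ _ _ then i else 0.
Definition tlv t := if t is TN _ k _ _ then k else 0.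
Definition trt t := if t is TN _ _ _ r then r else TE.

Fixpoint tids t : seq nat :=
  if t is TN i _ l r then tids l ++ i :: tids r else [::].

Fixpoint thgt t : nat :=
  if t is TN _ _ l r then (maxn (thgt l) (thgt r)).+1 else 0.

(** A 2-3 tree in binary form: a child on the same level is allowed only to the right, and never
    twice in a row. *)
Fixpoint aa t : Prop :=
  if t is TN _ k l r then
    [/\ aa l, aa r, k = (tlv l).+1 &
        k = (tlv r).+1 \/ (k = tlv r /\ tlv (trt r) < k)]
  else True.

Definition skew t :=
  if t is TN i k (TN i' k' l' r') r then
    if k' == k then TN i' k l' (TN i k r' r) else t
  else t.

Definition tsplit t :=
  if t is TN i k l (TN i' k' l' r') then
    if tlv r' == k then TN i' k'.+1 (TN i k l l') r' else t
  else t.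

Lemma tids_skew t : tids (skew t) = tids t.
Proof.
by case: t => //= i k [|i' k' l' r'] r //; case: eqP => //= _; rewrite -catA.
Qed.

Lemma tids_split t : tids (tsplit t) = tids t.
Proof.
by case: t => //= i k l [|i' k' l' r'] //; case: eqP => //= _; rewrite -catA.
Qed.

(* [grown t0 t]: [t] can replace [t0] below a valid parent, up to one call of
   [skew] and [split]. *)
Definition grown t0 t : Prop :=
  aa t /\ (tlv t = tlv t0 \/
           [/\ tlv t = (tlv t0).+1, tlv (trt t) < tlv t & tlv (trt t0) = tlv t0]).

Lemma tlv_trt t : aa t -> tlv (trt t) <= tlv t.
Proof. by case: t => //= i k l r [_ _ _ h]; lia. Qed.

(** A left child that rose to level [k] is turned to the right by [skew]. If the right child was on
    level [k] too, this makes two horizontal links in a row, and [tsplit] lifts the middle node by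
    one level. *)
Lemma grown_left i k t0 t r : aa (TN i k t0 r) -> grown t0 t ->
  grown (TN i k t0 r) (tsplit (skew (TN i k t r))).
Proof.
move=> /= [a0 ar k0 kr] [at_ gt].
case: t at_ gt => [|i' k' l' r'] at_ gt /=.
  have kE : k = 1 by case: gt => [|[]] /=; lia.
  case: r ar kr => [|j m l2 r2] ar kr /=; first by split; [split=> //=; lia|left].
  case: eqP => [E|_]; last by split; [split=> //=; case: gt => [|[]] /=; lia|left].
  by exfalso; move: kr => /=; case: ar => _ _ _ /=; lia.
case: (k' =P k) => [E|nE] /=.
  subst k'; case: at_ => al' ar' kl' kr'.
  have krl : k = (tlv r').+1 by case: gt => [/=|[/= _ h _]]; lia.
  case: eqP => [E|nE].
    split; first by split=> //=; lia.
    by right; split=> //=; lia.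
  split; last by left.
  by split=> //=; right; split=> //; have := tlv_trt ar; case: kr; lia.
have {}gt : k' = tlv t0 by case: gt => [|[]] //=; lia.
case: r ar kr => [|j m l2 r2] ar kr /=; first by split; [split=> //=; lia|left].
case: eqP => [E|_]; last by split; [split=> //=; lia|left].
by exfalso; have := tlv_trt ar; case: kr => /=; lia.
Qed.

(** The left child is below level [k], so [skew] does nothing; only [tsplit] may act, when the grown
    child continues a horizontal link. *)
Lemma grown_right i k t0 t l : aa (TN i k l t0) -> grown t0 t ->
  grown (TN i k l t0) (tsplit (skew (TN i k l t))).
Proof.
move=> /= [al a0 kl k0] [at_ gt].
rewrite -/(skew (TN i k l t)).
have -> : skew (TN i k l t) = TN i k l t.
  by case: l kl {al} => //= i' k' l' r' kl; case: eqP => //; lia.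
case: t at_ gt => [|i' k' l' r'] at_ gt /=.
  by split; [split=> //=; case: gt => [|[]] /=; lia|left].
case: at_ => al' ar' kl' kr'; rewrite /= in gt.
have {}gt : k' = tlv t0 \/
    (k' = (tlv t0).+1 /\ tlv r' < k' /\ tlv (trt t0) = tlv t0).
  by case: gt => [|[]]; [left|right].
have lk : k' <= k by lia.
case: eqP => [E|nE].
  have kk : k' = k by lia.
  split; first by rewrite kk; split=> //=; first (split=> //; lia); lia.
  by right; split=> //=; lia.
by split; [split=> //=; lia|left].
Qed.

Lemma aa_size t : aa t -> 2 ^ tlv t <= (size (tids t)).+1.
Proof.
elim: t => //= i k l IHl r IHr [/IHl hl /IHr hr -> kr].
rewrite size_cat /= expnS.
have : 2 ^ tlv l <= 2 ^ tlv r by rewrite leq_pexp2l //; case: kr; lia.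
lia.
Qed.

(** A horizontal link is never followed by another, so the level drops at least once in two steps of
    a path. *)
Lemma aa_height t : aa t ->
  thgt t <= 2 * tlv t /\ (tlv (trt t) < tlv t -> thgt t < 2 * tlv t).
Proof.
elim: t => //= i k l IHl r IHr [/IHl[hl _] /IHr[hr hr'] kl kr].
split=> [|lt]; last by lia.
by case: kr => [|[kr /[dup] lt]]; [|rewrite {1}kr => /hr']; lia.
Qed.

Lemma uniq_two (z : seq nat) i i' (y : seq nat) :
  perm_eq z [:: i, i' & y] -> uniq z ->
  i' <> i /\ forall j, j \in y -> j <> i /\ j <> i'.
Proof.
move=> /perm_uniq-> /=; rewrite inE negb_or => /and3P[/andP[n1 n2] n3 _].
split=> [E|j jy]; first by rewrite E eqxx in n1.
by split=> E; [rewrite -E jy in n2 | rewrite -E jy in n3].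
Qed.

Fixpoint trep (L R V : nat -> nat) t : Prop :=
  if t is TN i k l r then
    [/\ L i = tix l, R i = tix r, V i = k, i <> 0 & trep L R V l /\ trep L R V r]
  else True.

Lemma trep_eq L R V L' R' V' t :
  (forall j, j \in tids t -> [/\ L' j = L j, R' j = R j & V' j = V j]) ->
  trep L R V t -> trep L' R' V' t.
Proof.
elim: t => //= i k l IHl r IHr eqs [h1 h2 h3 h4 [h5 h6]].
have [|-> -> ->] := eqs i; first by rewrite mem_cat inE eqxx orbT.
split=> //; split; [apply: IHl h5 | apply: IHr h6] => j jt; apply: eqs;
  by rewrite mem_cat inE jt ?orbT.
Qed.

(* One level of a search path: [(true, i, k, t)] descends to the left child of
   node [i] of level [k] and right subtree [t]. *)
Definition frame := (bool * nat * nat * tr)%type.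

Definition plug1 (f : frame) t :=
  let: (d, i, k, u) := f in if d then TN i k t u else TN i k u t.

Definition lids (f : frame) : seq nat :=
  let: (d, i, _, u) := f in if d then [::] else rcons (tids u) i.
Definition rids (f : frame) : seq nat :=
  let: (d, i, _, u) := f in if d then i :: tids u else [::].

Fixpoint lefts (fs : seq frame) : seq nat :=
  if fs is f :: fs' then lefts fs' ++ lids f else [::].
Fixpoint rights (fs : seq frame) : seq nat :=
  if fs is f :: fs' then rids f ++ rights fs' else [::].

Lemma tids_plug1 f t : tids (plug1 f t) = lids f ++ tids t ++ rids f.
Proof. by case: f => [[[[] i] k] u] /=; rewrite ?cats0 ?cat_rcons. Qed.

Lemma inorder_cons f fs t :
  lefts (f :: fs) ++ tids t ++ rights (f :: fs) =
  lefts fs ++ tids (plug1 f t) ++ rights fs.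
Proof. by rewrite tids_plug1 /= -!catA. Qed.

Fixpoint ctx_ok (fs : seq frame) t : Prop :=
  if fs is f :: fs' then aa (plug1 f t) /\ ctx_ok fs' (plug1 f t) else True.

Fixpoint stk_rep (stk : nat -> nat) (fs : seq frame) : Prop :=
  if fs is f :: fs' then
    let: (_, i, _, _) := f in stk (size fs') = i /\ stk_rep stk fs'
  else True.

Lemma stk_rep_upd stk fs j x : size fs <= j -> stk_rep stk fs ->
  stk_rep (upd stk j x) fs.
Proof.
elim: fs => //= [[[[d i] k] u] fs IH] sj [h1 h2].
by rewrite upd_other; [split=> //; apply: IH => //; lia|lia].
Qed.

Fixpoint ctx_rep (L R V : nat -> nat) (fs : seq frame) : Prop :=
  if fs is f :: fs' then
    let: (d, i, k, u) := f in
    [/\ (if d then R i else L i) = tix u, V i = k, i <> 0, trep L R V u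
      & ctx_rep L R V fs']
  else True.

Lemma ctx_rep_eq L R V L' R' V' fs :
  (forall j, j \in lefts fs ++ rights fs ->
     [/\ L' j = L j, R' j = R j & V' j = V j]) ->
  ctx_rep L R V fs -> ctx_rep L' R' V' fs.
Proof.
elim: fs => //= [[[[d i] k] u] fs IH] eqs [h1 h2 h3 h4 h5].
have ii : i \in lids (d, i, k, u) ++ rids (d, i, k, u).
  by case: (d); rewrite /= ?mem_cat ?mem_rcons ?inE eqxx.
have sub j : j \in lids (d, i, k, u) ++ rids (d, i, k, u) ->
    [/\ L' j = L j, R' j = R j & V' j = V j].
  move=> jt; apply: eqs; move: jt; rewrite !mem_cat.
  by case/orP=> ->; rewrite ?orbT.
have [-> -> ->] := sub i ii; split=> //.
  apply: trep_eq h4 => j jt; apply: sub.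
  by case: (d); rewrite /= ?mem_cat ?mem_rcons ?inE jt ?orbT.
apply: IH h5 => j jt; apply: eqs; move: jt; rewrite !mem_cat.
by case/orP=> ->; rewrite ?orbT.
Qed.

Lemma size_ctx fs : size fs <= size (lefts fs) + size (rights fs).
Proof.
elim: fs => //= [[[[d i] k] u] fs IH]; rewrite !size_cat.
by case: d; rewrite /= ?size_rcons; lia.
Qed.

(** * Programs on the AA tree and their correctness *)

Definition down_step : acmd :=
  ASto 18 (AReg 13) (AReg 12) ;;
  ASet 13 (AMin (AAdd (AReg 13) (ACst 1)) (AReg 1)) ;;
  AIf (ACLt (ACst 0) (AReg 12))
    (ASet 12 (AFld 15 (AReg 12)))
    (ASet 12 (AFld 16 (AReg 12))).

Definition attach : acmd :=
  ASet 13 (ASub (AReg 13) (ACst 1)) ;;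
  ASet 15 (AFld 18 (AReg 13)) ;;
  AIf (ACLt (ACst 0) (AReg 15))
    (ASto 15 (AReg 15) (AReg 14))
    (ASto 16 (AReg 15) (AReg 14)).

Definition skew_cmd : acmd :=
  ASet 16 (AFld 15 (AReg 15)) ;;
  AIf (AEq (AFld 17 (AReg 16)) (AFld 17 (AReg 15)))
    (ASto 15 (AReg 15) (AFld 16 (AReg 16)) ;;
     ASto 16 (AReg 16) (AReg 15) ;;
     ASet 14 (AReg 16))
    (ASet 14 (AReg 15)).

Definition split_cmd : acmd :=
  ASet 16 (AFld 16 (AReg 14)) ;;
  AIf (AEq (AFld 17 (AFld 16 (AReg 16))) (AFld 17 (AReg 14)))
    (ASto 16 (AReg 14) (AFld 15 (AReg 16)) ;;
     ASto 15 (AReg 16) (AReg 14) ;;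
     ASto 17 (AReg 16) (AMin (AAdd (AFld 17 (AReg 16)) (ACst 1)) (AReg 1)) ;;
     ASet 14 (AReg 16))
    ASkip.

Definition grow : acmd :=
  ASet 2 (AMin (AAdd (AReg 2) (ACst 1)) (AReg 1)) ;;
  ACpy (AReg 2) (ACst 0) ;;
  ASto 15 (AReg 2) (ACst 0) ;;
  ASto 16 (AReg 2) (ACst 0) ;;
  ASto 17 (AReg 2) (ACst 1) ;;
  ASet 14 (AReg 2).

(* Leaves in register 17 the number of the character in text cell 0, giving it
   the next free number if it is new. Text cell [i] keeps the character with
   number [i]; the descent stops at node 0 because cell 0 equals itself. *)
Definition alpha : acmd :=
  ASet 12 (AReg 3) ;;
  ASet 13 (ACst 0) ;;
  AWhile (ANot (ACEq (AReg 12) (ACst 0))) down_step ;;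
  AIf (AEq (AReg 12) (ACst 0))
    (grow ;;
     AWhile (ALt (ACst 0) (AReg 13)) (attach ;; skew_cmd ;; split_cmd) ;;
     ASet 3 (AReg 14) ;;
     ASet 12 (AReg 2))
    ASkip ;;
  ASet 17 (AReg 12).

Section Alphabet.
Variables (disp : Order.disp_t) (Sigma : finOrderType disp).
Implicit Types s : astate Sigma.

Definition tree_at s t : Prop :=
  [/\ trep (ar s 15) (ar s 16) (ar s 17) t, ar s 16 0 = 0 & ar s 17 0 = 0].

Definition same_off (J : seq nat) s s' : Prop :=
  forall j, j \notin J ->
    [/\ ar s' 15 j = ar s 15 j, ar s' 16 j = ar s 16 j & ar s' 17 j = ar s 17 j].

Lemma skew_spec s t : tree_at s t -> uniq (tids t) -> rg s 15 = tix t ->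
  0 < tlv t ->
  wpb skew_cmd s 5 (fun s' => [/\ tree_at s' (skew t), rg s' 14 = tix (skew t)
    & same_off (tids t) s s']).
Proof.
case: t => // i k l r [rep R0 V0] U /= r15 k0; apply: wpb_sym => //=.
case: rep => Li Ri Vi i0 [repl repr].
rewrite /upd /= !r15 Li Vi; case: l repl U Li => [|i' k' l' r'] /= repl U Li.
  by rewrite V0 (ltn_eqF k0); split.
case: repl => Li' Ri' Vi' i0' [repl' repr']; rewrite Vi'.
case: eqP => [E|nE]; last by split.
have [|ii' nin] := @uniq_two _ i i' (tids l' ++ tids r' ++ tids r) _ U.
  by apply/permP=> p; rewrite /= !count_cat /= ?count_cat; lia.
split=> //=; last first.
  move=> j; rewrite /= /upd /= !(mem_cat, inE) !negb_or => /andP[/and3P[_ /negPf-> _]].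
  by case/andP=> /negPf-> _.
have ni' : (i == i') = false by apply/eqP=> E'; rewrite E' in ii'.
have ni : (i' == i) = false by apply/eqP.
split=> //=.
- rewrite /= /upd /= !eqxx ?ni ?ni' ?eqxx Li' Vi' Vi ?Ri' ?Ri; split=> //; split.
    apply: trep_eq repl' => j jt.
    by have [|/eqP/negPf-> /eqP/negPf->] := nin j; rewrite ?mem_cat ?jt ?orbT.
  split=> //; split; [apply: trep_eq repr' | apply: trep_eq repr] => j jt.
    by have [|/eqP/negPf-> /eqP/negPf->] := nin j; rewrite ?mem_cat ?jt ?orbT.
  by have [|/eqP/negPf-> /eqP/negPf->] := nin j; rewrite ?mem_cat ?jt ?orbT.
- by rewrite /= /upd /=; case: eqP => // E'; rewrite -E' in i0'.
Qed.

Lemma split_spec s t : tree_at s t -> uniq (tids t) -> rg s 14 = tix t ->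
  0 < tlv t -> tlv (tsplit t) <= rg s 1 ->
  wpb split_cmd s 6 (fun s' => [/\ tree_at s' (tsplit t), rg s' 14 = tix (tsplit t)
    & same_off (tids t) s s']).
Proof.
case: t => // i k l r [rep R0 V0] U /= r14 k0 lvN; apply: wpb_sym => //=.
case: rep => Li Ri Vi i0 [repl repr].
rewrite /upd /= !r14 Ri Vi; case: r repr U Ri lvN => [|i' k' l' r'] /= repr U Ri lvN.
  by rewrite R0 V0 (ltn_eqF k0); split.
case: repr => Li' Ri' Vi' i0' [repl' repr']; rewrite Ri'.
have -> : ar s 17 (tix r') = tlv r' by case: (r') repr' => //= ? ? ? ? [].
case: eqP lvN => [E|nE] lvN; last by split.
have [|ii' nin] := @uniq_two _ i i' (tids l ++ tids l' ++ tids r') _ U.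
  by apply/permP=> p; rewrite /= !count_cat /= ?count_cat /=; lia.
have VE : rg s 1 - (rg s 1 - (ar s 17 i' + 1)) = k'.+1 by move: lvN => /=; lia.
split=> //=; last first.
  move=> j; rewrite /= /upd /= !(mem_cat, inE) !negb_or.
  by case/and3P=> [_ /negPf-> /and3P[_ /negPf-> _]].
have ni' : (i == i') = false by apply/eqP=> E'; rewrite E' in ii'.
have ni : (i' == i) = false by apply/eqP.
split=> //=.
- rewrite /= /upd /= !eqxx ?ni ?ni' ?eqxx VE Ri' ?Li' ?Li ?Vi; split=> //; split.
    split=> //; split; [apply: trep_eq repl | apply: trep_eq repl'] => j jt.
      by have [|/eqP/negPf-> /eqP/negPf->] := nin j; rewrite ?mem_cat ?jt ?orbT.
    by have [|/eqP/negPf-> /eqP/negPf->] := nin j; rewrite ?mem_cat ?jt ?orbT.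
  apply: trep_eq repr' => j jt.
  by have [|/eqP/negPf-> /eqP/negPf->] := nin j; rewrite ?mem_cat ?jt ?orbT.
- by rewrite /= /upd /=; case: eqP => // E'; rewrite -E' in i0.
- by rewrite /= /upd /=; case: eqP => // E'; rewrite -E' in i0'.
Qed.

Definition side_ok s (f : frame) : Prop :=
  let: (d, i, _, _) := f in (ch s 0 < ch s i)%O = d.

Lemma attach_spec s t f fs : tree_at s t -> rg s 14 = tix t ->
  ctx_rep (ar s 15) (ar s 16) (ar s 17) (f :: fs) ->
  stk_rep (ar s 18) (f :: fs) -> rg s 13 = size (f :: fs) -> side_ok s f ->
  uniq (tids (plug1 f t)) ->
  wpb attach s 4 (fun s' => [/\ tree_at s' (plug1 f t), rg s' 15 = tix (plug1 f t),
    rg s' 13 = size fs & same_off (tids (plug1 f t)) s s']).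
Proof.
case: f => [[[d i] k] u] [rep R0 V0] r14 [E1 E2 E3 E4 _] [E5 _] /= r13 so U.
apply: wpb_sym => //=; rewrite /upd /= r13 subn1 /= E5 so.
have nin j : j \in tids t ++ tids u -> (j == i) = false.
  move=> jt; apply/negP=> /eqP E; subst j.
  have P : perm_eq (tids (plug1 (d, i, k, u) t)) (i :: tids t ++ tids u).
    by case: (d); apply/permP=> p; rewrite /= !count_cat /= ?count_cat /=; lia.
  by move: U; rewrite (perm_uniq P) /= jt.
case: d so E1 U => so E1 U /=.
  split=> //=; last first.
    move=> j; rewrite /= /upd /= !(mem_cat, inE) !negb_or.
    by case/and3P=> [_ /negPf-> _].
  split=> //=; rewrite /= /upd /= eqxx r14; split=> //; split.
    by apply: trep_eq rep => j jt; rewrite nin // mem_cat jt.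
  by apply: trep_eq E4 => j jt; rewrite nin // mem_cat jt orbT.
split=> //=; last first.
  move=> j; rewrite /= /upd /= !(mem_cat, inE) !negb_or.
  by case/and3P=> [_ /negPf-> _].
split=> //=.
- rewrite /= /upd /= eqxx r14; split=> //; split.
    by apply: trep_eq E4 => j jt; rewrite nin // mem_cat jt orbT.
  by apply: trep_eq rep => j jt; rewrite nin // mem_cat jt.
- by rewrite /= /upd /=; case: eqP => // E'; rewrite -E' in E3.
Qed.

Lemma same_off_trans J s1 s2 s3 : same_off J s1 s2 -> same_off J s2 s3 ->
  same_off J s1 s3.
Proof. by move=> h1 h2 j jJ; have [-> -> ->] := h2 j jJ; exact: h1. Qed.

Lemma tlv_skew t : tlv (skew t) = tlv t.
Proof. by case: t => //= i k [|i' k' l' r'] r //; case: eqP. Qed.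

Lemma up_step_spec s t f fs : tree_at s t -> rg s 14 = tix t ->
  ctx_rep (ar s 15) (ar s 16) (ar s 17) (f :: fs) ->
  stk_rep (ar s 18) (f :: fs) -> rg s 13 = size (f :: fs) -> side_ok s f ->
  uniq (tids (plug1 f t)) -> 0 < tlv (plug1 f t) ->
  tlv (tsplit (skew (plug1 f t))) <= rg s 1 ->
  wpb (attach ;; skew_cmd ;; split_cmd) s 15 (fun s' =>
    [/\ tree_at s' (tsplit (skew (plug1 f t))),
        rg s' 14 = tix (tsplit (skew (plug1 f t))), rg s' 13 = size fs
      & same_off (tids (plug1 f t)) s s']).
Proof.
move=> ta r14 cr sr r13 so U lv0 lvN.
have -> : 15 = 4 + (5 + 6) by [].
apply: wpb_seq.
apply: wpb_conseq (wpb_framed (attach_spec ta r14 cr sr r13 so U)) _ _ => //.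
move=> s1 [[ta1 r15 r13' so1] [R1 _ _ _]]; apply: wpb_seq.
apply: wpb_conseq (wpb_framed (skew_spec ta1 U r15 lv0)) _ _ => //.
move=> s2 [[ta2 r14' so2] [R2 _ _ _]].
have N2 : rg s2 1 = rg s 1 by rewrite R2 // R1.
have := @split_spec s2 _ ta2; rewrite tids_skew => /(_ U r14').
rewrite tlv_skew N2 => /(_ lv0 lvN) W.
apply: wpb_conseq (wpb_framed W) _ _ => // s3 [[ta3 r14'' so3] [R3 _ _ _]].
split=> //; first by rewrite R3 // R2.
exact: same_off_trans so1 (same_off_trans so2 so3).
Qed.

(** [cd] is a ghost numbering of the characters met so far; the machine keeps its inverse in the
    text cells and computes it by searching the tree. *)
Definition alpha_inv s (S : seq Sigma) (cd : Sigma -> nat) : Prop :=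
  [/\ exists T, [/\ tree_at s T, rg s 3 = tix T, aa T,
        pairwise (fun i j => (ch s i < ch s j)%O) (tids T)
      & perm_eq (tids T) (iota 1 (rg s 2))],
      forall i, 0 < i <= rg s 2 -> ch s i \in S
    & forall c, c \in S -> 0 < cd c <= rg s 2 /\ ch s (cd c) = c].

Lemma alpha_uniq s S cd : alpha_inv s S cd ->
  uniq [seq ch s i | i <- iota 1 (rg s 2)].
Proof.
case=> [[T [_ _ _ pw pe]] _ _]; rewrite -(perm_uniq (perm_map _ pe)).
rewrite uniq_pairwise pairwise_map; apply: sub_pairwise pw => i j /=.
by move=> lt; rewrite (lt_eqF lt).
Qed.

Lemma alpha_inj s S cd i j : alpha_inv s S cd -> 0 < i <= rg s 2 ->
  0 < j <= rg s 2 -> ch s i = ch s j -> i = j.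
Proof.
move=> /alpha_uniq U iA jA E.
have nE k : 0 < k <= rg s 2 ->
    nth (ch s 0) [seq ch s i | i <- iota 1 (rg s 2)] k.-1 = ch s k.
  move=> kA; rewrite (nth_map 0) ?size_iota; last by lia.
  by rewrite nth_iota; [congr (ch s _); lia|lia].
have : i.-1 == j.-1; last by lia.
by rewrite -(nth_uniq (ch s 0) _ _ U) ?size_map ?size_iota ?nE ?E //; lia.
Qed.

Lemma alpha_size s S cd : alpha_inv s S cd ->
  rg s 2 <= size S /\ rg s 2 <= #|Sigma|.
Proof.
move=> inv; have U := alpha_uniq inv; case: inv => _ mS _.
rewrite -{1 2}(size_iota 1 (rg s 2)) -(size_map (ch s)); split.
  apply: uniq_leq_size U _ => c /mapP[i]; rewrite mem_iota => iA ->.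
  by apply: mS; lia.
by rewrite -(card_uniqP U) max_card.
Qed.

Lemma alpha_code_inj s S cd : alpha_inv s S cd -> {in S &, injective cd}.
Proof.
by case=> _ _ h c c' /h[_ hc] /h[_ hc'] E; rewrite -hc -hc' E.
Qed.

Lemma aa_log t (A B : nat) : aa t -> size (tids t) = A -> A <= B ->
  tlv t <= (trunc_log 2 B).+1 /\ tlv t <= A.
Proof.
move=> /aa_size; set k := tlv t => h E AB; rewrite E in h.
have lt : k < 2 ^ k by apply: ltn_expl.
split; last by lia.
rewrite -(@leq_exp2l 2) //.
have := @trunc_log_ltn 2 B isT; lia.
Qed.

Definition search_ctx s a T t fs : Prop :=
  [/\ ctx_ok fs t, aa t, lefts fs ++ tids t ++ rights fs = tids T,
      all (fun j => (ch s j < a)%O) (lefts fs) &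
      all (fun j => (a < ch s j)%O) (rights fs)].

Lemma search_step s a T t fs i k l r :
  pairwise (fun i j => (ch s i < ch s j)%O) (tids T) ->
  t = TN i k l r -> search_ctx s a T t fs -> ch s i != a ->
  if (a < ch s i)%O then search_ctx s a T l ((true, i, k, r) :: fs)
  else search_ctx s a T r ((false, i, k, l) :: fs).
Proof.
move=> pw -> [co at_ E al ar_] ne.
have at2 : aa l /\ aa r by case: at_.
move: pw; rewrite -E pairwise_cat => /and3P[_ _].
rewrite pairwise_cat => /and3P[_ pt _].
move: pt; rewrite /= pairwise_cat allrel_consr /=.
case/and3P=> /andP[a1 _] _ /andP[a2 _].
case: at2 => aal aar; case: ifP => lt.
  split=> //; first by rewrite inorder_cons.
    by rewrite /= cats0.
  rewrite /= lt all_cat ar_ andbT; apply: sub_all a2 => j /=.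
  exact: lt_trans.
have gt : (ch s i < a)%O by rewrite lt_neqAle ne leNgt lt.
split=> //; first by rewrite inorder_cons.
rewrite /= all_cat al /= all_rcons gt /=; apply: sub_all a1 => j /=.
by move=> h; apply: lt_trans gt.
Qed.

Lemma down_spec s S cd T :
  tree_at s T -> rg s 3 = tix T -> aa T ->
  pairwise (fun i j => (ch s i < ch s j)%O) (tids T) ->
  perm_eq (tids T) (iota 1 (rg s 2)) ->
  alpha_inv s S cd -> rg s 1 = (size S).+1 -> rg s 12 = tix T -> rg s 13 = 0 ->
  let Lg := (trunc_log 2 #|Sigma|).+1 in
  wpb (AWhile (ANot (ACEq (AReg 12) (ACst 0))) down_step) s (10 * Lg + 1)
   (fun s' => exists t fs,
    [/\ search_ctx s (ch s 0) T t fs, rg s' 12 = tix t, t <> TE -> ch s (tix t) = ch s 0,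
        stk_rep (ar s' 18) fs & rg s' 13 = size fs /\
        (size fs <= 2 * Lg /\ ctx_rep (ar s 15) (ar s 16) (ar s 17) fs)]).
Proof.
move=> ta r3 aT pw pe inv r1 r12 r13 Lg.
have [AS AC] := alpha_size inv.
have szT : size (tids T) = rg s 2 by rewrite (perm_size pe) size_iota.
have [lvL _] := aa_log aT szT AC.
have hT : thgt T <= 2 * Lg by have [] := aa_height aT; lia.
(* At most [2 * Lg] levels are passed, each at cost four plus one for the guard. *)
have -> : 10 * Lg + 1 = (2 * Lg * 5).+1 by lia.
pose I (j : nat) s' := framed down_step s s' /\ exists t fs,
   [/\ search_ctx s (ch s 0) T t fs, rg s' 12 = tix t, stk_rep (ar s' 18) fs,
       rg s' 13 = size fs & [/\ thgt t <= j, j + size fs = 2 * Lg,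
         trep (ar s 15) (ar s 16) (ar s 17) t
       & ctx_rep (ar s 15) (ar s 16) (ar s 17) fs]].
apply: (wpb_while (I := I)) => [|j s' [F [t [fs [sc E12 sk E13 [hj jL rt cr]]]]] nb|
                          j s' [F [t [fs [sc E12 sk E13 [hj jL rt cr]]]]] /= hb].
- split; first by split.
  exists T, [::]; split=> //; first by split=> //=; rewrite cats0.
  by split=> //; [rewrite addn0 | case: ta].
- case: (F) => R A C O; exists t, fs; split=> //.
    move=> tE; move: nb; rewrite /= negbK E12 C // => /eqP.
    by [].
  by split=> //; split=> //; lia.
- case: (F) => R A C O; rewrite C // E12 in hb.
  case: t sc E12 rt hj hb => [|i k l r] sc E12 rt hj hb; first by rewrite /= eqxx in hb.
  exists j.-1; first by move: hj => /=; lia.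
  have szfs : size fs < rg s 2.
    case: (sc) => _ _ E _ _; rewrite -szT -E !size_cat /=.
    by have := size_ctx fs; lia.
  have r1' : rg s' 1 - (rg s' 1 - (rg s' 13 + 1)) = (size fs).+1.
    by rewrite R // r1 E13; lia.
  have st := search_step pw erefl sc hb;   apply: wpb_sym => //=; rewrite /upd /= C // E12 /= r1'.
  case: rt => Li Ri Vi i0 [rl rr].
  rewrite /= in hj.
  have Fr s2 : (forall x, x \notin [:: 12; 13] -> rg s2 x = rg s' x) ->
      (forall f, f != 18 -> ar s2 f = ar s' f) -> ch s2 = ch s' -> ou s2 = ou s' ->
      framed down_step s s2.
    move=> h1 h2 h3 h4; split=> [x xm|f fm|_|_]; rewrite ?h1 ?h2 ?h3 ?h4 //.
    - by apply: R.
    - by apply: contra xm; rewrite !inE => /orP[] ->; rewrite ?orbT.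
    - by apply: A.
    - by apply: contra fm; rewrite !inE.
    - by apply: C.
    - by apply: O.
  case: ifP st => lt sc'; (split; [apply: Fr => //=|]).
  + by move=> x; rewrite !inE !negb_or /upd => /andP[/negPf-> /negPf->].
  + by move=> f; rewrite /upd => /negPf->.
  + exists l, ((true, i, k, r) :: fs); split=> //=.
    * by rewrite A.
    * by rewrite E13 /upd /= eqxx; split=> //; apply: stk_rep_upd.
    * by split=> //; [lia | lia].
  + by move=> x; rewrite !inE !negb_or /upd => /andP[/negPf-> /negPf->].
  + by move=> f; rewrite /upd => /negPf->.
  + exists r, ((false, i, k, l) :: fs); split=> //=.
    * by rewrite A.
    * by rewrite E13 /upd /= eqxx; split=> //; apply: stk_rep_upd.
    * by split=> //; [lia | lia].
Qed.

(** The frames come from the old tree, so their validity refers to the old subtree [t0] at the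
    focus, and [grown t0 t] lets the rebuilt subtree take its place. *)
Lemma up_spec s a t fs (ids : seq nat) :
  tree_at s t -> rg s 14 = tix t -> ctx_rep (ar s 15) (ar s 16) (ar s 17) fs ->
  stk_rep (ar s 18) fs -> rg s 13 = size fs -> ch s 0 = a ->
  all (fun j => (ch s j < a)%O) (lefts fs) ->
  all (fun j => (a < ch s j)%O) (rights fs) ->
  (exists2 t0, ctx_ok fs t0 & grown t0 t) ->
  lefts fs ++ tids t ++ rights fs = ids -> uniq ids -> size ids <= rg s 1 ->
  wpb (AWhile (ALt (ACst 0) (AReg 13)) (attach ;; skew_cmd ;; split_cmd)) s
    (16 * size fs).+1
    (fun s' => exists2 T, tree_at s' T & [/\ rg s' 14 = tix T, aa T & tids T = ids]).
Proof.
move=> ta r14 cr sk r13 ca al ar_ cg E U szN; rewrite mulnC.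
pose c := attach ;; skew_cmd ;; split_cmd.
pose I (j : nat) s' := framed c s s' /\ exists t fs,
  [/\ tree_at s' t, rg s' 14 = tix t, ctx_rep (ar s' 15) (ar s' 16) (ar s' 17) fs,
      stk_rep (ar s' 18) fs & [/\ rg s' 13 = size fs, j = size fs,
      all (fun j => (ch s j < a)%O) (lefts fs),
      all (fun j => (a < ch s j)%O) (rights fs)
    & (exists2 t0, ctx_ok fs t0 & grown t0 t) /\ lefts fs ++ tids t ++ rights fs = ids]].
apply: (wpb_while (I := I)).
- by split; [split | exists t, fs; split].
- move=> j s' [_ [t' [fs' [ta' r14' _ _ [r13' _ _ _ [[t0 _ [aat _]] E']]]]]] /=.
  rewrite r13' lt0n negbK; case: fs' E' {r13'} => //= E' _; exists t' => //.
  by rewrite cats0 in E'.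
move=> j s' [F [t' [[|f fs'] [ta' r14' cr' sk' [r13' -> al' ar' [[t0 co g] E']]]]]] /=;
  first by rewrite r13'.
move=> _; exists (size fs') => //.
case: (F) => R A C O; rewrite inorder_cons in E'.
have U' : uniq (tids (plug1 f t')).
  by move: U; rewrite -E' !cat_uniq => /and3P[_ _ /and3P[]].
case: co => aap co.
have g' : grown (plug1 f t0) (tsplit (skew (plug1 f t'))).
  case: f aap {cr' sk' r13' al' ar' co E' U'} => [[[[] i] k] u] aap.
    exact: grown_left aap g.
  exact: grown_right aap g.
have lv0 : 0 < tlv (plug1 f t').
  by case: f aap {cr' sk' r13' al' ar' co E' U' g'} => [[[[] i] k] u] [_ _ -> _].
have lvN : tlv (tsplit (skew (plug1 f t'))) <= rg s' 1.
  rewrite R //; case: g' => aan _.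
  have [_ h] := aa_log aan erefl (leqnn _).
  apply: leq_trans h _; apply: leq_trans szN.
  by rewrite tids_split tids_skew -E' !size_cat; lia.
have so : side_ok s' f.
  case: f al' ar' {cr' sk' r13' co E' U' aap g' lv0 lvN} => [[[[] i] k] u] /=.
    by move=> _ /andP[lt _]; rewrite C // ca.
  by rewrite all_cat all_rcons => /and3P[_ lt _] _; rewrite C // ca lt_gtF.
apply: wpb_conseq (wpb_framed (up_step_spec ta' r14' cr' sk' r13' so U' lv0 lvN)) _ _ => //.
move=> s2 [[ta2 r142 r132 sm2] [R2 A2 C2 O2]]; split.
  by split=> [x xm|g0 gm|hm|hm]; rewrite ?R2 ?A2 ?C2 ?O2 ?R ?A ?C ?O.
exists (tsplit (skew (plug1 f t'))), fs'; split=> //.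
- apply: ctx_rep_eq (_ : ctx_rep (ar s' 15) (ar s' 16) (ar s' 17) fs') => [j0 j0m|].
    apply: sm2; move: U; rewrite -E' !cat_uniq has_cat negb_or.
    case/and3P=> _ /andP[h1 _] /and3P[_ h2 _].
    apply/negP=> jt; move: j0m; rewrite mem_cat => /orP[jl|jr].
      by move/hasP: h1; apply; exists j0.
    by move/hasP: h2; apply; exists j0.
  by case: (f) cr' => [[[d i] k] u] [].
- by rewrite A2 //; case: (f) sk' => [[[d i] k] u] [].
split=> //.
- by move: al'; rewrite /= all_cat => /andP[].
- by move: ar'; rewrite /= all_cat => /andP[].
split; first by exists (plug1 f t0).
by rewrite tids_split tids_skew.
Qed.

Lemma grow_spec s : let A := (rg s 2).+1 in A <= rg s 1 ->
  wpb grow s 6 (fun s' => [/\ rg s' 2 = A, rg s' 14 = A,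
    ch s' = upd (ch s) A (ch s 0), ar s' 15 = upd (ar s 15) A 0 &
    ar s' 16 = upd (ar s 16) A 0 /\ ar s' 17 = upd (ar s 17) A 1]).
Proof.
move=> A AN; apply: wpb_sym => //=.
have -> : rg s 1 - (rg s 1 - (rg s 2 + 1)) = A by lia.
by split; rewrite /= /upd /= ?eqxx.
Qed.

Lemma alpha_spec s S cd : alpha_inv s S cd -> rg s 1 = (size S).+1 ->
  wpb alpha s (100 * (trunc_log 2 #|Sigma|).+1) (fun s' =>
    exists cd', [/\ alpha_inv s' (ch s 0 :: S) cd', {in S, cd' =1 cd}
      & rg s' 17 = cd' (ch s 0)]).
Proof.
move=> inv r1; set Lg := (trunc_log 2 _).+1; set a := ch s 0.
have [AS AC] := alpha_size inv.
case: (inv) => -[T [ta r3 aT pw pe]] inS cdS.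
have szT : size (tids T) = rg s 2 by rewrite (perm_size pe) size_iota.
have Lg1 : 1 <= Lg by [].
apply: (@wpb_conseq _ _ _ _ (1 + (1 + ((10 * Lg + 1) + ((32 * Lg + 12) + 1))))
  _ _ _ _ _ (fun s' p => p)); last by lia.
do 2![apply: wpb_seq; apply: wpb_sym => //=].
set s1 := set_rg _ _ _.
have inv1 : alpha_inv s1 S cd by split=> //; exists T.
apply: wpb_seq.
apply: wpb_conseq
  (wpb_framed (@down_spec s1 S cd T ta r3 aT pw pe inv1 r1 r3 erefl)) _ _ => //.
move=> s2 [[t [fs [sc r12 ft sk [r13 [szfs cr]]]]] [R2 A2 C2 O2]].
have e2 : rg s2 2 = rg s 2 by rewrite R2.
have e3 : rg s2 3 = rg s 3 by rewrite R2.
have ch2 : ch s2 = ch s by rewrite C2.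
have sc_mem j : j \in tids T -> [|| j \in lefts fs, j \in tids t | j \in rights fs].
  by case: sc => _ _ <- _ _; rewrite !mem_cat.
apply: wpb_seq; case: t sc ft r12 sc_mem => [|i k l r] sc ft r12 sc_mem; last first.
  have iT : i \in tids T.
    by case: sc => _ _ <- _ _; rewrite !mem_cat inE eqxx !orbT.
  have i0 : 0 < i <= rg s 2.
    by move: iT; rewrite (perm_mem pe) mem_iota; lia.
  apply: (@wpb_conseq _ _ _ _ 2 _ _ _ _ _ (fun s' p => p)); last by lia.
  apply: wpb_if; rewrite /= r12 /=; have /negPf-> : i != 0 by lia.
  apply: wpb_sym => //=; apply: wpb_sym => //=.
  have cha : ch s i = a by apply: ft.
  have aS : a \in S by rewrite -cha inS.
  exists cd; split=> //; last first.
    rewrite /upd /= r12 /=; have [h1 h2] := cdS _ aS.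
    by apply: (alpha_inj inv) => //; rewrite h2.
  have sub c : c \in a :: S -> c \in S by rewrite inE => /orP[/eqP->|].
  split=> /=.
  - exists T; rewrite /upd /= ch2 e2 e3; split=> //.
    by case: ta => h1 h2 h3; split; rewrite /= !A2.
  - by rewrite /upd /= e2 ch2 => j jA; rewrite inE inS ?orbT.
  - by move=> c /sub /cdS; rewrite /upd /= e2 ch2.
apply: (@wpb_conseq _ _ _ _ (6 + ((32 * Lg + 1) + (1 + 1))).+1 _ _ _ _ _
  (fun s' p => p)); last by lia.
apply: wpb_if; rewrite /= r12 /=; apply: wpb_seq.
case: sc => co _ E al ar_; rewrite /= in E.
have AN : rg s2 2 < rg s2 1 by rewrite e2 R2 //= /upd /= r1; lia.
apply: wpb_conseq (wpb_framed (grow_spec AN)) _ _ => //.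
rewrite e2 ch2; set A := (rg s 2).+1.
move=> s3 [[r2 r14 ch3 a15 [a16 a17]] [R3 A3 C3 O3]]; rewrite -/a in ch3.
have nA j : j \in tids T -> j <> A by rewrite (perm_mem pe) mem_iota; lia.
have inT j : j \in lefts fs ++ rights fs -> j \in tids T by rewrite -E.
have chE j : j \in tids T -> ch s3 j = ch s j.
  by move=> jT; rewrite ch3 upd_other //; apply: nA.
have chA : ch s3 A = a by rewrite ch3 upd_same.
have ch0 : ch s3 0 = a by rewrite ch3 upd_other.
have al3 : all (fun j => (ch s3 j < a)%O) (lefts fs).
  apply/allP=> j jl; rewrite chE; last by apply: inT; rewrite mem_cat jl.
  by move/allP: al; apply.
have ar3 : all (fun j => (a < ch s3 j)%O) (rights fs).
  apply/allP=> j jl; rewrite chE; last by apply: inT; rewrite mem_cat jl orbT.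
  by move/allP: ar_; apply.
have ta3 : tree_at s3 (TN A 1 TE TE).
  case: ta => _ h2 h3; rewrite /tree_at /= a15 a16 a17 !upd_same.
  by split=> //; rewrite upd_other // A2.
have cr3 : ctx_rep (ar s3 15) (ar s3 16) (ar s3 17) fs.
  apply: ctx_rep_eq cr => j /inT/nA jA.
  by rewrite a15 a16 a17 !upd_other // !A2.
set ids := lefts fs ++ A :: rights fs.
have pids : perm_eq ids (iota 1 A).
  have -> : iota 1 A = rcons (iota 1 (rg s 2)) A.
    have -> : A = rg s 2 + 1 by rewrite addn1.
    by rewrite iotaD /= cats1 addnC.
  rewrite perm_sym perm_rcons perm_sym /ids -cat1s perm_catCA /= perm_cons.
  by rewrite E.
have Uids : uniq ids by rewrite (perm_uniq pids) iota_uniq.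
have szids : size ids <= rg s3 1.
  by rewrite (perm_size pids) size_iota R3 //; move: AN; rewrite e2.
have cg : exists2 t0, ctx_ok fs t0 & grown t0 (TN A 1 TE TE).
  by exists TE => //; split; [split=> //; left | right].
have sk3 : stk_rep (ar s3 18) fs by rewrite A3.
have r13' : rg s3 13 = size fs by rewrite R3.
apply: wpb_seq.
apply: wpb_conseq
  (wpb_framed (up_spec ta3 r14 cr3 sk3 r13' ch0 al3 ar3 cg erefl Uids szids)) _ _.
  by rewrite addn1 ltnS -[32]/(16 * 2) -mulnA leq_mul2l szfs.
move=> s4 [[T' ta4 [r14' aT' iT']] [R4 A4 C4 O4]].
apply: wpb_seq; apply: wpb_sym => //=; apply: wpb_sym => //=; apply: wpb_sym => //=.
have e42 : rg s4 2 = A by rewrite R4.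
have ch4 : ch s4 = ch s3 by rewrite C4.
(* The search ended in an empty subtree, so every number in the tree belongs to a smaller or a
   larger character. *)
have naS : a \notin S.
  apply/negP=> /cdS [cA cE].
  have : cd a \in tids T by rewrite (perm_mem pe) mem_iota add1n ltnS.
  move/sc_mem => /=; case/orP=> [/(allP al)|/(allP ar_)] /=; rewrite cE ltxx //.
exists (fun c => if c == a then A else cd c); split; last first.
- by rewrite /upd /= e42 eqxx.
- by move=> c cS; case: eqP => // ca; move: naS; rewrite -ca cS.
split.
- exists T'; rewrite /= /upd /= ch4 e42 r14' iT'; split=> //.
  rewrite /ids pairwise_cat pairwise_cons allrel_consr.
  have : pairwise (fun i j => (ch s3 i < ch s3 j)%O) (lefts fs ++ rights fs).
    have pm (g : nat -> Sigma) u :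
        pairwise (fun i j => (g i < g j)%O) u = pairwise <%O [seq g i | i <- u].
      by rewrite pairwise_map.
    rewrite E pm (_ : map _ _ = [seq ch s i | i <- tids T]) -?pm //.
    exact/eq_in_map.
  rewrite pairwise_cat => /and3P[-> -> ->]; rewrite chA !andbT.
  by rewrite al3.
- move=> j; rewrite /= /upd /= e42 ch4 => jA; rewrite inE; case: (j =P A) => [->|ne].
    by rewrite chA eqxx.
  have jA' : 0 < j <= rg s 2 by move: ne jA; rewrite /A; clear; lia.
    by rewrite ch3 upd_other // inS ?orbT.
- move=> c; rewrite /= /upd /= e42 ch4 inE; case: eqP => [-> _|_ /= cS].
    by split=> //; rewrite leqnn andbT.
  have [h1 h2] := cdS _ cS.
  split; first by case/andP: h1 => h11 h12; rewrite h11; apply: leqW.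
  by rewrite ch3 upd_other // => E1; case/andP: h1; rewrite E1 ltnn.
Qed.

End Alphabet.

(** * The suffix tree *)

Lemma key_eo (v v' k k' : nat) : (v, 2 * k) <> (v', 2 * k' + 1).
Proof. by case; lia. Qed.

Lemma key_oe (v v' k k' : nat) : (v, 2 * k + 1) <> (v', 2 * k').
Proof. by case; lia. Qed.

Lemma link_key_inj (k k' : nat) : 2 * k = 2 * k' -> k = k'.
Proof. lia. Qed.

Lemma child_key_inj (k k' : nat) : 2 * k + 1 = 2 * k' + 1 -> k = k'.
Proof. lia. Qed.

Lemma key_parity (k : nat) : k = 2 * k./2 \/ k = 2 * k./2 + 1.
Proof. lia. Qed.

Section Tree.
Variables (Sigma : finType) (dollar : Sigma).
Implicit Types (S X w : seq Sigma) (a b c : Sigma).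
Local Notation chr := (chr dollar).

(* Node [2 i] is the leaf of the suffix of length [i], node [2 i + 1] the
   internal node created together with that leaf (present iff its depth is
   positive), and node 1 the root. Hence the string of any node is a prefix of
   the suffix of length [v./2]. *)
Definition nstr X (len : nat -> nat) v := take (len v) (suf X v./2).
Definition inode (len : nat -> nat) v := (v == 1) || (odd v && (0 < len v)).
Definition node (len : nat -> nat) k v :=
  inode len v || [&& ~~ odd v, 0 < v & v./2 <= k].

(* The compacted trie of the suffixes of [X] of lengths 1, ..., k, with
   explicit nodes the words in [Br]. Key [2 c] of dictionary [v] is the
   (inverse suffix) link to the node [c v], key [2 c + 1] the child of [v] along
   the character coded [c]. *)
Record tree_inv X k (Br : seq Sigma -> Prop) (cd : Sigma -> nat)
    (len par : nat -> nat) (m : nat -> nat -> nat) : Prop := TreeInv {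
  ti_k : k <= size X;
  ti_root : len 1 = 0;
  ti_par1 : par 1 = 0;
  ti_leaf : forall i, 0 < i <= k -> len (2 * i) = i;
  ti_int : forall v, inode len v ->
    [/\ len v <= v./2, v./2 <= size X & Br (nstr X len v)];
  ti_inj : forall u v, inode len u -> inode len v ->
    nstr X len u = nstr X len v -> u = v;
  ti_cov : forall w, Br w -> exists2 v, inode len v & nstr X len v = w;
  ti_par : forall v, node len k v -> v <> 1 ->
    [/\ inode len (par v), len (par v) < len v,
        prefix (nstr X len (par v)) (nstr X len v)
      & forall u, inode len u -> prefix (nstr X len u) (nstr X len v) ->
          len u < len v -> len u <= len (par v)];
  ti_ws : forall v (c : nat) u, m v (2 * c) = u -> u <> 0 ->
    [/\ inode len u, inode len v &
        exists2 x, nstr X len u = x :: nstr X len v & cd x = c];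
  ti_wc : forall u x w, inode len u -> nstr X len u = x :: w ->
    exists v, [/\ inode len v, nstr X len v = w & m v (2 * cd x) = u];
  ti_cs : forall v (c : nat) u, m v (2 * c + 1) = u -> u <> 0 ->
    [/\ inode len v, node len k u, u <> 1, par u = v &
        cd (nth dollar (nstr X len u) (len v)) = c];
  ti_cc : forall u, node len k u -> u <> 1 ->
    m (par u) (2 * cd (nth dollar (nstr X len u) (len (par u))) + 1) = u }.

Lemma inode_odd len v : inode len v -> odd v.
Proof. by case/orP=> [/eqP-> //|/andP[]]. Qed.

Lemma inode_node len k v : inode len v -> node len k v.
Proof. by move=> iv; rewrite /node iv. Qed.

Lemma leaf_node len k i : 0 < i <= k -> node len k (2 * i).
Proof. by move=> ik; rewrite /node; apply/orP; right; lia. Qed.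

Lemma nodeP len k v : node len k v ->
  inode len v \/ exists2 i, v = 2 * i & 0 < i <= k.
Proof. by case/orP=> [|h]; [left | right; exists v./2; lia]. Qed.

Lemma inode_upd_even len v x u : ~~ odd v -> inode (upd len v x) u = inode len u.
Proof.
rewrite /inode /upd => ev; case: (u =P v) => [->|//].
by rewrite (negPf ev).
Qed.

Section Facts.
Variables (X : seq Sigma) (k : nat) (Br : seq Sigma -> Prop) (cd : Sigma -> nat).
Variables (len par : nat -> nat) (m : nat -> nat -> nat).
Hypothesis inv : tree_inv X k Br cd len par m.
Local Notation ns := (nstr X len).

Lemma half_double i : (2 * i)./2 = i. Proof. lia. Qed.

Lemma nstr_leaf i : 0 < i <= k -> ns (2 * i) = suf X i.
Proof.
move=> ik; rewrite /nstr (ti_leaf inv ik) half_double take_oversize //.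
by rewrite size_suf //; have := ti_k inv; lia.
Qed.

Lemma node_bounds v : node len k v -> len v <= v./2 <= size X.
Proof.
case/nodeP=> [/(ti_int inv)[-> -> _] //|[i -> ik]].
by rewrite half_double (ti_leaf inv ik) leqnn; have := ti_k inv; lia.
Qed.

Lemma size_nstr v : node len k v -> size (ns v) = len v.
Proof. by move/node_bounds=> /andP[h1 h2]; rewrite size_takel // size_suf. Qed.

Lemma nstr1 : ns 1 = [::].
Proof. by rewrite /nstr (ti_root inv) take0. Qed.

Lemma inode0 : inode len 0 = false. Proof. by []. Qed.

Lemma m0 (c : nat) : m 0 c = 0.
Proof.
case: (m 0 c =P 0) => // nz.
have [E|E] := key_parity c.
  by rewrite E in nz; have [] := ti_ws inv erefl nz.
by rewrite E in nz; have [] := ti_cs inv erefl nz.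
Qed.

Lemma nstr_prefix_len u v : inode len u -> inode len v ->
  prefix (ns u) (ns v) -> len u = len v -> u = v.
Proof.
move=> iu iv p E; apply: (ti_inj inv) => //.
rewrite (prefix_eq_take p) size_nstr ?inode_node // E take_oversize //.
by rewrite size_nstr ?inode_node.
Qed.

Lemma path_eq u v s : inode len u -> inode len v -> prefix (ns u) s ->
  prefix (ns v) s -> len u = len v -> u = v.
Proof.
move=> iu iv pu pv E; apply: nstr_prefix_len => //.
by apply: prefix_le_take pu pv _; rewrite !size_nstr ?inode_node // E.
Qed.

(** Climb from the leaf of the suffix: the parents stay below [y] until a node has [y] as its
    parent, and that node is the child along [b]. *)
Lemma child_exists y b i : inode len y -> 0 < i <= k ->
  prefix (rcons (ns y) b) (suf X i) -> m y (2 * cd b + 1) <> 0.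
Proof.
move=> iy ik pi.
suff main n u : len u <= n -> node len k u -> prefix (rcons (ns y) b) (ns u) ->
    m y (2 * cd b + 1) <> 0.
  by apply: (main _ (2 * i)); rewrite ?nstr_leaf ?leaf_node.
have sy := size_nstr (inode_node k iy).
elim: n u => [|n IH] u un nu pu.
  by have := size_prefix pu; rewrite size_rcons (size_nstr nu); lia.
have su := size_prefix pu; rewrite size_rcons (size_nstr nu) sy in su.
have u1 : u <> 1 by move=> E; rewrite E (ti_root inv) in su.
have [ip lp pp mp] := ti_par inv nu u1.
have pyu : prefix (ns y) (ns u) by apply: prefix_trans pu; apply: prefix_rcons.
have yp := mp y iy pyu su.
have [E|ne] := (len y =P len (par u)).
  have Ep : par u = y by apply: path_eq pp pyu _.
  have := ti_cc inv nu u1; rewrite Ep.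
  have -> : nth dollar (ns u) (len y) = b.
    case/prefixP: pu => s ->.
    by rewrite nth_cat size_rcons sy leqnn nth_rcons sy ltnn eqxx.
  by move=> ->; case/nodeP: (nu) => [/inode_odd|[j ->]]; lia.
apply: (IH (par u)); rewrite ?inode_node //; first by lia.
apply: prefix_le_take pu pp _.
by rewrite size_rcons sy size_nstr ?inode_node //; lia.
Qed.

Lemma tree_code cd' : {in X, cd' =1 cd} -> tree_inv X k Br cd' len par m.
Proof.
move=> E; have sub v : {subset ns v <= X}.
  by move=> x /mem_take /mem_drop.
case: inv => i1 i2 i3 i4 i5 i6 i7 i8 i9 i10 i11 i12; split=> //.
- move=> v c u h nz; have [iu iv [x xE xc]] := i9 _ _ _ h nz.
  split=> //; exists x => //; rewrite E //; apply: (sub u).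
  by rewrite xE inE eqxx.
- move=> u x w iu uE; have [v [iv vE mE]] := i10 _ _ _ iu uE.
  exists v; split=> //; rewrite E //; apply: (sub u).
  by rewrite uE inE eqxx.
- move=> v c u h nz; have [iv nu u1 pu uc] := i11 _ _ _ h nz.
  split=> //; rewrite E // (sub u) // mem_nth //.
  by rewrite size_nstr // -pu; have [] := i8 _ nu u1.
- move=> u nu u1; rewrite E; first exact: i12.
  by apply: (sub u); rewrite mem_nth // size_nstr //; have [] := i8 _ nu u1.
Qed.

Lemma tree_Br Br' : (forall w, Br w <-> Br' w) -> tree_inv X k Br' cd len par m.
Proof.
move=> E; case: inv => i1 i2 i3 i4 i5 i6 i7 i8 i9 i10 i11 i12; split=> //.
- by move=> v /i5[h1 h2 /E].
- by move=> w /E /i7.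
Qed.

(** Positions count from the right end, so a longer text leaves the string of every node
    unchanged. *)
Lemma tree_text a : tree_inv (a :: X) k Br cd len par m.
Proof.
have sE v : node len k v -> nstr (a :: X) len v = ns v.
  by move/node_bounds=> /andP[_ h]; rewrite /nstr suf_cons.
have iE v : inode len v -> nstr (a :: X) len v = ns v.
  by move=> iv; apply: sE; apply: inode_node.
case: inv => i1 i2 i3 i4 i5 i6 i7 i8 i9 i10 i11 i12; split=> //.
- exact: leqW.
- by move=> v iv; have [h1 h2 h3] := i5 _ iv; rewrite iE //; split=> //; apply: leqW.
- by move=> u v iu iv; rewrite !iE //; apply: i6.
- by move=> w /i7[v iv vE]; exists v; rewrite ?iE.
- move=> v nv v1; have [h1 h2 h3 h4] := i8 _ nv v1.
  by rewrite (sE v) // (iE (par v)) //; split=> // u iu; rewrite (iE u) //; apply: h4.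
- move=> v c u h nz; have [iu iv [x xE xc]] := i9 _ _ _ h nz.
  by rewrite !iE //; split=> //; exists x.
- move=> u x w iu; rewrite iE // => /(i10 _ _ _ iu)[v [iv vE mE]].
  by exists v; rewrite iE.
- move=> v c u h nz; have [iv nu u1 pu uc] := i11 _ _ _ h nz.
  by rewrite sE.
- by move=> u nu u1; rewrite sE //; apply: i12.
Qed.

Lemma add_leaf y : k.+1 = size X -> inode len y -> prefix (ns y) X ->
  len y < size X ->
  (forall z, inode len z -> prefix (ns z) X -> len z <= len y) ->
  let N := size X in let key := 2 * cd (nth dollar X (len y)) + 1 in
  m y key = 0 ->
  tree_inv X N Br cd (upd len (2 * N) N) (upd par (2 * N) y)
    (upd2 m y key (2 * N)).
Proof.
move=> kN iy py lyN deep N key my0.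
set len' := upd len _ _; set par' := upd par _ _; set m' := upd2 _ _ _ _.
have ii u : inode len' u = inode len u by apply: inode_upd_even; rewrite oddM.
have ne u : node len k u -> u <> 2 * N.
  by case/nodeP=> [/inode_odd|[i -> ik]]; lia.
have lE u : node len k u -> len' u = len u by move/ne=> h; rewrite /len' upd_other.
have pE u : node len k u -> par' u = par u by move/ne=> h; rewrite /par' upd_other.
have sE u : node len k u -> nstr X len' u = ns u by move=> nu; rewrite /nstr lE.
have lI u : inode len u -> len' u = len u by move/(inode_node k)/lE.
have sI u : inode len u -> nstr X len' u = ns u by move/(inode_node k)/sE.
have lN : len' (2 * N) = N by rewrite /len' upd_same.
have pN : par' (2 * N) = y by rewrite /par' upd_same.
have sN : nstr X len' (2 * N) = X.
  by rewrite /nstr lN half_double suf_size take_size.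
have nodeN u : node len' N u -> u = 2 * N \/ node len k u.
  case/nodeP=> [|[i -> iN]]; first by rewrite ii => h; right; apply: inode_node.
  by case: (i =P N) => [->|nE]; [left | right; apply: leaf_node; lia].
have nodeW u : node len k u -> node len' N u.
  case/nodeP=> [h|[i -> ik]]; first by rewrite inode_node // ii.
  by apply: leaf_node; lia.
have N0 : 0 < N by lia.
case: (inv) => i1 i2 i3 i4 i5 i6 i7 i8 i9 i10 i11 i12; split=> //.
- by rewrite lI.
- by rewrite pE // inode_node.
- move=> i iN; case: (i =P N) => [->//|nE].
  have ik : 0 < i <= k by lia.
  by rewrite lE ?leaf_node // i4.
- by move=> v; rewrite ii => iv; rewrite lI // sI //; apply: i5.
- by move=> u v; rewrite !ii => iu iv; rewrite !sI //; apply: i6.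
- by move=> w /i7[v iv vE]; exists v; rewrite ?ii ?sI.
- move=> v /nodeN[->|nv] v1.
    rewrite pN lN sN ii lI // sI //; split=> // u; rewrite ii => iu.
    by rewrite sI // lI // => pu _; apply: deep.
  have [h1 h2 h3 h4] := i8 _ nv v1.
  rewrite pE // lI // sI // lE // sE // ii; split=> // u; rewrite ii => iu.
  by rewrite sI // lI //; apply: h4.
- move=> v c u; rewrite /m' upd2_other; last exact: key_eo.
  move=> h nz; have [iu iv [x xE xc]] := i9 _ _ _ h nz.
  by rewrite !ii !sI //; split=> //; exists x.
- move=> u x w; rewrite ii => iu; rewrite sI // => /(i10 _ _ _ iu)[v [iv vE mE]].
  exists v; rewrite ii sI //; split=> //.
  by rewrite /m' upd2_other //; case=> _; rewrite /key; lia.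
- move=> v c u; case: ((v, 2 * c + 1) =P (y, key)) => [[-> cE]|nE].
    rewrite cE /m' upd2_same => <- _.
    split; [by rewrite ii | by apply: leaf_node; rewrite N0 leqnn | by lia | by [] |].
    by rewrite sN lI //; move: cE; rewrite /key; lia.
  rewrite /m' upd2_other // => h nz; have [iv nu u1 pu uc] := i11 _ _ _ h nz.
  by rewrite ii pE // sE // lI //; split=> //; apply: nodeW.
- move=> u /nodeN[->|nu] u1; first by rewrite pN sN lI // /m' upd2_same.
  have [h1 _ _ _] := i8 _ nu u1; have cc := i12 _ nu u1.
  rewrite pE // sE // lI // /m' upd2_other // => -[E1 E2].
  rewrite E2 E1 my0 in cc.
  by rewrite -cc in nu; case/nodeP: nu => [|[i]]; rewrite ?inode0 //; lia.
Qed.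

(** The node [w] splits the edge from [y] to [q]. It receives one link, from [pp], and sends out
    none: a branching word [x :: w0] would have had [w0] as an explicit tail before. *)
Lemma add_internal a q D pp (w : nat) : {in X &, injective cd} -> inode len w = false -> odd w -> w./2 = size X ->
  node len k q -> q <> 1 ->
  let y := par q in let w0 := take D X in
  len y < D -> D < len q -> D <= size X -> prefix w0 (ns q) ->
  inode len pp -> w0 = a :: ns pp ->
  let m' := upd2 (upd2 (upd2 m y (2 * cd (nth dollar X (len y)) + 1) w)
              pp (2 * cd a) w) w (2 * cd (nth dollar (ns q) D) + 1) q in
  [/\ m y (2 * cd (nth dollar X (len y)) + 1) = q, m pp (2 * cd a) = 0,
      forall c : nat, m w c = 0, ~ Br w0 &
    tree_inv X k (fun v => Br v \/ v = w0) cd (upd len w D)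
      (upd (upd par w y) q w) m'].
Proof.
move=> cdI iw ow wX nq q1 y w0 yD Dq DX w0q ipp w0E m'.
have [iy lyq pyq my] := ti_par inv nq q1.
rewrite -/y in iy lyq pyq my.
have sw0 : size w0 = D by rewrite size_takel.
have w1 : w <> 1 by move=> E; rewrite E in iw.
have nBr : ~ Br w0.
  case/(ti_cov inv) => z iz zE.
  have zl : len z = D by rewrite -(size_nstr (inode_node k iz)) zE.
  have := my z iz; rewrite zE zl => /(_ w0q Dq); lia.
have yw0 : prefix (ns y) w0.
  by apply: prefix_le_take pyq w0q _; rewrite size_nstr ?inode_node // sw0 ltnW.
have bE : nth dollar (ns q) (len y) = nth dollar X (len y).
  by case/prefixP: w0q => s ->; rewrite nth_cat sw0 yD nth_take.
have myq : m y (2 * cd (nth dollar X (len y)) + 1) = q.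
  by rewrite -bE; apply: (ti_cc inv).
have mpp : m pp (2 * cd a) = 0.
  case: (m pp (2 * cd a) =P 0) => // nz.
  have [iu _ [x xE xa]] := ti_ws inv erefl nz.
  case: nBr; have [_ _] := ti_int inv iu.
  rewrite xE w0E; suff -> : x = a by [].
  have aX : a \in X by have /mem_take : a \in w0 by rewrite w0E inE eqxx.
  apply: cdI => //; set u := m pp _ in xE.
  by have /mem_take/mem_drop : x \in ns u by rewrite xE inE eqxx.
have mw (c : nat) : m w c = 0.
  case: (m w c =P 0) => // nz.
  have [E|E] := key_parity c.
    by rewrite E in nz; have [] := ti_ws inv erefl nz; rewrite iw.
  by rewrite E in nz; have [] := ti_cs inv erefl nz; rewrite iw.
split=> //.
set len' := upd len w D; set par' := upd _ q w.
set b := nth dollar X (len y) in m' myq *.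
have nw u : node len k u -> u <> w.
  case/nodeP=> [iu E|[i ->]]; first by rewrite -E iu in iw.
  by move=> _ E; move: ow; rewrite -E oddM.
have wq : w <> q by move=> E; apply: (nw q).
have yw : y <> w by apply/nw/inode_node.
have lE u : node len k u -> len' u = len u by move/nw=> h; rewrite /len' upd_other.
have sE u : node len k u -> nstr X len' u = ns u by move=> nu; rewrite /nstr lE.
have lI u : inode len u -> len' u = len u by move/(inode_node k)/lE.
have sI u : inode len u -> nstr X len' u = ns u by move/(inode_node k)/sE.
have lw : len' w = D by rewrite /len' upd_same.
have sw : nstr X len' w = w0 by rewrite /nstr lw wX suf_size.
have pw : par' w = y by rewrite /par' upd_other // upd_same.
have pq : par' q = w by rewrite /par' upd_same.
have pE u : node len k u -> u <> q -> par' u = par u.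
  by move=> nu uq; rewrite /par' !upd_other //; apply: nw.
have D0 : 0 < D by apply: leq_ltn_trans yD.
have iw' : inode len' w by rewrite /inode lw ow D0 orbT.
have iW u : inode len u -> inode len' u.
  move=> iu; move: (iu); rewrite /inode lI //.
have iN u : inode len' u -> u = w \/ inode len u.
  case: (u =P w) => [->|ne]; first by left.
  by rewrite /inode /len' upd_other //; right.
have nW u : node len k u -> node len' k u.
  by case/nodeP=> [/iW/(inode_node k)//|[i -> ik]]; apply: leaf_node.
have nN u : node len' k u -> u = w \/ node len k u.
  case/nodeP=> [/iN[->|/(inode_node k)]|[i -> ik]]; [by left|by right|].
  by right; apply: leaf_node.
have snth u : node len k u -> prefix w0 (ns u) -> nth dollar (ns u) (len y) = b.
  by move=> nu /prefixP[s ->]; rewrite nth_cat sw0 yD nth_take.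
case: (inv) => i1 i2 i3 i4 i5 i6 i7 i8 i9 i10 i11 i12; split=> //.
- by rewrite lI.
- by rewrite pE // => E; apply: q1.
- by move=> i ik; rewrite lE ?leaf_node // i4.
- move=> v /iN[->|iv].
    by rewrite lw sw wX; split=> //; right.
  by have [h1 h2 h3] := i5 _ iv; rewrite lI // sI //; split=> //; left.
- move=> u v /iN[->|iu] /iN[->|iv] //.
  + by rewrite sw sI // => E; case: nBr; rewrite E; case: (i5 _ iv).
  + by rewrite sw sI // => E; case: nBr; rewrite -E; case: (i5 _ iu).
  + by rewrite !sI //; apply: i6.
- move=> v [/i7[u iu uE]|->]; last by exists w.
  by exists u; [apply: iW | rewrite sI].
- move=> v nv v1; case: (v =P w) => [->|vw].
    rewrite pw lw sw lI // sI //; split=> //; first exact: iW.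
    move=> u /iN[->|iu]; first by rewrite lw ltnn.
    rewrite sI // lI // => pu uD; apply: my => //.
      exact: prefix_trans pu w0q.
    exact: ltn_trans Dq.
  case: (v =P q) => [->|vq].
    rewrite pq lw sw lE // sE //; split=> // u /iN[->|iu]; first by rewrite lw.
    by rewrite sI // lI // => pu uq; apply: leq_trans (my u iu pu uq) (ltnW yD).
  have {}nv : node len k v by case: (nN _ nv).
  have [h1 h2 h3 h4] := i8 _ nv v1.
  rewrite pE // lI // sI // lE // sE //; split=> //; first exact: iW.
  move=> u /iN[->|iu]; last by rewrite sI // lI //; apply: h4.
  rewrite sw lw => w0v Dv; rewrite leqNgt; apply/negP=> pD.
  (* otherwise [v] hangs below [y] along the same character as [q] *)
  have pw0 : prefix (ns (par v)) w0.
    by apply: prefix_le_take h3 w0v _; rewrite size_nstr ?inode_node // sw0 ltnW.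
  have py := my _ h1 (prefix_trans pw0 w0q) (ltn_trans pD Dq).
  have yp := h4 _ iy (prefix_trans yw0 w0v) (ltn_trans yD Dv).
  have Ep : par v = y by apply: path_eq pw0 yw0 _ => //; apply/eqP; rewrite eqn_leq py.
  have := i12 _ nv v1; rewrite Ep snth // myq => E.
  by apply: vq.
- move=> v c u; rewrite {1}/m' upd2_other; last exact: key_eo.
  case: ((v, 2 * c) =P (pp, 2 * cd a)) => [[-> cE]|ne].
    rewrite cE upd2_same => <- _; rewrite sw sI //; split=> //; first exact: iW.
    by exists a => //; rewrite (link_key_inj cE).
  rewrite upd2_other // upd2_other; last exact: key_eo.
  move=> h nz; have [iu iv xE] := i9 _ _ _ h nz.
  by rewrite !sI //; split=> //; apply: iW.
- move=> u x z /iN[->|iu].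
    rewrite sw w0E => -[<- <-]; exists pp; rewrite sI //; split=> //; first exact: iW.
    by rewrite /m' upd2_other ?upd2_same //; exact: key_eo.
  rewrite sI // => /(i10 _ _ _ iu)[v [iv vE mE]]; exists v; rewrite sI //.
  split=> //; first exact: iW.
  rewrite /m' upd2_other; last exact: key_eo.
  rewrite upd2_other.
    by rewrite upd2_other //; exact: key_eo.
  case=> E1 E2; rewrite E1 E2 mpp in mE.
  by rewrite -mE in iu.
- move=> v c u.
  case: ((v, 2 * c + 1) =P (w, 2 * cd (nth dollar (ns q) D) + 1)) => [[-> cE]|ne].
    rewrite /m' cE upd2_same => <- _; rewrite pq lw sE //; split=> //.
      exact: nW.
    by rewrite (child_key_inj cE).
  rewrite /m' upd2_other // upd2_other; last exact: key_oe.
  case: ((v, 2 * c + 1) =P (y, 2 * cd b + 1)) => [[-> cE]|ne'].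
    rewrite cE upd2_same => <- _; rewrite pw sw lI //; split=> //.
    - exact: iW.
    - exact: inode_node.
    - by rewrite nth_take // -/b (child_key_inj cE).
  rewrite upd2_other // => h nz; have [iv nu u1 pu uc] := i11 _ _ _ h nz.
  have uq : u <> q.
    move=> E; apply: ne'; rewrite -uc E -pu E -/y; congr (_, _).
    by rewrite bE.
  by rewrite pE // sE // lI //; split=> //; [apply: iW | apply: nW].
- move=> u nu u1; case: (u =P w) => [->|uw].
    rewrite pw sw lI // nth_take // -/b /m' upd2_other; last by case.
    by rewrite upd2_other ?upd2_same //; exact: key_oe.
  case: (u =P q) => [->|uq]; first by rewrite pq lw sE // /m' upd2_same.
  have {}nu : node len k u by case: (nN _ nu).
  have [h1 _ _ _] := i8 _ nu u1; have cc := i12 _ nu u1.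
  rewrite pE // sE // lI // /m' upd2_other; last first.
    by case=> E _; apply: (nw (par u)) => //; apply: inode_node.
  rewrite upd2_other; last exact: key_oe.
  by rewrite upd2_other // => -[E1 E2]; apply: uq; rewrite -cc E2 E1.
Qed.

End Facts.
End Tree.

Ltac slia :=
  repeat match goal with
  | H : ?T |- _ =>
    lazymatch type of T with Prop =>
      lazymatch T with
      | is_true (leq _ _) => fail
      | is_true (leq _ _ && leq _ _) => fail
      | @eq nat _ _ => fail
      | ~ (@eq nat _ _) => fail
      | is_true (~~ (@eq_op _ _ _)) => fail
      | _ => clear H
      end
    end
  end; lia.

(** * Locating the insertion point of a new suffix *)

Section Insertion.
Variables (Sigma : finType) (dollar : Sigma).
Implicit Types (w : seq Sigma).
Local Notation chr := (chr dollar).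
Local Notation tree_inv := (tree_inv dollar).

(** A nonempty suffix contains the end-marker and occurs once, whereas a branching word repeats. *)
Lemma branching_proper (S : seq Sigma) i w : terminated dollar S ->
  0 < i <= size S -> branching S w -> prefix w (suf S i) -> size w < i.
Proof.
move=> tS /andP[i0 iS] bw pw; have n0 := terminated_size tS.
have sw := size_prefix pw; rewrite size_suf // in sw.
rewrite ltn_neqAle sw andbT; apply/negP=> /eqP E.
have wE : w = suf S i by rewrite (prefix_eq_take pw) E take_oversize // size_suf.
have [m [m' [mS mS' nm pm pm']]] := branching_repeat n0 bw.
have [k [kS ki pk]] : exists k, [/\ k <= size S, i != k & prefix w (suf S k)].
  case: (i =P m) => [E'|/eqP]; last by exists m.
  by exists m'; rewrite E'.
have := suf_not_prefix tS _ kS ki; rewrite i0 iS => /(_ isT).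
by rewrite -wE pk.
Qed.

Lemma sub_in_count (T : eqType) (p p' : pred T) (s : seq T) :
  (forall d, d \in s -> p d -> p' d) -> count p s <= count p' s.
Proof.
move=> sub; apply: leq_trans (_ : count (predI p p') s <= _).
  by rewrite (eq_in_count (a2 := predI p p')) // => d /sub /=; case: (p d) => //= ->.
by apply: sub_count => d /andP[].
Qed.

Section Static.
Variables (S : seq Sigma) (cd : Sigma -> nat).
Variables (len par : nat -> nat) (m : nat -> nat -> nat).
Hypothesis inv : tree_inv S (size S) (branching S) cd len par m.
Hypothesis tS : terminated dollar S.
Local Notation n := (size S).
Local Notation ns := (nstr S len).

Definition on_path x := inode len x && prefix (ns x) S.

Let n0 : 0 < n. Proof. exact: terminated_size tS. Qed.
Let nodeL i (h : 0 < i <= n) : node len n (2 * i) := leaf_node len h.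

Lemma inode_proper i u : 0 < i <= n -> inode len u -> prefix (ns u) (suf S i) ->
  len u < i.
Proof.
move=> ih iu pu; rewrite -(size_nstr inv (inode_node n iu)).
by apply: branching_proper pu => //; have [] := ti_int inv iu.
Qed.

Lemma par_leaf i : 0 < i <= n ->
  [/\ inode len (par (2 * i)), len (par (2 * i)) < i,
      prefix (ns (par (2 * i))) (suf S i)
    & forall u, inode len u -> prefix (ns u) (suf S i) -> len u <= len (par (2 * i))].
Proof.
move=> ih; have [|h1 h2 h3 h4] := ti_par inv (nodeL ih); first by lia.
rewrite (ti_leaf inv ih) in h2 h4; rewrite (nstr_leaf inv ih) in h3 h4.
by split=> // u iu pu; apply: h4 => //; apply: inode_proper pu.
Qed.

Lemma par_top : on_path (par (2 * n)) /\
  (forall z, on_path z -> len z <= len (par (2 * n))).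
Proof.
have [|h1 h2 h3 h4] := @par_leaf n; first by rewrite n0 leqnn.
rewrite suf_size in h3 h4; rewrite /on_path h1 h3; split=> // z /andP[].
exact: h4.
Qed.

Lemma par_path x : on_path x -> x <> 1 ->
  [/\ on_path (par x), len (par x) < len x
    & forall z, on_path z -> len z < len x -> len z <= len (par x)].
Proof.
case/andP=> ix px x1; have [h1 h2 h3 h4] := ti_par inv (inode_node n ix) x1.
split=> //; first by rewrite /on_path h1 (prefix_trans h3 px).
move=> z /andP[iz pz] zx; apply: h4 => //.
apply: prefix_le_take pz px _.
by rewrite !(size_nstr inv) ?inode_node // ltnW.
Qed.

Lemma on_path_eq x z : on_path x -> on_path z -> len x = len z -> x = z.
Proof. by case/andP=> ix px /andP[iz pz]; apply: (path_eq inv) px pz. Qed.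

(** If the prefix one longer than the parent also occurred at [k], the word at which the suffixes
    [i] and [k] diverge would be branching and deeper than the parent. *)
Lemma repeat_lengths_par : repeat_lengths S (fun i => len (par (2 * i))).
Proof.
move=> i ih; have [h1 h2 h3 h4] := par_leaf ih; case/andP: (ih) => i0 iS.
have wE : take (len (par (2 * i))) (suf S i) = ns (par (2 * i)).
  by rewrite [RHS](prefix_eq_take h3) (size_nstr inv) // inode_node.
split=> //.
  have [_ _ bp] := ti_int inv h1.
  have [k [k' [kS kS' nk pk pk']]] := branching_repeat n0 bp.
  rewrite wE; case: (k =P i) => [E|/eqP ne]; last by exists k.
  by exists k'; split=> //; rewrite -E eq_sym.
move=> k kS pk; apply/eqP/negP=> /negP ki.
have sz := size_prefix pk; rewrite size_takel ?size_suf // in sz.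
have kh : 0 < k <= n by lia.
have ik : i != k by rewrite eq_sym.
have [d [di dk E nE]] := suf_split tS ih kh ik.
have ld : len (par (2 * i)) < d.
  rewrite ltnNge; apply/negP=> dl; case/eqP: nE.
  rewrite -!(nth_suf dollar) //; try lia.
  case/prefixP: pk => s ->; rewrite nth_cat size_takel ?size_suf // ltnS dl.
  by rewrite nth_take.
have bd : branching S (take d (suf S i)).
  by apply: branching_split nE => //; [rewrite di | rewrite dk].
have [u iu uE] := ti_cov inv bd.
have du : len u = d.
  by rewrite -(size_nstr inv (inode_node n iu)) uE size_takel // size_suf // ltnW.
have := h4 u iu; rewrite uE => /(_ (prefix_take _ _)); lia.
Qed.

Lemma inode_repeat v : inode len v -> repeat S (ns v).
Proof.
move=> iv; apply/occ_ge2P; apply: branching_repeat => //.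
by have [] := ti_int inv iv.
Qed.

Definition net_count v : nat :=
  count (fun i => (par (2 * i) == v) && (len (par (2 * i.+1)) <= len (par (2 * i))))
        (iota 1 n.-1).

Lemma nf_nstr v : inode len v -> nf S (ns v) = net_count v.
Proof.
move=> iv; rewrite (nf_count tS repeat_lengths_par (inode_repeat iv)).
apply: eq_in_count => i; rewrite mem_iota => ih.
have [|h1 h2 h3 h4] := @par_leaf i; first by lia.
rewrite /net; congr (_ && _).
have -> : take (len (par (2 * i))) (suf S i) = ns (par (2 * i)).
  by rewrite [RHS](prefix_eq_take h3) (size_nstr inv) // inode_node.
apply/eqP/eqP => [|-> //]; exact: (ti_inj inv).
Qed.

Lemma PNF_net_count w f : (w, f) \in PNF S <->
  exists v, [/\ inode len v, ns v = w, f = net_count v & 0 < net_count v].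
Proof.
rewrite (PNFE dollar); split.
  case/and3P=> rw /eqP fE nf0.
  have [v iv vE] : exists2 v, inode len v & ns v = w; last first.
    by exists v; rewrite -nf_nstr // vE.
  move: nf0; rewrite (nf_count tS repeat_lengths_par rw) -has_count.
  case/hasP=> i; rewrite mem_iota => ih /andP[/eqP wE _].
  have [|h1 h2 h3 h4] := @par_leaf i; first by lia.
  exists (par (2 * i)) => //; rewrite -wE {1}(prefix_eq_take h3).
  by rewrite (size_nstr inv) // inode_node.
case=> v [iv vE -> c0]; rewrite -vE inode_repeat //.
by rewrite nf_nstr // eqxx c0.
Qed.

(* The amortized cost of the walk is paid for by the string depths of the
   explicit nodes on the path of the current string. *)
Definition rank l := count (fun d => branching S (take d S)) (iota 0 l).

(** Node 0 is the place above the root where the climb may end. The shift by one gives it a height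
    of its own, so that the step from the root to it is paid for as well. *)
Definition height x := if x == 0 then 0 else (rank (len x)).+1.

Lemma rankS l : rank l.+1 = rank l + branching S (take l S).
Proof. by rewrite /rank -addn1 iotaD count_cat /= add0n addn0. Qed.

Lemma rank_le l l' : l <= l' -> rank l <= rank l'.
Proof. by move=> h; rewrite /rank -(subnKC h) iotaD count_cat leq_addr. Qed.

Lemma path_rank x : on_path x -> branching S (take (len x) S).
Proof.
case/andP=> ix px; have [_ _ b] := ti_int inv ix.
by rewrite -(size_nstr inv (inode_node n ix)) -(prefix_eq_take px).
Qed.

Lemma height_par x : on_path x -> height (par x) < height x.
Proof.
move=> px; have x0 : x <> 0 by case/andP: px => /inode_odd; case: (x).
case: (x =P 1) => [->|x1].
  by rewrite (ti_par1 inv) /height.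
have [pp lp _] := par_path px x1.
have p0 : par x <> 0 by case/andP: pp => /inode_odd; case: (par x).
rewrite /height; move/eqP/negPf: x0 => ->; move/eqP/negPf: p0 => ->.
rewrite ltnS; apply: leq_trans (rank_le lp); rewrite rankS path_rank // addn1.
by [].
Qed.

Lemma height_mono x z : on_path x -> on_path z -> len x <= len z ->
  height x <= height z.
Proof.
move=> /andP[/inode_odd ox _] /andP[/inode_odd oz _] h.
by rewrite /height; case: (x) ox h => // ? _ h; case: (z) oz h => //= ? _ h;
  rewrite ltnS rank_le.
Qed.

Lemma height_top : height (par (2 * n)) <= rank n.
Proof.
have [px _] := par_top; have x0 : par (2 * n) != 0.
  by case/andP: px => /inode_odd; case: (par _).
rewrite /height (negPf x0).
have [|_ lp _ _] := @par_leaf n; first by rewrite n0 leqnn.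
by apply: leq_trans (rank_le lp); rewrite rankS path_rank // addn1.
Qed.

Section Prepend.
Variable a : Sigma.
Hypotheses (ad : a != dollar) (cdI : {in a :: S &, injective cd}).
Local Notation X := (a :: S).
Local Notation N := (size S).+1.

Definition walk_end x :=
  (x = 0 \/ (on_path x /\ m x (2 * cd a) <> 0)) /\
  (forall z, on_path z -> x = 0 \/ len x < len z -> m z (2 * cd a) = 0).

Lemma walk_exists : exists x, walk_end x.
Proof.
suff main k x : len x <= k -> on_path x ->
    (forall z, on_path z -> len x < len z -> m z (2 * cd a) = 0) ->
    exists x, walk_end x.
  have [p1 p2] := par_top; apply: main (leqnn _) p1 _ => z /p2; lia.
have stop z : on_path z -> m z (2 * cd a) <> 0 ->
    (forall z', on_path z' -> len z < len z' -> m z' (2 * cd a) = 0) ->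
    exists z, walk_end z.
  move=> pz mz deep; exists z; split; first by right.
  move=> z' pz' [E|]; last exact: deep.
  by rewrite E /on_path inode0 in pz.
elim: k x => [|k IH] x xk px deep.
  case: (m x (2 * cd a) =P 0) => [mx|mx]; last by apply: (stop x).
  exists 0; split; [by left | move=> z pz _].
  case: (posnP (len z)) => z0; last by apply: deep => //; lia.
  by have -> : z = x by apply: on_path_eq => //; lia.
case: (m x (2 * cd a) =P 0) => [mx|mx]; last by apply: (stop x).
case: (x =P 1) => [x1|x1].
  exists 0; split; [by left | move=> z pz _].
  have lx : len x = 0 by rewrite x1 (ti_root inv).
  case: (posnP (len z)) => z0; last by apply: deep; rewrite ?lx.
  by have -> : z = x by apply: on_path_eq => //; rewrite z0 lx.
have [pp lp dp] := par_path px x1; apply: (IH (par x)) => //; first by lia.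
move=> z pz lz; have [lt|gt|E] := ltngtP (len z) (len x).
- by have := dp z pz lt; lia.
- exact: deep.
- by rewrite (on_path_eq pz px E).
Qed.

Variable x : nat.
Hypothesis wx : walk_end x.
Let y := if x == 0 then 1 else m x (2 * cd a).

(** Every explicit prefix [a :: w] of the new string is the target of a link from the explicit node
    [w] on the old path. So the lowest node with a link by [a] yields the deepest such prefix, and
    without any link only the root remains. *)
Lemma walk_y : [/\ inode len y, prefix (ns y) X,
  len y = (if x == 0 then 0 else (len x).+1),
  forall z, inode len z -> prefix (ns z) X -> len z <= len y
  & len y <= n].
Proof.
case: wx => h1 h2.
have pre : [/\ inode len y, prefix (ns y) X &
    len y = (if x == 0 then 0 else (len x).+1)].
  rewrite /y; case: (x =P 0) => [_|x0].
    by rewrite (nstr1 inv) (ti_root inv).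
  case: h1 => // -[px nz]; have [iu ix [c cE ca]] := ti_ws inv erefl nz.
  have cS : c \in S.
    have : c \in ns (m x (2 * cd a)) by rewrite cE inE eqxx.
    by move/mem_take/mem_drop.
  have ac : c = a by apply: cdI; rewrite ?inE ?cS ?eqxx ?orbT.
  split=> //; first by rewrite cE ac /= eqxx; case/andP: px.
  rewrite -(size_nstr inv (inode_node n iu)) cE /=.
  by rewrite (size_nstr inv (inode_node n ix)).
have [iy py ly] := pre; split=> //; last first.
  by have [h _ _] := ti_int inv iy; have := node_bounds inv (inode_node n iy); lia.
move=> z iz pz; rewrite ly.
have sz := size_nstr inv (inode_node n iz).
case E : (ns z) => [|c w]; first by rewrite -sz E.
move: (pz); rewrite E /= => /andP[/eqP ca pw]; subst c.
have [v [iv vE mE]] := ti_wc inv iz E.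
have pv : on_path v by rewrite /on_path iv vE.
rewrite -sz E /= -vE (size_nstr inv) ?inode_node //.
case: (x =P 0) => [x0|x0].
  have := h2 v pv (or_introl x0); rewrite mE => z0.
  by rewrite z0 in iz.
rewrite ltnS leqNgt; apply/negP=> lt.
have := h2 v pv (or_intror lt); rewrite mE => z0.
by rewrite z0 in iz.
Qed.

Let iE v : inode len v -> nstr X len v = ns v.
Proof.
by move=> /(inode_node n)/(node_bounds inv)/andP[_ h]; rewrite /nstr suf_cons.
Qed.
Let sE v : node len n v -> nstr X len v = ns v.
Proof. by move=> /(node_bounds inv)/andP[_ h]; rewrite /nstr suf_cons. Qed.

Let b := nth dollar X (len y).
Let q := m y (2 * cd b + 1).

Lemma yX : ns y = take (len y) X.
Proof.
have [iy py _ _ _] := walk_y.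
by rewrite {1}(prefix_eq_take py) (size_nstr inv) // inode_node.
Qed.

Lemma yb_take : rcons (ns y) b = take (len y).+1 X.
Proof.
by rewrite yX -take_nth //= ltnS; have [] := walk_y.
Qed.

(** Depth 0 and depth [D] account for the 2. Any other explicit depth [d] of the new path is at most
    [len y], and dropping the first character makes [d - 1] an explicit depth of the old path. *)
Lemma pot_cons D : (forall w, branching X w <-> branching S w \/ w = take D X) ->
  count (fun d => branching X (take d X)) (iota 0 N) <= 2 + rank (len y).
Proof.
move=> bX; have [iy py ly deep yn] := walk_y.
have old d : d <= n -> branching S (take d X) -> d <= len y.
  move=> dn /(ti_cov inv)[z iz zE].
  have := deep z iz; rewrite zE => /(_ (prefix_take _ _)).
  by rewrite -(size_nstr inv (inode_node n iz)) zE size_takel //= leqW.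
have le1 : count (fun d => branching X (take d X)) (iota 1 n) <=
    count (fun d => (d <= len y) && branching S (take d X)) (iota 1 n) +
    count (pred1 D) (iota 1 n).
  rewrite -count_predUI; apply: leq_trans (leq_addr _ _).
  rewrite -!size_filter.
  rewrite !size_filter; apply: sub_in_count => d; rewrite mem_iota /= => dn.
  move/bX => [bd|E]; first by rewrite bd old //; lia.
  case: (leqP D n) => Dn; last first.
    by move/(congr1 size): E; rewrite size_takel ?size_take_min /=; lia.
  by move/(congr1 size): E; rewrite !size_takel /= ?leqW //; [move=> ->; rewrite eqxx orbT|lia].
have le2 : count (pred1 D) (iota 1 n) <= 1.
  by rewrite count_uniq_mem ?iota_uniq //; case: (_ \in _).
have le3 : count (fun d => (d <= len y) && branching S (take d X)) (iota 1 n) <=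
    rank (len y).
  rewrite -(subnKC yn) iotaD count_cat.
  rewrite [X in _ + X](_ : _ = 0) ?addn0; last first.
    apply/eqP; rewrite -leqn0.
    apply: leq_trans (_ : count pred0 (iota (1 + len y) (n - len y)) <= 0);
      last by rewrite count_pred0.
    apply: sub_in_count => d; rewrite mem_iota /= => dn /andP[dl _].
    by exfalso; move: dn dl; clear; lia.
  have -> : iota 1 (len y) = [seq d.+1 | d <- iota 0 (len y)].
    by rewrite -[1]addn0 iotaDl.
  rewrite count_map; apply: sub_count => d /= /andP[_].
  exact: branching_behead.
apply: leq_trans (leq_add (leq_b1 _) (leq_trans le1 (leq_add le3 le2))) _.
by clear; lia.
Qed.

(** Without a child along the next character, the string of [y] is itself the longest prefix of [X]
    found in [S]. It branches already, so no internal node is created. *)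
Lemma tree_nosplit : q = 0 ->
  tree_inv X N (branching X) cd (upd len (2 * N) N) (upd par (2 * N) y)
    (upd2 m y (2 * cd b + 1) (2 * N)) /\
  (forall w, branching X w <-> branching S w \/ w = take (len y) X).
Proof.
move=> q0; have [iy py ly deep yn] := walk_y.
have nin : ~~ infix (take (len y).+1 X) S.
  apply/negP=> /infix_sufP[i iS]; rewrite -yb_take => pi.
  have i0 : 0 < i.
    by have := size_prefix pi; rewrite size_rcons size_suf //; lia.
  by apply: (child_exists inv iy _ pi) q0; rewrite i0.
have yin : infix (take (len y) X) S.
  rewrite -yX; have /andP[h1 h2] := node_bounds inv (inode_node n iy).
  exact: infix_take_suf.
have bX w := branching_cons w ad tS yn yin nin.
split; last exact: bX.
apply: tree_Br (_ : forall w, branching S w \/ w = take (len y) X <-> _) => [|w];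
  last by split=> /bX.
have by_ : branching S (take (len y) X) by rewrite -yX; have [] := ti_int inv iy.
apply: tree_Br (_ : forall w, branching S w <-> _) => [|w]; last first.
  by split=> [|[|->]] //; left.
have i' := tree_text inv a.
apply: (add_leaf i') => //=.
- by rewrite iE.
- by move=> z iz; rewrite iE //; apply: deep.
Qed.

(** [D] is the depth at which [X] leaves the edge to [q], and [pp] is the tail of the new node. The
    last two clauses make [pp] the highest node of the old path where a comparison of characters
    fails, which is what [branch_step] tests. *)
Lemma split_data : q <> 0 -> exists D pp,
  [/\ [/\ node len n q, q <> 1, par q = y, len y < D < len q & D <= n],
      prefix (take D X) (ns q), nth dollar X D <> nth dollar (ns q) D &
      [/\ on_path pp, len pp + 1 = D, x = 0 \/ len x < len pp, take D X = a :: ns pp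
        & chr S (q./2 - 1 - len pp) <> chr S (n - len pp) /\
          forall z, on_path z -> len z < len pp ->
            chr S (q./2 - 1 - len z) = chr S (n - len z)]].
Proof.
move=> q0; have [iy py ly deep yn] := walk_y.
have [_ nq q1 pq cq] := ti_cs inv erefl q0.
have [_ lyq pyq myq] := ti_par inv nq q1; rewrite -/q pq in nq lyq pyq myq.
have /andP[qb1 qb2] := node_bounds inv nq.
have sq := size_nstr inv nq; have sy := size_nstr inv (inode_node n iy).
have qb : nth dollar (ns q) (len y) = b.
  apply: cdI => //.
    rewrite inE; apply/orP; right.
    have /mem_take/mem_drop // : nth dollar (ns q) (len y) \in ns q.
    by rewrite mem_nth // sq.
  by rewrite mem_nth //= ltnS.
have pbq : prefix (rcons (ns y) b) (ns q).
  rewrite (prefix_eq_take pyq) sy -qb -take_nth ?sq //; exact: prefix_take.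
have pbX : prefix (rcons (ns y) b) X by rewrite yb_take prefix_take.
have tX : terminated dollar X by apply: terminated_cons.
(* Neither word is a prefix of the other: [X] is longer than the string of [q], and the latter as a
   prefix of [X] would be an explicit node below [y] or a proper suffix, excluded by the
   end-marker. *)
have [||D [DX Dq E nE]] := @split_point _ dollar X (ns q).
- apply/negP=> /size_prefix; rewrite sq /=; slia.
- apply/negP=> pX; case/nodeP: (nq) => [iq|[i qi ih]].
    by have := deep q iq pX; slia.
  move: pX; rewrite qi (nstr_leaf inv ih); apply/negP.
  have := @suf_not_prefix _ dollar X i (size X) tX.
  rewrite suf_size suf_cons; last by slia.
  by apply=> //=; slia.
rewrite sq in Dq; rewrite /= ltnS in DX.
have yD : len y < D.
  rewrite ltnNge; apply/negP=> Dy; case/eqP: nE.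
  case/prefixP: pbX => s ->; case/prefixP: pbq => s' ->.
  by rewrite !nth_cat size_rcons sy ltnS Dy.
have pDq : prefix (take D X) (ns q) by rewrite E prefix_take.
set i0 := q./2 in qb1 qb2 *.
have wE : take D X = a :: take D.-1 S by case: (D) yD.
have nthq k : k < len q -> nth dollar (ns q) k = chr S (i0 - k).
  by move=> kq; rewrite /nstr nth_take // nth_suf //; slia.
have sufi : suf S i0 = chr S i0 :: suf S i0.-1.
  have i00 : 0 < i0 by slia.
  by rewrite -{1}(prednK i00) (suf_S dollar) ?prednK //; slia.
have Ei : take D.-1 S = take D.-1 (suf S i0.-1).
  move: E; rewrite wE /nstr -/i0 sufi take_takel; last by slia.
  by case: (D) yD => //= d _ [].
have nthX k : 0 < k <= n -> nth dollar X k = chr S (n - k.-1).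
  case: k => // k /andP[_ kn]; rewrite /= /chr subKn //.
  exact: ltnW.
(* [S] and the suffix of length [i0 - 1] agree on [D - 1] characters and then differ, so the tail of
   the new node is explicit in the old tree. *)
have bpp : branching S (take D.-1 S).
  rewrite -[S in take _ S](suf_size S); apply: (@branching_split _ dollar S n i0.-1).
  - by slia.
  - by slia.
  - by rewrite suf_size.
  have := nE; rewrite nthX ?nthq //; last by slia.
  by rewrite (_ : i0.-1 - D.-1 = i0 - D) //; slia.
have [pp ipp ppE] := ti_cov inv bpp.
have lpp : len pp = D.-1.
  by rewrite -(size_nstr inv (inode_node n ipp)) ppE size_takel //; slia.
exists D, pp; split=> //.
- by split=> //; rewrite yD.
- exact/eqP.
split.
- by rewrite /on_path ipp ppE prefix_take.
- by slia.
- by move: ly yD; case: eqP => [->|_]; [left|right; slia].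
- by rewrite ppE.
split.
  apply/eqP; have := nE; rewrite nthX ?nthq //; last by slia.
  by rewrite lpp (_ : i0 - 1 - D.-1 = i0 - D) 1?eq_sym //; slia.
move=> z pz zl; have zD : len z < D.-1 by slia.
have := congr1 (fun s => nth dollar s (len z)) Ei; rewrite !nth_take //.
rewrite -{1}(suf_size S) !nth_suf; try slia.
by rewrite subn1.
Qed.

Lemma tree_split D pp (w := 2 * N + 1) : q <> 0 ->
  [/\ node len n q, q <> 1, par q = y, len y < D < len q & D <= n] ->
  prefix (take D X) (ns q) -> nth dollar X D <> nth dollar (ns q) D ->
  inode len pp -> take D X = a :: ns pp ->
  let m1 := upd2 m y (2 * cd b + 1) w in
  let m2 := upd2 m1 pp (2 * cd a) w in
  let m3 := upd2 m2 w (2 * cd (nth dollar (ns q) D) + 1) q in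
  let m4 := upd2 m3 w (2 * cd (nth dollar X D) + 1) (2 * N) in
  [/\ tree_inv X N (branching X) cd (upd (upd len w D) (2 * N) N)
        (upd (upd (upd par w y) q w) (2 * N) w) m4,
      (forall w, branching X w <-> branching S w \/ w = take D X),
      m1 pp (2 * cd a) = 0,
      m2 w (2 * cd (nth dollar (ns q) D) + 1) = 0
    & m3 w (2 * cd (nth dollar X D) + 1) = 0].
Proof.
move=> q0 [nq q1 pq /andP[yD Dq] Dn] pDq nE ipp wE m1 m2 m3 m4.
have [iy py ly deep yn] := walk_y.
have [_ lyq pyq myq] := ti_par inv nq q1; rewrite pq in lyq pyq myq.
have iw : inode len w = false.
  apply/negP=> /(ti_int inv)[_ h _]; move: h; rewrite /w; slia.
have ow : odd w by rewrite /w; slia.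
have wX : w./2 = size X by rewrite /w /=; slia.
have i' := tree_text inv a.
have DX : D <= size X by rewrite /= leqW.
have := @add_internal _ dollar X n (branching S) cd len par m i' a q D pp w cdI iw ow wX nq q1.
rewrite pq sE // iE // => /(_ yD Dq DX pDq ipp wE).
rewrite -/b -/m1 -/m2 -/m3 => -[mq mpp mw nBr i3].
have /andP[qb1 qb2] := node_bounds inv nq.
have sq := size_nstr inv nq.
have inD : infix (take D X) S.
  by apply: prefix_infix_trans pDq _; apply: infix_take_suf.
(* Otherwise the word of length [D] would have two right extensions in [S] and be explicit
   already. *)
have ninD : ~~ infix (take D.+1 X) S.
  apply/negP=> inS; apply: nBr; apply/branchingP; right.
  exists (nth dollar X D), (nth dollar (ns q) D); split; first exact/eqP.
    by rewrite -take_nth //= ltnS.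
  have -> : rcons (take D X) (nth dollar (ns q) D) = take D.+1 (ns q).
    by rewrite (take_nth dollar) ?sq // (prefix_eq_take pDq) size_takel.
  by apply: prefix_infix_trans (prefix_take _ _) _; apply: infix_take_suf.
have bX u := branching_cons u ad tS Dn inD ninD.
have aX : a \in X by rewrite inE eqxx.
have w1 : w <> 1 by rewrite /w; slia.
have yw : y <> w by move=> E; rewrite E iw in iy.
have ppw : pp <> w by move=> E; rewrite E iw in ipp.
have m1p : m1 pp (2 * cd a) = 0 by rewrite /m1 upd2_other //; case=> _; slia.
have m2w (c : nat) : m2 w c = 0.
  by rewrite /m2 /m1 !upd2_other //; case=> E _; [apply: yw | apply: ppw].
have key : m3 w (2 * cd (nth dollar X D) + 1) = 0.
  rewrite /m3 upd2_other // => -[E]; apply: nE.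
  apply: cdI; [by rewrite mem_nth //= ltnS | | by slia].
  rewrite inE; apply/orP; right.
  have /mem_take/mem_drop // : nth dollar (ns q) D \in ns q.
  by rewrite mem_nth // sq.
split=> //.
apply: tree_Br (_ : forall u, branching S u \/ u = take D X <-> _) => [|u];
  last by split=> /bX.
have lw : upd len w D w = D by rewrite upd_same.
have := @add_leaf _ dollar X n _ cd _ _ m3 i3 w.
rewrite /= lw /nstr lw wX suf_size /=; apply=> //.
- by rewrite /inode lw ow; slia.
- by have p : prefix (take D X) X := prefix_take _ _.
- move=> z iz pz; have {}pz : prefix (nstr X (upd len w D) z) X := pz.
  move: iz pz; case: (z =P w) => [->|zw]; first by rewrite lw.
  rewrite /inode /nstr upd_other // -/(inode len z) -/(nstr X len z) => iz.
  by rewrite iE // => pz; apply: leq_trans (deep z iz pz) (ltnW yD).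
Qed.

End Prepend.
End Static.
End Insertion.

(** * Counters of net occurrences *)

Definition cnt_ok K (par flag cnt : nat -> nat) : Prop :=
  forall v, cnt v = count (fun i => (flag i == 1) && (par (2 * i) == v)) (iota 0 K).

Lemma count_change (p p' : pred nat) K i : i < K ->
  (forall j, j != i -> p j = p' j) ->
  count p (iota 0 K) + p' i = count p' (iota 0 K) + p i.
Proof.
move=> iK E; have -> : K = i + (K - i.+1).+1 by lia.
rewrite iotaD !count_cat /=.
rewrite (@eq_in_count _ p p' (iota 0 i)) => [|j].
  rewrite (@eq_in_count _ p p' (iota (0 + i).+1 _)) => [|j].
    rewrite add0n; move: (count _ (iota 0 i)) (count _ (iota i.+1 _)).
    by move: (nat_of_bool (p i)) (nat_of_bool (p' i)); lia.
  by rewrite mem_iota => jh; apply: E; lia.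
by rewrite mem_iota => jh; apply: E; lia.
Qed.

Lemma cnt_set K par flag cnt i : cnt_ok K par flag cnt -> i < K -> flag i = 0 ->
  cnt_ok K par (upd flag i 1) (upd cnt (par (2 * i)) (cnt (par (2 * i))).+1).
Proof.
move=> ok iK f0 v.
have := @count_change (fun j => (flag j == 1) && (par (2 * j) == v))
  (fun j => (upd flag i 1 j == 1) && (par (2 * j) == v)) K i iK.
rewrite upd_same f0 /= addn0 -ok => <-; last by move=> j /eqP ji; rewrite upd_other.
rewrite {1}/upd [v == _]eq_sym; case: eqP => [<-|_] /=; lia.
Qed.

Lemma cnt_reset K par flag cnt i : cnt_ok K par flag cnt -> i < K -> flag i = 1 ->
  cnt_ok K par (upd flag i 0) (upd cnt (par (2 * i)) (cnt (par (2 * i))).-1).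
Proof.
move=> ok iK f1 v.
have E : cnt v + 0 = count (fun j => (upd flag i 0 j == 1) && (par (2 * j) == v))
    (iota 0 K) + (par (2 * i) == v).
  rewrite ok; have := @count_change (fun j => (flag j == 1) && (par (2 * j) == v))
    (fun j => (upd flag i 0 j == 1) && (par (2 * j) == v)) K i iK.
  by rewrite upd_same f1 /=; apply=> j /eqP ji; rewrite upd_other.
move: E; rewrite {2}/upd [v == _]eq_sym; case: eqP => [->|_] /=; lia.
Qed.

(** A leaf may change its parent only while it is not counted; this is why flags are cleared before
    an edge is split and set again afterwards. *)
Lemma cnt_par K par flag cnt i x : cnt_ok K par flag cnt -> flag i = 0 ->
  cnt_ok K (upd par (2 * i) x) flag cnt.
Proof.
move=> ok f0 v; rewrite ok; apply: eq_count => j; rewrite /upd.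
case: (2 * j =P 2 * i) => // E; have -> : j = i by lia.
by rewrite f0.
Qed.

Lemma cnt_par_odd K par flag cnt u x : cnt_ok K par flag cnt -> odd u ->
  cnt_ok K (upd par u x) flag cnt.
Proof.
move=> ok ou v; rewrite ok; apply: eq_count => j; rewrite /upd.
by case: (2 * j =P u) => // E; move: ou; rewrite -E oddM.
Qed.

Lemma cnt_le K par flag cnt v : cnt_ok K par flag cnt -> cnt v <= K.
Proof. by move=> ->; rewrite -[X in _ <= X](size_iota 0 K) count_size. Qed.

Definition remove : acmd :=
  AIf (AEq (AFld 14 (AReg 27)) (ACst 1))
    (ASet 29 (AFld 6 (AMul 2 (AReg 27))) ;;
     ASto 7 (AReg 29) (ASub (AFld 7 (AReg 29)) (ACst 1)) ;;
     ASto 14 (AReg 27) (ACst 0))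
    ASkip.

(** The test that the flag is 0 prevents counting a leaf twice, as the leaves to be recounted may
    coincide. Index 0, which arises as the predecessor of leaf 1, is no leaf. *)
Definition add : acmd :=
  AIf (AAnd (ALt (ACst 0) (AReg 27))
       (AAnd (AEq (AFld 14 (AReg 27)) (ACst 0))
         (ANot (ALt (AFld 5 (AFld 6 (AMul 2 (AReg 27))))
                    (AFld 5 (AFld 6 (AMul 2 (AAdd (AReg 27) (ACst 1)))))))))
    (ASet 29 (AFld 6 (AMul 2 (AReg 27))) ;;
     ASto 7 (AReg 29) (AMin (AAdd (AFld 7 (AReg 29)) (ACst 1)) (AReg 1)) ;;
     ASto 14 (AReg 27) (ACst 1))
    ASkip.

(** * The list of net-frequent nodes *)

(* Slots 1, ..., [c] of the list are contiguous; slot [k] links to slot [k - 1]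
   and a deleted slot is refilled with the last one. [lc v] is the frequency
   currently listed for node [v] (0 if absent), [slt v] its slot. *)
Record list_inv (c : nat) (Lpos Llen Lcnt Lnext Lown slt lc len : nat -> nat) : Prop :=
  ListInv {
  li_slot : forall k, 0 < k <= c ->
    [/\ 0 < lc (Lown k), slt (Lown k) = k, Lpos k = (Lown k)./2,
        Llen k = len (Lown k) & Lcnt k = lc (Lown k) /\ Lnext k = 32 * (k - 1)];
  li_node : forall v, 0 < lc v -> 0 < slt v <= c /\ Lown (slt v) = v }.

Definition entry_of (len f : nat -> nat) v : entry := (v./2, len v, f v).

(** Index [k] of arrays 0 to 3 occupies the cells [32 * k] to [32 * k + 3], which is a list node at
    address [32 * k]; slot 0 has the null address. *)
Lemma list_linked c Lpos Llen Lcnt Lnext Lown slt lc len (h : nat -> nat) :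
  list_inv c Lpos Llen Lcnt Lnext Lown slt lc len ->
  (forall k, [/\ h (32 * k) = Lpos k, h (32 * k + 1) = Llen k,
                 h (32 * k + 2) = Lcnt k & h (32 * k + 3) = Lnext k]) ->
  linked_list h (32 * c) [seq entry_of len lc v | v <- rev [seq Lown k | k <- iota 1 c]].
Proof.
move=> li hE; suff main k : k <= c ->
    linked_list h (32 * k) [seq entry_of len lc v | v <- rev [seq Lown k | k <- iota 1 k]].
  exact: main.
elim: k => [|k IH] kc; first by rewrite muln0; constructor.
have [|_ _ h1 h2 [h3 h4]] := li_slot li (k := k.+1); first by rewrite kc.
have [e1 e2 e3 e4] := hE k.+1.
have -> : iota 1 k.+1 = iota 1 k ++ [:: k.+1] 
  by rewrite -[k.+1]addn1 iotaD add1n addn1.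
rewrite map_cat rev_cat /= /entry_of.
rewrite -h1 -h2 -h3 -e1 -e2 -e3; apply: LinkedCons; first by lia.
by rewrite e4 h4 subn1 /=; apply: IH; apply: ltnW.
Qed.

Lemma list_uniq c Lpos Llen Lcnt Lnext Lown slt lc len :
  list_inv c Lpos Llen Lcnt Lnext Lown slt lc len -> uniq [seq Lown k | k <- iota 1 c].
Proof.
move=> li; rewrite map_inj_in_uniq ?iota_uniq // => k k'.
rewrite !mem_iota => kc kc' E.
have [|_ s1 _ _ _] := li_slot li (k := k); first by lia.
have [|_ s2 _ _ _] := li_slot li (k := k'); first by lia.
by rewrite -s1 -s2 E.
Qed.

Lemma list_mem c Lpos Llen Lcnt Lnext Lown slt lc len v :
  list_inv c Lpos Llen Lcnt Lnext Lown slt lc len ->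
  (v \in [seq Lown k | k <- iota 1 c]) = (0 < lc v).
Proof.
move=> li; apply/mapP/idP => [[k]|lv].
  rewrite mem_iota => kc ->; have [|h _ _ _ _] := li_slot li (k := k) => //; lia.
have [h1 h2] := li_node li lv; exists (slt v) => //; rewrite mem_iota; lia.
Qed.

Lemma list_size c Lpos Llen Lcnt Lnext Lown slt lc len K :
  list_inv c Lpos Llen Lcnt Lnext Lown slt lc len ->
  (forall v, 0 < lc v -> v < K) -> c <= K.
Proof.
move=> li lK; rewrite -(size_iota 1 c) -(size_map Lown) -(size_iota 0 K).
apply: uniq_leq_size (list_uniq li) _ => v; rewrite (list_mem _ li) => /lK.
by rewrite mem_iota.
Qed.

Lemma list_len c Lpos Llen Lcnt Lnext Lown slt lc len len' :
  list_inv c Lpos Llen Lcnt Lnext Lown slt lc len ->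
  (forall v, 0 < lc v -> len' v = len v) ->
  list_inv c Lpos Llen Lcnt Lnext Lown slt lc len'.
Proof.
move=> li E; split; last exact: (li_node li).
move=> k kc; have [h1 h2 h3 h4 h5] := li_slot li kc.
by split=> //; rewrite E.
Qed.

Definition list_push : acmd :=
  ASet 5 (AMin (AAdd (AReg 5) (ACst 1)) (AMul 4 (AReg 1))) ;;
  ASto 9 (AReg 28) (AReg 5) ;;
  ASto 4 (AReg 5) (AReg 28) ;;
  ASto 0 (AReg 5) (AHalf (AReg 28)) ;;
  ASto 1 (AReg 5) (AFld 5 (AReg 28)) ;;
  ASto 3 (AReg 5) (AMul 32 (ASub (AReg 5) (ACst 1))) ;;
  ASet 0 (AMul 32 (AReg 5)).

(** The link of a slot depends on its index only, so refilling a slot copies all fields but the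
    link. *)
Definition list_delete : acmd :=
  ASet 29 (AFld 9 (AReg 28)) ;;
  ASet 30 (AFld 4 (AReg 5)) ;;
  ASto 4 (AReg 29) (AReg 30) ;;
  ASto 0 (AReg 29) (AFld 0 (AReg 5)) ;;
  ASto 1 (AReg 29) (AFld 1 (AReg 5)) ;;
  ASto 2 (AReg 29) (AFld 2 (AReg 5)) ;;
  ASto 9 (AReg 30) (AReg 29) ;;
  ASet 5 (ASub (AReg 5) (ACst 1)) ;;
  ASet 0 (AMul 32 (AReg 5)).

Definition flush : acmd :=
  AIf (AEq (AFld 8 (AReg 28)) (AFld 7 (AReg 28)))
    ASkip
    (AIf (ALt (ACst 0) (AFld 8 (AReg 28)))
       (AEmit false (AHalf (AReg 28)) (AFld 5 (AReg 28)) (AFld 8 (AReg 28)))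
       ASkip ;;
     AIf (ALt (ACst 0) (AFld 7 (AReg 28)))
       (AEmit true (AHalf (AReg 28)) (AFld 5 (AReg 28)) (AFld 7 (AReg 28)) ;;
        AIf (ALt (ACst 0) (AFld 8 (AReg 28))) ASkip list_push ;;
        ASto 2 (AFld 9 (AReg 28)) (AFld 7 (AReg 28)))
       list_delete ;;
     ASto 8 (AReg 28) (AFld 7 (AReg 28))).

(* What has been output after the listed frequencies have changed from [lc0]
   to [lc] on their way to [cnt]. *)
Definition emitted_ok (lc0 cnt lc len : nat -> nat) (out : seq (bool * entry)) : Prop :=
  exists VF VT : seq nat,
  [/\ uniq VF /\ uniq VT,
      [seq x.2 | x <- out & x.1 == false] = [seq entry_of len lc0 v | v <- VF],
      [seq x.2 | x <- out & x.1 == true] = [seq entry_of len cnt v | v <- VT],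
      forall v, (v \in VF) = (0 < lc0 v) && (lc v != lc0 v) /\
                (v \in VT) = (0 < cnt v) && (lc v != lc0 v)
    & forall v, lc v = lc0 v \/ lc v = cnt v].

Section ListProgram.
Variables (disp : Order.disp_t) (Sigma : finOrderType disp).
Implicit Types s : astate Sigma.

Definition list_state s :=
  rg s 0 = 32 * rg s 5 /\
  list_inv (rg s 5) (ar s 0) (ar s 1) (ar s 2) (ar s 3) (ar s 4) (ar s 9) (ar s 8) (ar s 5).

(** Nodes below [2 * N + 2] bound the length of the list, where [N] is the string length; with
    [2 <= N] the clamp [4 * N] never cuts off a push. *)
Definition flush_inv lc0 s :=
  [/\ list_state s, emitted_ok lc0 (ar s 7) (ar s 8) (ar s 5) (ou s),
      2 <= rg s 1 &
      forall v, 0 < lc0 v \/ 0 < ar s 7 v -> v < 2 * rg s 1 + 2].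

Lemma remove_spec s K : cnt_ok K (ar s 6) (ar s 14) (ar s 7) -> rg s 27 < K ->
  (forall i, ar s 14 i <= 1) ->
  wpb remove s 4 (fun s' => cnt_ok K (ar s' 6) (ar s' 14) (ar s' 7) /\
    ar s' 14 = upd (ar s 14) (rg s 27) 0).
Proof.
move=> ok mK f1; apply: wpb_sym => //=; case: eqP => f /=; last first.
  split=> //; apply: functional_extensionality => i; rewrite /upd.
  by case: eqP => // ->; have := f1 (rg s 27); lia.
split=> //; rewrite /upd /= -/(upd _ _ _) subn1; exact: cnt_reset.
Qed.

Lemma add_spec s K : cnt_ok K (ar s 6) (ar s 14) (ar s 7) -> rg s 27 < K ->
  K <= rg s 1 -> (forall i, ar s 14 i <= 1) ->
  wpb add s 4 (fun s' => cnt_ok K (ar s' 6) (ar s' 14) (ar s' 7) /\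
    ar s' 14 = upd (ar s 14) (rg s 27)
      (maxn (ar s 14 (rg s 27))
        ((0 < rg s 27) && (ar s 5 (ar s 6 (2 * (rg s 27).+1)) <=
                           ar s 5 (ar s 6 (2 * rg s 27)))))).
Proof.
move=> ok mK KN f1; set i := rg s 27 in mK *.
apply: wpb_sym => //=; rewrite -/i -leqNgt addn1.
set b := ar s 5 _ <= ar s 5 _.
case: (boolP [&& 0 < i, ar s 14 i == 0 & b]) => [/and3P[i0 /eqP f hb]|C] /=; last first.
  split=> //; apply: functional_extensionality => j; rewrite /upd.
  case: eqP => // ->; move: C (f1 i); case: (0 < i); case: (b) => //=; lia.
rewrite i0 hb /=.
have ok' := cnt_set ok mK f.
rewrite /upd /= -!/(upd _ _ _) f max0n; split=> //.
have -> : rg s 1 - (rg s 1 - (ar s 7 (ar s 6 (2 * i)) + 1)) =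
    (ar s 7 (ar s 6 (2 * i))).+1; last by [].
have := cnt_le (ar s 6 (2 * i)) ok'; rewrite upd_same; lia.
Qed.

Lemma push_inv c Lpos Llen Lcnt Lnext Lown slt lc len v x :
  list_inv c Lpos Llen Lcnt Lnext Lown slt lc len -> lc v = 0 -> 0 < x ->
  list_inv c.+1 (upd Lpos c.+1 v./2) (upd Llen c.+1 (len v)) (upd Lcnt c.+1 x)
    (upd Lnext c.+1 (32 * c)) (upd Lown c.+1 v) (upd slt v c.+1) (upd lc v x) len.
Proof.
move=> li v0 x0; split=> [k kc|u].
  case: (k =P c.+1) => [->|ne]; first by rewrite !upd_same subn1.
  have [|h1 h2 h3 h4 [h5 h6]] := li_slot li (k := k); first by lia.
  have nv : Lown k <> v by move=> E; rewrite E v0 in h1.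
  by rewrite !(upd_other _ _ ne) !(upd_other _ _ nv).
case: (u =P v) => [->|ne]; first by rewrite !upd_same leqnn.
rewrite !(upd_other _ _ ne) => /(li_node li)[h1 h2].
by rewrite upd_other //; [split=> //; lia|lia].
Qed.

Lemma set_inv c Lpos Llen Lcnt Lnext Lown slt lc len v x :
  list_inv c Lpos Llen Lcnt Lnext Lown slt lc len -> 0 < lc v -> 0 < x ->
  list_inv c Lpos Llen (upd Lcnt (slt v) x) Lnext Lown slt (upd lc v x) len.
Proof.
move=> li v0 x0; have [sv ov] := li_node li v0; split=> [k kc|u].
  have [h1 h2 h3 h4 [h5 h6]] := li_slot li kc.
  case: (Lown k =P v) => [E|ne].
    have -> : k = slt v by rewrite -E h2.
    by rewrite ov !upd_same; move: h2 h3 h4 h6; rewrite E => <-.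
  rewrite !(upd_other _ _ ne) upd_other // => E.
  by apply: ne; rewrite E.
by case: (u =P v) => [->|ne]; rewrite ?upd_same ?(upd_other _ _ ne) //; apply: (li_node li).
Qed.

Lemma delete_inv c Lpos Llen Lcnt Lnext Lown slt lc len v :
  list_inv c Lpos Llen Lcnt Lnext Lown slt lc len -> 0 < lc v ->
  let i := slt v in let o := Lown c in
  list_inv (c - 1) (upd Lpos i (Lpos c)) (upd Llen i (Llen c)) (upd Lcnt i (Lcnt c))
    Lnext (upd Lown i o) (upd slt o i) (upd lc v 0) len.
Proof.
move=> li v0 i o; have [sv ov] := li_node li v0; rewrite -/i in sv ov.
have cc : 0 < c <= c by lia.
have [o1 o2 o3 o4 [o5 o6]] := li_slot li cc; rewrite -/o in o1 o2 o3 o4 o5.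
split=> [k kc|u].
  have kc' : 0 < k <= c by lia.
  have [h1 h2 h3 h4 [h5 h6]] := li_slot li kc'.
  case: (k =P i) => [E|ne].
    have nv : o <> v by move=> E'; move: o2; rewrite E' -/i => E2; lia.
    by rewrite E !upd_same (upd_other _ _ nv); split=> //; rewrite -E.
  have nv : Lown k <> v by move=> E'; apply: ne; rewrite -h2 E'.
  have no : Lown k <> o by move=> E'; move: h2; rewrite E' o2; lia.
  by rewrite !(upd_other _ _ ne) (upd_other _ _ nv) (upd_other _ _ no).
case: (u =P v) => [->|ne]; first by rewrite upd_same.
rewrite (upd_other _ _ ne) => /(li_node li)[h1 h2].
case: (u =P o) => [E|no].
  rewrite E !upd_same; split=> //.
  by move: o2; rewrite -E => us; have : i <> c; [move=> ic; apply: ne; rewrite -ov ic E|lia].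
rewrite (upd_other _ _ no) upd_other; last by move=> E; apply: ne; rewrite -h2 E.
split=> //; suff : slt u <> c by lia.
by move=> E; apply: no; rewrite /o -E.
Qed.

Lemma emitted_flush lc0 cnt lc len out v : emitted_ok lc0 cnt lc len out ->
  lc v <> cnt v ->
  emitted_ok lc0 cnt (upd lc v (cnt v)) len
    (let out1 := if 0 < lc v then rcons out (false, entry_of len lc v) else out in
     if 0 < cnt v then rcons out1 (true, entry_of len cnt v) else out1).
Proof.
move=> [VF [VT [[UF UT] EF ET M C]]] ne.
(* Every listed frequency is either the initial or the current one; being out of date, that of [v]
   is still the initial one. *)
have lv : lc v = lc0 v by case: (C v).
have [nF nT] : v \notin VF /\ v \notin VT.
  by have [-> ->] := M v; rewrite lv eqxx !andbF.
exists (if 0 < lc v then rcons VF v else VF), (if 0 < cnt v then rcons VT v else VT).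
split.
- by split; case: ifP => // _; rewrite rcons_uniq ?nF ?nT.
- case: (0 < lc v); case: (0 < cnt v); rewrite ?filter_rcons /= ?map_rcons ?EF //;
    by rewrite /entry_of lv.
- by case: (0 < lc v); case: (0 < cnt v); rewrite ?filter_rcons /= ?map_rcons ?ET //.
- move=> u; have [h1 h2] := M u; case: (u =P v) => [->|nu].
    rewrite upd_same -lv; have /eqP/negPf E : cnt v <> lc v by move=> E; apply: ne.
    rewrite E /= !andbT; split; case: ifP => h; rewrite ?mem_rcons ?inE ?eqxx //.
      by apply/negbTE.
    by apply/negbTE.
  rewrite upd_other // -h1 -h2; split; case: ifP => // _;
    by rewrite mem_rcons inE; move/eqP/negPf: nu => ->.
- move=> u; case: (u =P v) => [->|nu]; first by rewrite upd_same; right.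
  by rewrite upd_other //; apply: C.
Qed.

Lemma flush_spec lc0 s : flush_inv lc0 s ->
  wpb flush s 20 (fun s' => flush_inv lc0 s' /\
    ar s' 8 = upd (ar s 8) (rg s 28) (ar s 7 (rg s 28))).
Proof.
case=> -[r0 li] em N2 bnd; set v := rg s 28.
have lcb u : 0 < ar s 8 u -> u < 2 * rg s 1 + 2.
  case: em => VF [VT [_ _ _ _ C]] h; apply: bnd.
  by case: (C u) => <-; [left|right].
have c4 : rg s 5 + 1 <= 4 * rg s 1 by have := list_size li lcb; lia.
apply: wpb_sym => //=; rewrite -/v; case: eqP => ne /=.
  split; last first.
    by apply: functional_extensionality => u; rewrite /upd; case: eqP => // ->.
  by split.
have em' := emitted_flush em ne; rewrite -/v in em'.
have cE : 4 * rg s 1 - (4 * rg s 1 - (rg s 5 + 1)) = (rg s 5).+1 by lia.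
case l0 : (0 < ar s 8 v); case c0 : (0 < ar s 7 v); rewrite l0 c0 in em'.
- split; last by [].
  split; [split; first exact: r0 | exact: em' | exact: N2 | exact: bnd].
  exact: (set_inv li l0 c0).
- split; last by [].
  split; [split; first by [] | exact: em' | exact: N2 | exact: bnd].
  have c00 : ar s 7 v = 0 by lia.
  have E : upd (ar s 8) v (ar s 7 v) = upd (ar s 8) v 0 by rewrite c00.
  have := delete_inv li l0; rewrite -E; exact.
- split; last by [].
  split; [split; first by [] | exact: em' | exact: N2 | exact: bnd].
  have v0 : ar s 8 v = 0 by lia.
  have := push_inv li v0 c0; rewrite /upd /= -!/(upd _ _ _) cE subn1 !eqxx.
  exact.
- by exfalso; move: ne l0 c0; rewrite -/v; lia.
Qed.

End ListProgram.

(** * The online algorithm *)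

(* Registers: 0 list head, 1 length of the current string, 2 number of distinct
   characters, 3 root of the AA tree, 4 next free dictionary entry, 5 length of
   the list, 17 number of the new character; the others are temporary.
   Arrays: 0-3 the list (position, length, frequency, next), 4 node listed in a
   slot, 5 string depth, 6 parent, 7 frequency, 8 listed frequency, 9 slot of a
   node, 10 dictionary slots, 11-12 keys and values of the entries, 13 the
   numbered string, 14 flags of the leaves that are net occurrences, 15-18 the
   AA tree and its stack. *)

(* Climbs from the parent of the current leaf to the lowest node with a link
   by the new character (or to 0 above the root). *)
Definition walk : acmd :=
  ASet 6 (AFld 6 (AMul 2 (ASub (AReg 1) (ACst 1)))) ;;
  ASet 7 (AMul 2 (AReg 17)) ;;
  dict_find ;;
  AWhile (AAnd (ANot (AEq (AReg 6) (ACst 0))) (AEq (AReg 9) (ACst 0)))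
    (ASet 6 (AFld 6 (AReg 6)) ;; dict_find).

(* Climbs the same path again: register 25 gets the highest node below which
   the current string leaves the suffix link of node [r20]. *)
Definition branch_step : acmd :=
  AIf (AEq (AFld 13 (ASub (ASub (AHalf (AReg 20)) (ACst 1)) (AFld 5 (AReg 24))))
           (AFld 13 (ASub (ASub (AReg 1) (ACst 1)) (AFld 5 (AReg 24)))))
    ASkip (ASet 25 (AReg 24)) ;;
  ASet 24 (AFld 6 (AReg 24)).

Definition branch_point : acmd :=
  ASet 24 (AFld 6 (AMul 2 (ASub (AReg 1) (ACst 1)))) ;;
  AWhile (ANot (AEq (AReg 24) (AReg 18))) branch_step.

Section Online.
Variables (disp : Order.disp_t) (Sigma : finOrderType disp) (dollar : Sigma).
Implicit Types s : astate Sigma.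
Local Notation chr := (chr dollar).

Section Walk.
Variables (S : seq Sigma) (cd : Sigma -> nat) (m : nat -> nat -> nat) (a : Sigma).
Variables (s : astate Sigma) (x : nat).
Local Notation len := (ar s 5).
Local Notation par := (ar s 6).
Hypothesis inv : tree_inv dollar S (size S) (branching S) cd len par m.
Hypothesis tS : terminated dollar S.
Hypothesis wx : walk_end S cd len m a x.
Hypothesis r1 : rg s 1 = (size S).+1.

Let x0 := par (2 * size S).

Lemma path_end_par z : z <> 0 -> on_path S len z -> z <> x ->
  (x = 0 \/ (on_path S len x /\ len x <= len z)) ->
  [/\ par z = 0 \/ on_path S len (par z), par z = 0 -> x = 0,
      x = 0 \/ len x <= len (par z) & height S len x <= height S len (par z) < height S len z].
Proof.
move=> z0 pz zx xz.
have hp := height_par inv pz.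
case: (z =P 1) xz => [z1|z1] xz.
  have xx : x = 0.
    case: xz => // -[px lx]; case: zx; apply: (on_path_eq inv) => //.
    by move: lx; rewrite z1 (ti_root inv); lia.
  have p0 : par z = 0 by rewrite z1 (ti_par1 inv).
  by split; [left | | left | rewrite hp xx p0 /height].
have [pp lp dp] := par_path inv pz z1.
have pn : par z <> 0 by move=> E; rewrite E /on_path inode0 in pp.
split; [by right | by [] | | rewrite hp andbT].
  case: xz => [|[px lx]]; [by left | right; apply: dp => //].
  rewrite ltn_neqAle lx andbT; apply/negP=> /eqP E.
  by case: zx; apply: (on_path_eq inv).
case: xz => [->|[px lx]]; first by [].
apply: (height_mono px pp); apply: dp => //.
rewrite ltn_neqAle lx andbT; apply/negP=> /eqP E.
by case: zx; apply: (on_path_eq inv).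
Qed.

Lemma walk_start : [/\ x0 <> 0, on_path S len x0 &
  x = 0 \/ (on_path S len x /\ len x <= len x0)].
Proof.
have [p1 p2] := par_top inv tS.
split=> //; first by move=> E; move: p1; rewrite -/x0 E /on_path inode0.
by case: wx => -[e|[px _]] _; [left | right; split=> //; apply: p2].
Qed.

Lemma walk_spec Kmax L ow dep :
  dict_state s Kmax ow dep m -> Kmax < 2 ^ L -> rg s 17 = cd a -> 2 * cd a <= Kmax ->
  wpb walk s (4 * L + 7 + (height S len x0 - height S len x) * (4 * L + 6))
    (fun s' => rg s' 6 = x /\ ar s 12 (rg s' 9) = m x (2 * cd a)).
Proof.
move=> inD KL r17 kK.
have [x00 px0 xx0] := walk_start.
set H := height S len x0 - height S len x.
have -> : 4 * L + 7 + H * (4 * L + 6) = 1 + (1 + ((4 * L + 4) + (H * (4 * L + 5).+1).+1)).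
  by lia.
apply: wpb_seq; apply: wpb_sym => //=; apply: wpb_seq; apply: wpb_sym => //=.
rewrite /upd /= -!/(upd _ _ _) r1 subn1 /= r17 -/x0.
set s1 := set_rg _ _ _.
have D1 : dict_state s1 Kmax ow dep m by [].
have k1 : rg s1 7 <= Kmax by [].
apply: wpb_seq.
apply: wpb_conseq (wpb_framed (dict_find_spec D1 KL k1)) _ _ => // s2 [F2 [R2 A2 _ _]].
pose I j s' := (forall v, v \notin [:: 6; 8; 9; 10] -> rg s' v = rg s1 v) /\
  ar s' = ar s /\ exists z, [/\ rg s' 6 = z,
    z = 0 \/ on_path S len z, z = 0 -> x = 0, x = 0 \/ len x <= len z &
    height S len z - height S len x <= j /\
    found (ar s 10) (ar s 11) (rg s 4) ow m z (2 * cd a) (rg s' 8) (rg s' 9)].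
have arE s' : (forall f, f \notin mod_ar dict_find -> ar s' f = ar s f) -> ar s' = ar s.
  by move=> h; apply: functional_extensionality => f; apply: h.
apply: (wpb_while (I := I)) => [|j s' [R [A [z [E6 pz z0 xz [hj F]]]]] nb|
                                j s' [R [A [z [E6 pz z0 xz [hj F]]]]] /= hb].
- split; first by move=> v vn; apply: R2; move: vn; rewrite !inE !negb_or; case/and4P=> _ -> -> ->.
  split; first exact: arE A2.
  exists x0; split=> //; first by rewrite R2.
    by right.
  by case: xx0 => [|[]]; [left|right].
- have vE : ar s 12 (rg s' 9) = m z (2 * cd a) by apply: (found_val inD F).
  suff zx : z = x by split; [rewrite E6 | rewrite vE zx].
  case: (z =P 0) => [zz|nz]; first by rewrite zz z0.
  have {}pz : on_path S len z by case: pz.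
  have e0 : rg s' 9 <> 0.
    by move=> e0; move: nb; rewrite /= E6 e0 eqxx andbT negbK => /eqP.
  have mz : m z (2 * cd a) <> 0.
    case: F => d [_ _ _ /(_ e0)[eD <- <-] _].
    by have [-> ] := di_val inD eD.
  case: wx => w1 w2.
  have nx : x <> 0 by move=> xz0; apply: mz; apply: w2 => //; left.
  have {}w1 : on_path S len x by case: w1 => // -[].
  apply: (on_path_eq inv) => //; apply/eqP; rewrite eqn_leq.
  apply/andP; split; last by case: xz.
  by rewrite leqNgt; apply/negP=> lt; apply: mz; apply: w2 => //; right.
case/andP: hb; rewrite E6 => /eqP zn /eqP e0.
have {}pz : on_path S len z by case: pz.
have mz : m z (2 * cd a) = 0.
  by rewrite -(found_val inD F) e0 (di_val0 inD).
have zx : z <> x.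
  move=> zx; case: wx => -[|[_]] w1 _; first by apply: zn; rewrite zx.
  by apply: w1; rewrite -zx.
have xz' : x = 0 \/ (on_path S len x /\ len x <= len z).
  by case: xz => [e|lx]; [left | case: wx => -[e|[px _]] _; [left|right]].
have [q1 q2 q3 /andP[q4 q5]] := path_end_par zn pz zx xz'.
exists j.-1; first by move: hj q4 q5; clear; lia.
have -> : 4 * L + 5 = 1 + (4 * L + 4) by lia.
apply: wpb_seq; apply: wpb_sym => //=.
rewrite E6 A.
set s3 := set_rg _ _ _.
have D3 : dict_state s3 Kmax ow dep m.
  by rewrite /dict_state /s3 /= /upd /= A R.
have r73 : rg s3 7 = 2 * cd a by rewrite /s3 /= /upd /= R.
have r43 : rg s3 4 = rg s 4 by rewrite /s3 /= /upd /= R.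
have k3 : rg s3 7 <= Kmax by rewrite r73.
apply: wpb_conseq (wpb_framed (dict_find_spec D3 KL k3)) _ _ => // s4 [F4 [R4 A4 _ _]].
split.
  move=> v vn; have vn' : v \notin [:: 8; 9; 10].
    by move: vn; rewrite !inE !negb_or; case/and4P=> _ -> -> ->.
  rewrite R4 ?inE //; last by move: vn'; rewrite !inE !negb_or; case/and3P=> -> -> ->.
  rewrite -(R _ vn) /s3 /= /upd; move: (vn); rewrite inE negb_or.
  by case/andP=> /negPf->.
split; first by apply: arE => f fn; rewrite A4 // /s3 /= A.
exists (par z); split=> //; first by rewrite R4.
split; first by lia.
by move: F4; rewrite r73 r43 /s3 /= A.
Qed.

(** The climb ends strictly above [pp], so [pp] is visited, and above it all comparisons succeed.
    Below [pp] they may give anything, even at truncated positions, because the last recorded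
    mismatch wins. *)
Lemma branch_spec q pp : rg s 18 = x -> rg s 20 = q ->
  (forall i, 0 < i <= size S -> ar s 13 i = cd (chr S i)) -> {in S &, injective cd} ->
  len pp < q./2 - 1 <= size S -> len pp < size S ->
  on_path S len pp -> x = 0 \/ len x < len pp ->
  chr S (q./2 - 1 - len pp) <> chr S (size S - len pp) ->
  (forall z, on_path S len z -> len z < len pp ->
     chr S (q./2 - 1 - len z) = chr S (size S - len z)) ->
  wpb branch_point s (2 + (height S len x0 - height S len x) * 4)
    (fun s' => rg s' 25 = pp).
Proof.
move=> r18 r20 txE cdI ppq ppn ppp xpp mis eqs.
have [x00 px0 xx0] := walk_start.
set H := height S len x0 - height S len x.
have -> : 2 + H * 4 = 1 + (H * 3.+1).+1 by lia.
apply: wpb_seq; apply: wpb_sym => //=.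
rewrite r1 subn1 /= -/x0.
set s1 := set_rg _ _ _.
pose I j s' := (forall v, v \notin [:: 24; 25] -> rg s' v = rg s v) /\
  ar s' = ar s /\ exists z, [/\ rg s' 24 = z,
    z = 0 \/ on_path S len z, z = 0 -> x = 0, x = 0 \/ len x <= len z &
    height S len z - height S len x <= j /\
    (rg s' 25 = pp \/ (z <> 0 /\ len pp <= len z))].
apply: (wpb_while (I := I)) => [|j s' [R [A [z [E24 pz z0 xz [hj F]]]]] nb|
                                j s' [R [A [z [E24 pz z0 xz [hj F]]]]] /= hb].
- split; first by move=> v; rewrite !inE !negb_or /s1 /= /upd => /andP[/negPf-> _].
  split=> //; exists x0; split=> //; first by right.
    by case: xx0 => [|[]]; [left|right].
  split=> //; right; split=> //.
  by have [_ p2] := par_top inv tS; apply: p2.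
- move: nb; rewrite /= negbK E24 R // r18 => /eqP zx.
  case: F => // -[nz lz]; exfalso.
  by case: xpp => [xx|]; [apply: nz; rewrite zx|rewrite -zx; lia].
rewrite E24 R // r18 in hb; move/eqP: hb => zx.
have zn : z <> 0 by move=> E; apply: zx; rewrite E z0.
have {}pz : on_path S len z by case: pz.
have xz' : x = 0 \/ (on_path S len x /\ len x <= len z).
  by case: xz => [e|lx]; [left | case: wx => -[e|[px _]] _; [left|right]].
have [q1 q2 q3 /andP[q4 q5]] := path_end_par zn pz zx xz'.
have e1 : (size S).+1 - 1 = size S by rewrite subn1.
exists j.-1; first by move: hj q4 q5; clear; lia.
apply: wpb_sym => //=; rewrite E24 A !R // r20 r1 e1.
set P := (X in if X then _ else _).
pose s2 := if P then s' else set_rg s' 25 z.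
suff st : I j.-1 (set_rg s2 24 (par z)).
  by move: st; rewrite /s2; clear s2; case: P; rewrite /= /upd /= ?E24.
have r25 : rg s2 25 = pp \/ (par z <> 0 /\ len pp <= len (par z)).
  have [lt|gt|E] := ltngtP (len z) (len pp).
  - have -> : rg s2 25 = rg s' 25.
      rewrite /s2 /P !txE; try slia.
      by rewrite eqs // eqxx.
    by case: F => [|[_]]; [left|lia].
  - right; have z1 : z <> 1 by move=> z1; move: gt; rewrite z1 (ti_root inv).
    have [pp' _ dp] := par_path inv pz z1; split; last exact: dp.
    by move=> E0; rewrite E0 /on_path inode0 in pp'.
  left; have zE : z = pp by apply: (on_path_eq inv).
  have inS i : 0 < i <= size S -> chr S i \in S.
    by case/andP=> i0 iS; apply: chr_mem.
  rewrite /s2 /P !txE ?E; try slia.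
  case: eqP => [/cdI h|_]; last by rewrite /= /upd /= zE.
  by exfalso; apply: mis; apply: h; apply: inS; slia.
have s2R v : v \notin [:: 24; 25] -> rg s2 v = rg s v.
  rewrite /s2; case: ifP => _ vn; first exact: R.
  rewrite /= /upd; move: (vn); rewrite !inE !negb_or => /andP[_ /negPf->].
  exact: R.
have s2A : ar s2 = ar s by rewrite /s2; case: ifP.
split.
  move=> v vn; rewrite /= /upd; move: (vn); rewrite !inE !negb_or => /andP[/negPf-> _].
  exact: s2R.
split=> //; exists (par z); split=> //.
split; last exact: r25.
by move: hj q4 q5; clear; lia.
Qed.

End Walk.
End Online.

(** * Inserting the new suffix into the tree *)

Definition dict_put (e : aexpr) : acmd := ASet 11 e ;; dict_find ;; dict_add.

(** Register 8 still holds the empty slot in which the search of [choose_child] ended, so no second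
    search is made. *)
Definition attach_leaf : acmd :=
  ASet 11 (AMul 2 (AReg 1)) ;; dict_add ;; ASet 23 (AReg 19).

(** Register 9 is still the entry leading from [y] to [q]. Overwriting its value redirects it to the
    new node, so a split adds only three entries, whence the bound [3 * n] on the dictionary. *)
Definition make_node : acmd :=
  ASet 26 (AMin (AAdd (AFld 5 (AReg 25)) (ACst 1)) (AReg 1)) ;;
  ASet 23 (AAdd (AMul 2 (AReg 1)) (ACst 1)) ;;
  ASto 5 (AReg 23) (AReg 26) ;;
  ASto 6 (AReg 23) (AReg 19) ;;
  ASto 6 (AReg 20) (AReg 23) ;;
  ASto 12 (AReg 9) (AReg 23).

Definition link_node : acmd :=
  ASet 6 (AReg 25) ;;
  ASet 7 (AMul 2 (AReg 17)) ;;
  dict_put (AReg 23) ;;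
  ASet 6 (AReg 23) ;;
  ASet 7 (AAdd (AMul 2 (AFld 13 (ASub (AHalf (AReg 20)) (AReg 26)))) (ACst 1)) ;;
  dict_put (AReg 20) ;;
  ASet 7 (AAdd (AMul 2 (AFld 13 (ASub (AReg 1) (AReg 26)))) (ACst 1)) ;;
  dict_put (AMul 2 (AReg 1)).

Section Nodes.
Variables (disp : Order.disp_t) (Sigma : finOrderType disp) (dollar : Sigma).
Implicit Types s : astate Sigma.

Lemma found_none s Kmax ow dep m v k sl e : dict_state s Kmax ow dep m ->
  found (ar s 10) (ar s 11) (rg s 4) ow m v k sl e -> (e = 0 <-> m v k = 0).
Proof.
move=> inD [d [_ _ _ he h0]]; split=> // mz.
case: (e =P 0) => // ne; have [eD oe ke] := he ne.
by have [] := di_val inD eD; rewrite oe ke mz => <-.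
Qed.

Lemma put_spec s Kmax L ow dep m e :
  dict_state s Kmax ow dep m -> Kmax < 2 ^ L -> rg s 7 <= Kmax ->
  m (rg s 6) (rg s 7) = 0 -> aeval s e <> 0 -> rg s 4 < 4 * rg s 1 ->
  wpb (dict_put e) s (4 * L + 9) (fun s' => rg s' 4 = (rg s 4).+1 /\
    exists ow' dep', dict_state s' Kmax ow' dep'
      (upd2 m (rg s 6) (rg s 7) (aeval s e))).
Proof.
move=> inD KL kK mz ez D4.
have -> : 4 * L + 9 = 1 + ((4 * L + 4) + 4) by clear; lia.
apply: wpb_seq; apply: wpb_sym => //=; apply: wpb_seq.
set s1 := set_rg _ _ _.
have D1 : dict_state s1 Kmax ow dep m by [].
have k1 : rg s1 7 <= Kmax by [].
apply: wpb_conseq (wpb_framed (dict_find_spec D1 KL k1)) _ _ => // s2 [F [R A _ _]].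
have a10 : ar s2 10 = ar s 10 by rewrite A.
have a11 : ar s2 11 = ar s 11 by rewrite A.
have a12 : ar s2 12 = ar s 12 by rewrite A.
have e4 : rg s2 4 = rg s 4 by rewrite R.
have e6 : rg s2 6 = rg s 6 by rewrite R.
have e7 : rg s2 7 = rg s 7 by rewrite R.
have e1 : rg s2 1 = rg s 1 by rewrite R.
have e11 : rg s2 11 = aeval s e by rewrite R // /= upd_same.
have D2 : dict_state s2 Kmax ow dep m by rewrite /dict_state a10 a11 a12 e4.
have F2 : found (ar s2 10) (ar s2 11) (rg s2 4) ow m (rg s2 6) (rg s2 7) (rg s2 8) 0.
  have z : rg s2 9 = 0 by apply/(found_none D1 F).
  by move: F; rewrite z a10 a11 e4 e6 e7.
have x0 : rg s2 11 <> 0 by rewrite e11.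
have k2 : rg s2 7 <= Kmax by rewrite e7.
have D42 : rg s2 4 < 4 * rg s2 1 by rewrite e4 e1.
apply: wpb_conseq (dict_add_spec D2 F2 x0 k2 D42) _ _ => // s3.
by rewrite e4 e6 e7 e11.
Qed.

Lemma attach_leaf_spec s Kmax ow dep m y k : dict_state s Kmax ow dep m ->
  found (ar s 10) (ar s 11) (rg s 4) ow m y k (rg s 8) 0 ->
  rg s 6 = y -> rg s 7 = k -> k <= Kmax -> rg s 19 = y ->
  0 < rg s 1 -> rg s 4 < 4 * rg s 1 ->
  wpb attach_leaf s 6 (fun s' => [/\ rg s' 4 = (rg s 4).+1, rg s' 23 = y &
    exists ow' dep', dict_state s' Kmax ow' dep' (upd2 m y k (2 * rg s 1))]).
Proof.
move=> inD F e6 e7 kK e19 N0 D4; have -> : 6 = 1 + (4 + 1) by [].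
apply: wpb_seq; apply: wpb_sym => //=; apply: wpb_seq.
set s1 := set_rg _ _ _.
have D1 : dict_state s1 Kmax ow dep m by [].
have [r6 r7] : rg s1 6 = y /\ rg s1 7 = k by rewrite /s1 /= /upd /= e6 e7.
have F1 : found (ar s1 10) (ar s1 11) (rg s1 4) ow m (rg s1 6) (rg s1 7) (rg s1 8) 0.
  by rewrite r6 r7.
have x0 : rg s1 11 <> 0 by rewrite /s1 /= upd_same; move: N0; clear; lia.
have k1 : rg s1 7 <= Kmax by rewrite r7.
apply: wpb_conseq (wpb_framed (dict_add_spec D1 F1 x0 k1 D4)) _ _ => //.
move=> s2 [[E4 [ow' [dep' D2]]] [R A _ _]]; apply: wpb_sym => //=.
by split; [rewrite /upd /= E4 | rewrite /upd /= R | exists ow', dep'; rewrite -r6 -r7].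
Qed.

Lemma make_node_spec s Kmax ow dep m y k : dict_state s Kmax ow dep m ->
  found (ar s 10) (ar s 11) (rg s 4) ow m y k (rg s 8) (rg s 9) -> rg s 9 <> 0 ->
  let w := 2 * rg s 1 + 1 in let D := (ar s 5 (rg s 25)).+1 in D <= rg s 1 ->
  wpb make_node s 6 (fun s' => [/\ rg s' 23 = w, rg s' 26 = D,
    ar s' 5 = upd (ar s 5) w D,
    ar s' 6 = upd (upd (ar s 6) w (rg s 19)) (rg s 20) w &
    dict_state s' Kmax ow dep (upd2 m y k w)]).
Proof.
move=> inD F ne w D DN; apply: wpb_sym => //=.
have DE : rg s 1 - (rg s 1 - (ar s 5 (rg s 25) + 1)) = D.
  by move: DN; rewrite /D; clear; lia.
rewrite DE; split=> //.
have w0 : w <> 0 by rewrite /w addn1.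
exact: (dict_change inD F ne w0).
Qed.

Lemma link_node_spec s Kmax L ow dep m pp w q a (cd : Sigma -> nat) kq kX :
  dict_state s Kmax ow dep m -> Kmax < 2 ^ L ->
  rg s 25 = pp -> rg s 17 = cd a -> rg s 23 = w -> rg s 20 = q ->
  2 * ar s 13 (q./2 - rg s 26) + 1 = kq -> 2 * ar s 13 (rg s 1 - rg s 26) + 1 = kX ->
  2 * cd a <= Kmax -> kq <= Kmax -> kX <= Kmax -> w <> 0 -> q <> 0 -> 0 < rg s 1 ->
  rg s 4 + 3 <= 4 * rg s 1 ->
  m pp (2 * cd a) = 0 ->
  let m2 := upd2 m pp (2 * cd a) w in m2 w kq = 0 ->
  let m3 := upd2 m2 w kq q in m3 w kX = 0 ->
  wpb link_node s (12 * L + 32) (fun s' => rg s' 4 = rg s 4 + 3 /\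
    exists ow' dep', dict_state s' Kmax ow' dep' (upd2 m3 w kX (2 * rg s 1))).
Proof.
move=> inD KL r25 r17 r23 r20 kqE kXE aK qK XK w0 q0 N0 D4 mz1 m2 mz2 m3 mz3.
have -> : 12 * L + 32 =
  1 + (1 + ((4 * L + 9) + (1 + (1 + ((4 * L + 9) + (1 + (4 * L + 9))))))) by clear; lia.
apply: wpb_seq; apply: wpb_sym => //=; apply: wpb_seq; apply: wpb_sym => //=.
rewrite /upd /= -!/(upd _ _ _) r25 r17.
set s1 := set_rg _ _ _; apply: wpb_seq.
have D1 : dict_state s1 Kmax ow dep m by [].
have [e61 e71] : rg s1 6 = pp /\ rg s1 7 = 2 * cd a by [].
have k1 : rg s1 7 <= Kmax by rewrite e71.
have z1 : m (rg s1 6) (rg s1 7) = 0 by rewrite e61 e71.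
have v1 : aeval s1 (AReg 23) = w by rewrite -r23.
have n1 : aeval s1 (AReg 23) <> 0 by rewrite v1.
have D41 : rg s1 4 < 4 * rg s1 1.
  by rewrite /s1 /= /upd /=; move: D4; clear; lia.
apply: wpb_conseq (wpb_framed (put_spec D1 KL k1 z1 n1 D41)) _ _ => //.
move=> s2 [[E42 [ow2 [dep2 D2]]] [R2 A2 _ _]].
rewrite e61 e71 v1 in D2.
have s2r v : v \in [:: 1; 17; 20; 23; 25; 26] -> rg s2 v = rg s v.
  by rewrite !inE => /or4P[/eqP->|/eqP->|/eqP->|/or3P[] /eqP->]; rewrite R2.
have s2a : ar s2 13 = ar s 13 by rewrite A2.
have s24 : rg s2 4 = (rg s 4).+1 by rewrite E42.
apply: wpb_seq; apply: wpb_sym => //=; apply: wpb_seq; apply: wpb_sym => //=.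
rewrite /upd /= -!/(upd _ _ _) !s2r // s2a r20 kqE r23.
set s3 := set_rg _ _ _; apply: wpb_seq.
have D3 : dict_state s3 Kmax ow2 dep2 m2 by [].
have [e63 e73] : rg s3 6 = w /\ rg s3 7 = kq by [].
have k3 : rg s3 7 <= Kmax by rewrite e73.
have z3 : m2 (rg s3 6) (rg s3 7) = 0 by rewrite e63 e73.
have v3 : aeval s3 (AReg 20) = q by rewrite /s3 /= /upd /= s2r.
have n3 : aeval s3 (AReg 20) <> 0 by rewrite v3.
have D43 : rg s3 4 < 4 * rg s3 1.
  by rewrite /s3 /= /upd /= s24 s2r //; move: D4; clear; lia.
apply: wpb_conseq (wpb_framed (put_spec D3 KL k3 z3 n3 D43)) _ _ => //.
move=> s4 [[E44 [ow4 [dep4 D4']]] [R4 A4 _ _]].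
rewrite e63 e73 v3 in D4'.
have s4r v : v \in [:: 1; 26] -> rg s4 v = rg s v.
  by rewrite !inE => /orP[] /eqP->; rewrite R4 // /s3 /= /upd /= s2r.
have s4a : ar s4 13 = ar s 13 by rewrite A4.
have s46 : rg s4 6 = w by rewrite R4.
have s44 : rg s4 4 = (rg s 4).+2 by rewrite E44 /s3 /= /upd /= s24.
apply: wpb_seq; apply: wpb_sym => //=.
rewrite !s4r // s4a kXE.
set s5 := set_rg _ _ _.
have D5 : dict_state s5 Kmax ow4 dep4 m3 by [].
have [e65 e75] : rg s5 6 = w /\ rg s5 7 = kX by [].
have k5 : rg s5 7 <= Kmax by rewrite e75.
have z5 : m3 (rg s5 6) (rg s5 7) = 0 by rewrite e65 e75.
have v5 : aeval s5 (AMul 2 (AReg 1)) = 2 * rg s 1 by rewrite /s5 /= /upd /= s4r.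
have n5 : aeval s5 (AMul 2 (AReg 1)) <> 0 by rewrite v5; move: N0; clear; lia.
have D45 : rg s5 4 < 4 * rg s5 1.
  by rewrite /s5 /= /upd /= s44 s4r //; move: D4; clear; lia.
apply: wpb_conseq (put_spec D5 KL k5 z5 n5 D45) _ _ => //.
move=> s6 [E46 D6]; split; first by rewrite E46 /s5 /= /upd /= s44; clear; lia.
by move: D6; rewrite e65 e75 v5.
Qed.

End Nodes.

Definition choose_child : acmd :=
  ASet 18 (AReg 6) ;;
  AIf (AEq (AReg 18) (ACst 0)) (ASet 19 (ACst 1)) (ASet 19 (AFld 12 (AReg 9))) ;;
  ASet 6 (AReg 19) ;;
  ASet 7 (AAdd (AMul 2 (AFld 13 (ASub (AReg 1) (AFld 5 (AReg 19))))) (ACst 1)) ;;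
  dict_find.

(* Register 21 is the leaf whose parent is about to change, or the leaf of the
   current string if there is none. *)
Definition choose_leaf : acmd :=
  ASet 20 (AFld 12 (AReg 9)) ;;
  AIf (AAnd (ANot (AEq (AReg 20) (ACst 0)))
            (AEq (AMul 2 (AHalf (AReg 20))) (AReg 20)))
    (ASet 21 (AHalf (AReg 20)))
    (ASet 21 (ASub (AReg 1) (ACst 1))).

(** A flag depends on the parents of its leaf and of the next longer leaf, so a new parent of leaf
    [j] puts the flags of [j] and [j - 1] in doubt. Register 22 saves the old parent for the
    report. *)
Definition uncount : acmd :=
  ASet 27 (AReg 21) ;; remove ;;
  ASet 27 (ASub (AReg 21) (ACst 1)) ;; remove ;;
  ASet 22 (AFld 6 (AMul 2 (AReg 21))).

Definition grow_tree : acmd :=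
  AIf (AEq (AReg 20) (ACst 0))
    attach_leaf
    (branch_point ;; make_node ;; link_node) ;;
  ASto 6 (AMul 2 (AReg 1)) (AReg 23) ;;
  ASto 5 (AMul 2 (AReg 1)) (AReg 1).

Definition insert_suffix : acmd :=
  walk ;; choose_child ;; choose_leaf ;; uncount ;; grow_tree.

Section InsertSuffix.
Variables (disp : Order.disp_t) (Sigma : finOrderType disp) (dollar : Sigma).
Local Notation chr := (chr dollar).

Lemma framed_ar (c : acmd) (s s' : astate Sigma) :
  framed c s s' -> mod_ar c = [::] -> ar s' = ar s.
Proof.
by case=> _ A _ _ E; apply: functional_extensionality => f; apply: A; rewrite E.
Qed.

Lemma uncount_spec (s : astate Sigma) K (j := rg s 21) :
  cnt_ok K (ar s 6) (ar s 14) (ar s 7) -> j < K -> (forall i, ar s 14 i <= 1) ->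
  wpb uncount s 11 (fun s' => [/\ cnt_ok K (ar s' 6) (ar s' 14) (ar s' 7),
    ar s' 14 = upd (upd (ar s 14) j 0) (j - 1) 0 & rg s' 22 = ar s 6 (2 * j)]).
Proof.
move=> ok jK f1; have -> : 11 = 1 + (4 + (1 + (4 + 1))) by [].
apply: wpb_seq; apply: wpb_sym => //=; apply: wpb_seq.
set s1 := set_rg _ _ _.
have j1 : rg s1 27 < K by [].
apply: wpb_conseq (wpb_framed (remove_spec (s := s1) ok j1 f1)) _ _ => //.
move=> s2 [[ok2 fl2] [R2 A2 _ _]].
apply: wpb_seq; apply: wpb_sym => //=; apply: wpb_seq.
rewrite R2 //= -/j.
set s3 := set_rg _ _ _.
have j3 : rg s3 27 < K.
  by rewrite /s3 /= upd_same; apply: leq_ltn_trans jK; apply: leq_subr.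
have f3 i : ar s3 14 i <= 1.
  by rewrite /s3 /= fl2 /upd; case: eqP => // _; apply: f1.
apply: wpb_conseq (wpb_framed (remove_spec (s := s3) ok2 j3 f3)) _ _ => //.
move=> s4 [[ok4 fl4] [R4 A4 _ _]]; apply: wpb_sym => //=; split=> //.
  by rewrite fl4 /s3 /= fl2 upd_same /s1 /= upd_same.
by rewrite upd_same R4 // A4 // /s3 /= /upd /= A2 // R2.
Qed.

Variables (S : seq Sigma) (cd : Sigma -> nat) (m : nat -> nat -> nat) (a : Sigma).
Variables (s : astate Sigma) (Kmax L : nat) (ow dep : nat -> nat).
Local Notation len := (ar s 5).
Local Notation par := (ar s 6).
Local Notation X := (a :: S).
Local Notation n := (size S).
Local Notation N := (size S).+1.
Hypothesis inv : tree_inv dollar S n (branching S) cd len par m.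
Hypothesis tS : terminated dollar S.
Hypothesis ad : a != dollar.
Hypothesis cdI : {in X &, injective cd}.
Hypothesis r1 : rg s 1 = N.
Hypothesis r17 : rg s 17 = cd a.
Hypothesis txE : forall i, 0 < i <= N -> ar s 13 i = cd (chr X i).
Hypothesis inD : dict_state s Kmax ow dep m.
Hypothesis KL : Kmax < 2 ^ L.
Hypothesis codeK : forall c, c \in X -> 2 * cd c + 1 <= Kmax.
Hypothesis D3 : rg s 4 <= 3 * n.
Hypothesis cok : cnt_ok N par (ar s 14) (ar s 7).
Hypothesis flag1 : forall i, ar s 14 i <= 1.
Hypothesis flagN : ar s 14 N = 0.

Let n0 : 0 < n. Proof. exact: terminated_size tS. Qed.

Definition inserted (s' : astate Sigma) : Prop := let j := rg s' 21 in
  [/\ [/\ 0 < j <= n, rg s' 22 = par (2 * j),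
         forall i, 0 < i <= n -> i <> j -> ar s' 6 (2 * i) = par (2 * i)
       & forall v, inode len v -> inode (ar s' 5) v /\ ar s' 5 v = len v],
     exists ow' dep' m', dict_state s' Kmax ow' dep' m' /\
       tree_inv dollar X N (branching X) cd (ar s' 5) (ar s' 6) m',
     rg s' 4 <= 3 * N, cnt_ok N (ar s' 6) (ar s' 14) (ar s' 7)
   & ar s' 14 = upd (upd (ar s 14) j 0) (j - 1) 0].

Lemma choose_child_spec (s1 : astate Sigma) x (y := if x == 0 then 1 else m x (2 * cd a))
    (k := 2 * cd (nth dollar X (len y)) + 1) :
  rg s1 6 = x -> ar s1 12 (rg s1 9) = m x (2 * cd a) -> rg s1 1 = N ->
  rg s1 4 = rg s 4 -> ar s1 = ar s -> len y <= n ->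
  wpb choose_child s1 (4 * L + 9) (fun s2 => [/\ rg s2 18 = x, rg s2 19 = y,
    rg s2 6 = y, rg s2 7 = k &
    found (ar s 10) (ar s 11) (rg s 4) ow m y k (rg s2 8) (rg s2 9)]).
Proof.
move=> r6 v9 e1 e4 eA yn; have -> : 4 * L + 9 = 1 + (2 + (1 + (1 + (4 * L + 4)))).
  by clear; lia.
apply: wpb_seq; apply: wpb_sym => //=; apply: wpb_seq; apply: wpb_sym => //=.
rewrite /upd /= -!/(upd _ _ _) r6 v9.
pose s2 := set_rg (set_rg s1 18 x) 19 y.
suff W : wpb (ASet 6 (AReg 19) ;;
    ASet 7 (AAdd (AMul 2 (AFld 13 (ASub (AReg 1) (AFld 5 (AReg 19))))) (ACst 1)) ;;
    dict_find) s2 (1 + (1 + (4 * L + 4))) (fun s2 => [/\ rg s2 18 = x, rg s2 19 = y,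
      rg s2 6 = y, rg s2 7 = k &
      found (ar s 10) (ar s 11) (rg s 4) ow m y k (rg s2 8) (rg s2 9)]).
  by move: W; rewrite /s2 /y; case: eqP.
apply: wpb_seq; apply: wpb_sym => //=; apply: wpb_seq; apply: wpb_sym => //=.
rewrite /upd /= -!/(upd _ _ _) eA e1.
have -> : 2 * ar s 13 (N - len y) + 1 = k.
  rewrite txE; last by move: yn; clear; lia.
  by rewrite /chr /= subKn // leqW.
set s4 := set_rg _ _ _.
have D4 : dict_state s4 Kmax ow dep m.
  by rewrite /dict_state /s4 /= /upd /= eA e4.
have k4 : rg s4 7 <= Kmax.
  rewrite /s4 /= upd_same; apply: codeK.
  by rewrite mem_nth //= ltnS.
apply: wpb_conseq (wpb_framed (dict_find_spec D4 KL k4)) _ _ => //.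
move=> s5 [F [R A _ _]].
have [g6 g7] : rg s4 6 = y /\ rg s4 7 = k by [].
have g4 : rg s4 4 = rg s 4 by rewrite -e4.
rewrite g6 g7 g4 (_ : ar s4 = ar s) // in F.
by split=> //; rewrite R.
Qed.

(** The climb starts at height at most [rank S n] and ends at [x], of height [rank S (len y)]; by
    [pot_cons] the new path has at most two explicit nodes more than that. *)
Lemma walk_pot x : walk_end S cd len m a x ->
  height S len (par (2 * n)) - height S len x + rank X N <= rank S n + 2.
Proof.
move=> wx; have := walk_y inv tS ad cdI wx; set y := if x == 0 then _ else _.
move=> [iy py ly deep yn].
pose b := nth dollar X (len y); pose q := m y (2 * cd b + 1).
set x0 := par (2 * n); set H := _ - _.
have [D bX] : exists D, forall w, branching X w <-> branching S w \/ w = take D X.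
  case: (q =P 0) => [q0|qn].
    by have [_ bX] := tree_nosplit inv tS ad cdI wx q0; exists (len y).
  have [D [pp [h1 h2 h3 [/andP[h4 _] _ _ h5 _]]]] := split_data inv tS ad cdI wx qn.
  by have [_ bX _ _ _] := tree_split inv tS ad cdI wx qn h1 h2 h3 h4 h5; exists D.
have := pot_cons inv tS ad cdI wx bX; rewrite -/y -/(rank X N) => p1.
have p2 := height_top inv tS; rewrite -/x0 in p2.
have hx : height S len x = rank S (len y).
  rewrite ly /height; case: (x =P 0) => // nx.
  have pxx : on_path S len x by case: wx => -[//|[]].
  by rewrite rankS (path_rank inv pxx) addn1.
have hh : height S len x <= height S len x0.
  have [_ px0 [e|[px lx]]] := walk_start inv tS wx; first by rewrite e.
  exact: height_mono px px0 lx.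
apply: leq_trans (leq_add (leqnn H) p1) _; rewrite -hx /H.
by rewrite addnCA subnK // addnC leq_add2r.
Qed.

Lemma rank_cons : rank X N <= rank S n + 2.
Proof.
have [x wx] := walk_exists inv tS ad.
by apply: leq_trans (walk_pot wx); apply: leq_addl.
Qed.

Lemma insert_suffix_spec :
  wpb insert_suffix s ((rank S n + 3 - rank X N) * (20 * L + 80)) inserted.
Proof.
have [x wx] := walk_exists inv tS ad.
have := walk_y inv tS ad cdI wx; set y := if x == 0 then _ else _.
move=> [iy py ly deep yn].
pose b := nth dollar X (len y); pose q := m y (2 * cd b + 1).
pose x0 := par (2 * n); pose H := height S len x0 - height S len x.
have pot : H + rank X N <= rank S n + 2 := walk_pot wx.
(* The two climbs together cost [4 * L + 10] per step; everything else adds up to [20 * L + 73]. *)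
have TH : (4 * L + 7 + H * (4 * L + 6)) + ((4 * L + 9) + (3 + (11 +
    ((2 + H * 4 + (6 + (12 * L + 32))).+1 + (1 + 1)))))
    <= (rank S n + 3 - rank X N) * (20 * L + 80).
  apply: leq_trans (_ : (H + 1) * (20 * L + 80) <= _).
    by rewrite !mulnDl !mulnDr; clear; lia.
  by rewrite leq_mul2r; apply/orP; right; move: pot; clear; lia.
apply: wpb_conseq (_ : wpb _ _ _ inserted) TH (fun s' p => p).
apply: wpb_seq.
have aK : 2 * cd a <= Kmax.
  by have := codeK (mem_head a S); clear; lia.
apply: wpb_conseq (wpb_framed (walk_spec inv tS wx r1 inD KL r17 aK)) _ _ => //.
move=> s1 [[e6 e9] F1]; have A1 := framed_ar F1 erefl; case: F1 => R1 _ _ _.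
apply: wpb_seq.
have e1 : rg s1 1 = N by rewrite R1.
have e4 : rg s1 4 = rg s 4 by rewrite R1.
rewrite -{1}A1 in e9.
apply: wpb_conseq (wpb_framed (choose_child_spec e6 e9 e1 e4 A1 yn)) _ _ => //.
move=> s2 [[e18 e19 e26 e27 F] F2]; have A2 := framed_ar F2 erefl.
case: F2 => R2 _ _ _; rewrite A1 in A2.
rewrite -/y -/b in e19 e26 e27 F.
have qE : ar s 12 (rg s2 9) = q := found_val inD F.
pose j := if (q != 0) && (2 * q./2 == q) then q./2 else n.
apply: wpb_seq.
apply: (@wpb_conseq _ _ _ _ 3 3 (fun s3 => [/\ rg s3 20 = q, rg s3 21 = j, ar s3 = ar s
    & forall v, v \notin [:: 20; 21] -> rg s3 v = rg s2 v])) => //.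
  apply: wpb_sym => //=; rewrite A2 qE upd_same /=.
  have e12 : upd (rg s2) 20 q 1 - 1 = n by rewrite /upd /= R2 // e1 subn1.
  have jE c : c = (q != 0) && (2 * q./2 == q) -> (if c then q./2 else n) = j.
    by move=> ->.
  rewrite e12; case: ifP => hC; have /= hj := jE _ (esym hC);
    (split=> [| |//|v]; [by [] | by rewrite /= upd_same | ]);
    by rewrite !inE !negb_or /= /upd; case/andP=> /negPf-> /negPf->.
move=> s3 [e20 e21 A3 R3].
have jn : 0 < j <= n.
  rewrite /j; case: ifP => [/andP[qn /eqP qq]|_]; last by rewrite n0 leqnn.
  have [_ nq _ _ _] := ti_cs inv (erefl q) (elimN eqP qn).
  have /andP[_ ->] := node_bounds inv nq; rewrite andbT lt0n.
  by apply: contra qn => /eqP q2; rewrite -qq q2.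
have jN : rg s3 21 < N by rewrite e21 ltnS; case/andP: jn.
have cok3 : cnt_ok N (ar s3 6) (ar s3 14) (ar s3 7) by rewrite A3.
have flag3 i : ar s3 14 i <= 1 by rewrite A3.
apply: wpb_seq.
apply: wpb_conseq (wpb_framed (uncount_spec cok3 jN flag3)) _ _ => //.
move=> s4 [[cok4 fl4 e22] [R4 A4 _ _]].
rewrite e21 A3 in fl4 e22.
have a4 f : f \notin [:: 7; 14] -> ar s4 f = ar s f.
  by move=> fn; rewrite A4 ?A3 //; move: fn; rewrite !inE !negb_or; case/andP=> -> ->.
have r4 v : v \notin [:: 20; 21; 22; 27; 29] -> rg s4 v = rg s2 v.
  rewrite !inE !negb_or => /and5P[h1 h2 h3 h4 h5]; rewrite R4.
    by rewrite R3 // !inE negb_or h1 h2.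
  by rewrite !inE !negb_or h3 h4 h5.
have f41 : rg s4 1 = N by rewrite r4 // R2 // e1.
have f44 : rg s4 4 = rg s 4 by rewrite r4 // R2 // e4.
have f46 : rg s4 6 = y by rewrite r4.
have f47 : rg s4 7 = 2 * cd b + 1 by rewrite r4.
have f418 : rg s4 18 = x by rewrite r4.
have f419 : rg s4 19 = y by rewrite r4.
have f417 : rg s4 17 = cd a by rewrite r4 // R2 // R1.
have f420 : rg s4 20 = q by rewrite R4.
have f421 : rg s4 21 = j by rewrite R4.
have F4 : found (ar s4 10) (ar s4 11) (rg s4 4) ow m y (2 * cd b + 1) (rg s4 8) (rg s4 9).
  by rewrite !a4 // f44 !r4.
have D4 : dict_state s4 Kmax ow dep m by rewrite /dict_state !a4 // f44.
have fl4N : ar s4 14 N = 0.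
  by rewrite fl4 /upd; case: eqP => // _; case: eqP.
have fl4j : ar s4 14 j = 0 by rewrite fl4 /upd eqxx; case: eqP.
have n94 : rg s4 9 = 0 <-> q = 0 by apply: (found_none D4 F4).
(* Common end of both cases: the new leaf enters the tables. Its flag is 0, so the counters stay
   valid. *)
have fin s5 par1 len1 w m' : rg s5 1 = N -> rg s5 23 = w -> rg s5 21 = j ->
    rg s5 22 = par (2 * j) -> ar s5 5 = len1 -> ar s5 6 = par1 ->
    ar s5 14 = ar s4 14 -> cnt_ok N par1 (ar s5 14) (ar s5 7) -> rg s5 4 <= 3 * N ->
    (forall i, 0 < i <= n -> i <> j -> par1 (2 * i) = par (2 * i)) ->
    (forall v, inode len v -> inode len1 v /\ len1 v = len v) ->
    (exists ow' dep', dict_state s5 Kmax ow' dep' m') ->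
    tree_inv dollar X N (branching X) cd (upd len1 (2 * N) N) (upd par1 (2 * N) w) m' ->
    wpb (ASto 6 (AMul 2 (AReg 1)) (AReg 23) ;; ASto 5 (AMul 2 (AReg 1)) (AReg 1))
      s5 (1 + 1) inserted.
  move=> g1 g23 g21 g22 g5 g6 g14 ok5 g4 pE lE [ow' [dep' D5]] tr.
  apply: wpb_sym => //=; rewrite g1 g23 /inserted /= /upd /=.
  rewrite g5 g6 g21 g22 g14 fl4 -!/(upd _ _ _); split=> //.
  - split=> // [i ih ij|v iv].
      have ne : 2 * i <> 2 * N by move: ih; clear; lia.
      by move/eqP/negPf: ne => ->; apply: pE.
    have ov : v <> 2 * N by move: (inode_odd iv); clear; lia.
    have E : upd len1 (2 * N) N v = len1 v by rewrite upd_other.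
    have : inode (upd len1 (2 * N) N) v /\ upd len1 (2 * N) N v = len v.
      by rewrite /inode E; apply: lE.
    exact.
  - by exists ow', dep', m'; split; [exact: D5 | exact: tr].
  - have f14 : ar s5 14 N = 0 by rewrite g14.
    rewrite -fl4 -g14; exact: (cnt_par w ok5 f14).
apply: wpb_seq.
case: (q =P 0) => [q0|qn].
  apply: (@wpb_conseq _ _ _ _ 7 _ _ _ _ _ (fun s' p => p)); last by clear; lia.
  apply: wpb_if; rewrite /= f420 q0 /=.
  have [tr _] := tree_nosplit inv tS ad cdI wx q0.
  have F40 : found (ar s4 10) (ar s4 11) (rg s4 4) ow m y (2 * cd b + 1) (rg s4 8) 0.
    by move: F4; have -> : rg s4 9 = 0 by apply/n94.
  have kK : 2 * cd b + 1 <= Kmax by apply: codeK; rewrite mem_nth //= ltnS.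
  have N4 : 0 < rg s4 1 by rewrite f41.
  have DD : rg s4 4 < 4 * rg s4 1 by rewrite f44 f41; move: D3; clear; lia.
  apply: wpb_conseq (wpb_framed (attach_leaf_spec D4 F40 f46 f47 kK f419 N4 DD)) _ _ => //.
  move=> s5 [[g4 g23 gD] [R5 A5 _ _]].
  have k1 : rg s5 1 = N by rewrite R5.
  have k21 : rg s5 21 = j by rewrite R5.
  have k22 : rg s5 22 = par (2 * j) by rewrite R5.
  have k5 : ar s5 5 = len by rewrite A5 // a4.
  have k6 : ar s5 6 = par by rewrite A5 // a4.
  have k14 : ar s5 14 = ar s4 14 by rewrite A5.
  have k7 : ar s5 7 = ar s4 7 by rewrite A5.
  have ok5 : cnt_ok N par (ar s5 14) (ar s5 7) by rewrite k14 k7 -(a4 6).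
  have k4 : rg s5 4 <= 3 * N by rewrite g4 f44; move: D3; clear; lia.
  rewrite f41 in gD.
  exact: (fin s5 par len y _ k1 g23 k21 k22 k5 k6 k14 ok5 k4 _ _ gD tr).
have [D [pp [h1 h2 h3 [pon ppD xpp h5 [mis eqs]]]]] := split_data inv tS ad cdI wx qn.
have /andP[h4 _] := pon.
have [tr bX mz1 mz2 mz3] := tree_split inv tS ad cdI wx qn h1 h2 h3 h4 h5.
rewrite -/y -/b -/q in h1 h2 h3 mis eqs tr mz1 mz2 mz3.
have [nq q1 pq /andP[yD Dq] Dn] := h1.
have /andP[qb1 qb2] := node_bounds inv nq.
have iw : inode len (2 * N + 1) = false.
  apply/negP=> /(ti_int inv)[_ h _]; move: h.
  by rewrite addn1 mul2n /= uphalf_double ltnn.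
apply: wpb_if; rewrite /= f420; move/eqP/negPf: (qn) => ->.
apply: wpb_seq.
have inv4 : tree_inv dollar S n (branching S) cd (ar s4 5) (ar s4 6) m by rewrite !a4.
have wx4 : walk_end S cd (ar s4 5) m a x by rewrite a4.
have W := @branch_spec _ _ dollar S cd m a s4 x inv4 tS wx4 f41 q pp f418 f420.
rewrite !a4 // in W.
have tx4 i : 0 < i <= n -> ar s 13 i = cd (chr S i).
  by move=> /andP[i0 i_n]; rewrite txE ?chr_cons // i0 leqW.
have cdS : {in S &, injective cd}.
  by move=> c c' cS cS'; apply: cdI; rewrite inE ?cS ?cS' orbT.
have aux1 x1 x2 x3 x4 x5 : x1 + 1 = x2 -> x2 < x3 -> x3 <= x4 -> x4 <= x5 ->
  x1 < x4 - 1 <= x5 by clear; lia.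
have c1 : len pp < q./2 - 1 <= n := aux1 _ _ _ _ _ ppD Dq qb1 qb2.
have c2 : len pp < n by rewrite -addn1 ppD.
apply: wpb_conseq (wpb_framed (W tx4 cdS c1 c2 pon xpp mis eqs)) _ _ => // {W}.
move=> s5 [f525 F5]; have A5 := framed_ar F5 erefl; case: F5 => R5 _ _ _.
have ne5 : rg s5 9 <> 0 by rewrite R5 // => /n94.
have F5 : found (ar s5 10) (ar s5 11) (rg s5 4) ow m y (2 * cd b + 1) (rg s5 8) (rg s5 9).
  by rewrite A5 !R5.
have D5 : dict_state s5 Kmax ow dep m by rewrite /dict_state A5 R5.
have DN : (ar s5 5 (rg s5 25)).+1 <= rg s5 1.
  by rewrite f525 A5 a4 // R5 // f41; move: c2; clear; lia.
apply: wpb_seq.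
apply: wpb_conseq (wpb_framed (make_node_spec D5 F5 ne5 DN)) _ _ => //.
move=> s6 [[g23 g26 g5 g6 D6] [R6 A6 _ _]].
have e51 : rg s5 1 = N by rewrite R5.
have DE : (ar s5 5 (rg s5 25)).+1 = D by rewrite f525 A5 a4 // -ppD addn1.
have e519 : rg s5 19 = y by rewrite R5.
have e520 : rg s5 20 = q by rewrite R5.
rewrite DE e51 e519 e520 A5 !a4 // in g23 g26 g5 g6 D6.
have r6 v : v \notin [:: 23; 26; 24; 25] -> rg s6 v = rg s4 v.
  rewrite !inE !negb_or => /and4P[k1 k2 k3 k4].
  by rewrite R6 ?inE ?negb_or ?k1 ?k2 // R5 // !inE !negb_or k3 k4.
have a613 : ar s6 13 = ar s 13 by rewrite A6 // A5 a4.
have f61 : rg s6 1 = N by rewrite r6.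
have kqE : 2 * ar s6 13 (q./2 - rg s6 26) + 1 = 2 * cd (nth dollar (nstr S len q) D) + 1.
  have aux2 x1 x2 x3 x4 : x1 < x2 -> x2 <= x3 -> x3 <= x4 ->
    0 < x3 - x1 <= x4 /\ x1 <= x3 by clear; lia.
  have [h6 h7] := aux2 _ _ _ _ Dq qb1 qb2.
  rewrite a613 g26 tx4 //.
  by rewrite /nstr nth_take // nth_suf.
have kXE : 2 * ar s6 13 (rg s6 1 - rg s6 26) + 1 = 2 * cd (nth dollar X D) + 1.
  rewrite a613 g26 f61 txE; last by rewrite subn_gt0 ltnS Dn leq_subr.
  by rewrite /chr /= subKn // leqW.
have qK : 2 * cd (nth dollar (nstr S len q) D) + 1 <= Kmax.
  apply: codeK; rewrite inE; apply/orP; right.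
  have /mem_take/mem_drop // : nth dollar (nstr S len q) D \in nstr S len q.
  by rewrite mem_nth // (size_nstr inv).
have XK : 2 * cd (nth dollar X D) + 1 <= Kmax.
  by apply: codeK; rewrite mem_nth //= ltnS.
have w0 : 2 * N + 1 <> 0 by rewrite addn1.
have N6 : 0 < rg s6 1 by rewrite f61.
have DD6 : rg s6 4 + 3 <= 4 * rg s6 1.
  by rewrite r6 // f44 f61; move: D3; clear; lia.
have f625 : rg s6 25 = pp by rewrite R6.
have f617 : rg s6 17 = cd a by rewrite r6.
have f620 : rg s6 20 = q by rewrite r6.
apply: wpb_conseq (wpb_framed (link_node_spec D6 KL f625 f617 g23 f620 kqE kXE
  aK qK XK w0 qn N6 DD6 mz1 mz2 mz3)) _ _ => //.
move=> s7 [[g74 gD7] [R7 A7 _ _]]; rewrite f61 in gD7.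
have k21 : rg s7 21 = j by rewrite R7 // r6.
have k22 : rg s7 22 = par (2 * j) by rewrite R7 // r6.
have k5 : ar s7 5 = upd len (2 * N + 1) D by rewrite A7.
have k6 : ar s7 6 = upd (upd par (2 * N + 1) y) q (2 * N + 1) by rewrite A7.
have k14 : ar s7 14 = ar s4 14 by rewrite A7 // A6 // A5.
have k7 : ar s7 7 = ar s4 7 by rewrite A7 // A6 // A5.
have k1 : rg s7 1 = N by rewrite R7.
have k23 : rg s7 23 = 2 * N + 1 by rewrite R7.
have k4 : rg s7 4 <= 3 * N by rewrite g74 r6 // f44; move: D3; clear; lia.
(* If the node below the split edge is a leaf, it is leaf [j], whose flag [uncount] has cleared. *)
have qj : ~~ odd q -> q = 2 * j.
  move=> oq; rewrite /j; have -> : (q != 0) && (2 * q./2 == q).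
    by rewrite (introN eqP qn); apply/eqP; move: oq; clear; lia.
  by move: oq; clear; lia.
have ok7 : cnt_ok N (upd (upd par (2 * N + 1) y) q (2 * N + 1)) (ar s7 14) (ar s7 7).
  have ok0 : cnt_ok N (upd par (2 * N + 1) y) (ar s7 14) (ar s7 7).
    rewrite k14 k7; apply: cnt_par_odd; last by clear; lia.
    by rewrite -(a4 6).
  case: (boolP (odd q)) => [oq|/qj ->]; first exact: cnt_par_odd.
  by apply: cnt_par => //; rewrite k14.
apply: fin k1 k23 k21 k22 k5 k6 k14 ok7 k4 _ _ gD7 tr.
- move=> i ih ij; rewrite !upd_other //; first by move: ih; clear; lia.
  move=> E; apply: ij; have oq : ~~ odd q by rewrite -E oddM.
  by move: (qj oq) E; clear; lia.
move=> v iv; have vw : v <> 2 * N + 1 by move=> E; rewrite E iw in iv.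
by rewrite /inode upd_other.
Qed.

End InsertSuffix.

(** * One complete update *)

Definition recount : acmd :=
  ASet 27 (AReg 21) ;; add ;;
  ASet 27 (ASub (AReg 21) (ACst 1)) ;; add ;;
  ASet 27 (ASub (AReg 1) (ACst 1)) ;; add.

(* Only the nodes above the leaves touched by the update can have changed
   frequency. *)
Definition report : acmd :=
  ASet 28 (AReg 22) ;; flush ;;
  ASet 28 (AFld 6 (AMul 2 (AReg 21))) ;; flush ;;
  ASet 28 (AFld 6 (AMul 2 (ASub (AReg 21) (ACst 1)))) ;; flush ;;
  ASet 28 (AFld 6 (AMul 2 (ASub (AReg 1) (ACst 1)))) ;; flush.

Definition prepend_body : acmd :=
  alpha ;;
  ASto 13 (AReg 1) (AReg 17) ;;
  insert_suffix ;;
  recount ;;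
  report.

(** The increment stays outside [prepend_body] because it breaks the bound discipline: its
    coefficient is 2 while register 1 is bounded by the string length itself. At this command the
    bound moves from the old to the new length. *)
Definition prepend : acmd := ASet 1 (AAdd (AReg 1) (ACst 1)) ;; prepend_body.

(** The end-marker gets number 1. Leaf 2 hangs from the root, node 1, through dictionary entry 1
    with child key [2 * 1 + 1], stored in the root slot [3 * 1]. *)
Definition start : acmd :=
  ASet 1 (ACst 1) ;; ASet 2 (ACst 1) ;; ASet 3 (ACst 1) ;; ASet 4 (ACst 2) ;;
  ASto 17 (ACst 1) (ACst 1) ;;
  ASto 13 (ACst 1) (ACst 1) ;;
  ASto 6 (ACst 2) (ACst 1) ;;
  ASto 5 (ACst 2) (ACst 1) ;;
  ASto 10 (ACst 3) (ACst 1) ;;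
  ASto 11 (ACst 1) (ACst 3) ;;
  ASto 12 (ACst 1) (ACst 2).

(** A key is twice a code plus one; a dictionary slot is three times an entry plus one plus a bit,
    estimated by the coefficient of register 10; a list address is 32 times a list slot. The largest
    array address has coefficient [32 * 32 + 10], below the cap 1100. *)
Definition reg_bound (x : nat) : nat :=
  if x == 0 then 128 else if x == 1 then 1 else
  if (x == 7) || (x == 10) then 16 else if x == 8 then 32 else 4.

Definition fld_bound (f : nat) : nat :=
  if f == 3 then 128 else if f == 11 then 16 else 4.

Lemma wt_prepend : wt_cmd reg_bound fld_bound 1100 prepend_body.
Proof. by vm_compute. Qed.

Lemma wt_start : wt_cmd reg_bound fld_bound 1100 start.
Proof. by vm_compute. Qed.

Section Update.
Variables (disp : Order.disp_t) (Sigma : finOrderType disp) (dollar : Sigma).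
Local Notation chr := (chr dollar).
Implicit Types s : astate Sigma.

Definition code_cap := 2 * #|Sigma| + 1.

Definition flags_ok n (len par flag : nat -> nat) : Prop :=
  forall i, flag i = (0 < i < n) && (len (par (2 * i.+1)) <= len (par (2 * i))).

Definition state_inv (S : seq Sigma) s : Prop :=
  exists cd ow dep m,
  [/\ rg s 1 = size S, alpha_inv s S cd,
      dict_state s code_cap ow dep m /\ rg s 4 <= 3 * size S,
      tree_inv dollar S (size S) (branching S) cd (ar s 5) (ar s 6) m &
  [/\ forall i, 0 < i <= size S -> ar s 13 i = cd (chr S i),
      cnt_ok (size S) (ar s 6) (ar s 14) (ar s 7),
      flags_ok (size S) (ar s 5) (ar s 6) (ar s 14),
      list_state s & ar s 8 = ar s 7]].

Lemma cnt_pos K par flag cnt v : cnt_ok K par flag cnt -> 0 < cnt v ->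
  exists i, [/\ i < K, flag i = 1 & par (2 * i) = v].
Proof.
move=> ok; rewrite ok -has_count => /hasP[i]; rewrite mem_iota add0n => /= iK.
by case/andP=> /eqP fi /eqP pi; exists i.
Qed.

Section Meaning.
Variables (S : seq Sigma) (cd : Sigma -> nat) (len par flag cnt : nat -> nat).
Variable m : nat -> nat -> nat.
Hypothesis inv : tree_inv dollar S (size S) (branching S) cd len par m.
Hypothesis tS : terminated dollar S.
Hypothesis cok : cnt_ok (size S) par flag cnt.
Hypothesis fok : flags_ok (size S) len par flag.

Lemma cnt_inode v : 0 < cnt v -> inode len v.
Proof.
case/(cnt_pos cok) => i [iS fi <-]; rewrite fok in fi.
have ih : 0 < i <= size S by move: fi; case: andP => // -[/andP[-> /ltnW ->]].
by have [] := par_leaf inv tS ih.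
Qed.

Lemma cnt_net v : cnt v = net_count S len par v.
Proof.
rewrite cok /net_count; have := terminated_size tS.
case E : (size S) => [//|n'] _ /=; rewrite fok /= add0n.
apply: eq_in_count => i; rewrite mem_iota => ih; rewrite fok E.
have -> : 0 < i < n'.+1 by move: ih; clear; lia.
by case: (_ <= _); rewrite /= ?andbT ?andbF.
Qed.

Lemma PNF_nodes w f : (w, f) \in PNF S <->
  exists v, [/\ inode len v, nstr S len v = w, f = cnt v & 0 < cnt v].
Proof.
split=> [/(PNF_net_count inv tS)|] [v [iv vE fE c0]].
  by exists v; rewrite cnt_net.
by apply/(PNF_net_count inv tS); exists v; rewrite -cnt_net.
Qed.

Lemma enum_nodes (VS : seq nat) (f : nat -> nat) (P : {pred seq Sigma * nat}) :
  uniq VS -> (forall v, v \in VS -> inode len v) ->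
  (forall w g, (w, g) \in P <-> exists v, [/\ v \in VS, nstr S len v = w & g = f v]) ->
  enumerates S [seq entry_of len f v | v <- VS] P.
Proof.
move=> U iV PV; split.
- apply/allP=> e /mapP[v vV ->]; rewrite /valid_entry /=.
  by have [-> -> _] := ti_int inv (iV _ vV).
- rewrite -map_comp map_inj_in_uniq // => u v uV vV /= [E _].
  by apply: (ti_inj inv) => //; apply: iV.
move=> [w g]; rewrite -map_comp; apply/mapP/idP.
  by case=> v vV [-> ->]; apply/PV; exists v.
by case/PV => v [vV <- ->]; exists v.
Qed.

End Meaning.

Lemma state_stores S s : terminated dollar S -> state_inv S s ->
  stores_PNF S (conc s).
Proof.
move=> tS [cd [ow [dep [m [_ _ _ inv [_ cok fok [r0 li] lcE]]]]]].
rewrite lcE in li.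
exists [seq entry_of (ar s 5) (ar s 7) v |
        v <- rev [seq ar s 4 k | k <- iota 1 (rg s 5)]].
  rewrite /= r0; apply: list_linked li _ => k.
  have md f : f < 32 -> (32 * k + f) %% 32 = f /\ (32 * k + f) %/ 32 = k.
    by move=> f32; rewrite mulnC modnMDl divnMDl // modn_small // divn_small // addn0.
  have [h0 h0'] := md 0 isT; rewrite addn0 in h0 h0'.
  have [h1 h1'] := md 1 isT; have [h2 h2'] := md 2 isT; have [h3 h3'] := md 3 isT.
  by rewrite h0 h0' h1 h1' h2 h2' h3 h3'.
apply: (enum_nodes inv).
- by rewrite rev_uniq (list_uniq li).
- by move=> v; rewrite mem_rev (list_mem _ li); apply: (cnt_inode inv tS cok fok).
move=> w g; split=> [/(PNF_nodes inv tS cok fok)[v [iv vE gE c0]]|[v [vV vE gE]]].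
  by exists v; rewrite mem_rev (list_mem _ li).
rewrite mem_rev (list_mem _ li) in vV; apply/(PNF_nodes inv tS cok fok).
by exists v; split=> //; apply: (cnt_inode inv tS cok fok).
Qed.

(** Leaf [n] could not be flagged before, as there was no longer suffix. The three indices may
    coincide; the maximum says that a flag once set stays set. *)
Lemma recount_spec s n : rg s 1 = n.+1 -> 0 < rg s 21 <= n ->
  cnt_ok n.+1 (ar s 6) (ar s 14) (ar s 7) -> (forall i, ar s 14 i <= 1) ->
  let j := rg s 21 in
  wpb recount s 15 (fun s' => cnt_ok n.+1 (ar s' 6) (ar s' 14) (ar s' 7) /\
    forall i, ar s' 14 i = if [|| i == j, i == j - 1 | i == n] then
      maxn (ar s 14 i) ((0 < i) && (ar s 5 (ar s 6 (2 * i.+1)) <= ar s 5 (ar s 6 (2 * i))))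
      else ar s 14 i).
Proof.
move=> r1 jn ok f1 j; have -> : 15 = 1 + (4 + (1 + (4 + (1 + 4)))) by [].
pose c i := (0 < i) && (ar s 5 (ar s 6 (2 * i.+1)) <= ar s 5 (ar s 6 (2 * i))).
have bnd (f : nat -> nat) k : (forall i, f i <= 1) ->
    forall i, upd f k (maxn (f k) (c k)) i <= 1.
  move=> fb i; rewrite /upd; case: eqP => // _; rewrite geq_max fb.
  by case: (c k).
apply: wpb_seq; apply: wpb_sym => //=; apply: wpb_seq; rewrite -/j.
set s1 := set_rg _ _ _.
have j1 : rg s1 27 < n.+1 by rewrite /s1 /= upd_same ltnS; case/andP: jn.
have N1 : n.+1 <= rg s1 1 by rewrite /s1 /= /upd /= r1.
apply: wpb_conseq (wpb_framed (add_spec (s := s1) ok j1 N1 f1)) _ _ => //.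
move=> s2 [[ok2 fl2] [R2 A2 _ _]].
have {}fl2 : ar s2 14 = upd (ar s 14) j (maxn (ar s 14 j) (c j)) by [].
apply: wpb_seq; apply: wpb_sym => //=; apply: wpb_seq.
rewrite R2 //= -/j.
set s3 := set_rg _ _ _.
have f3 i : ar s3 14 i <= 1 by rewrite /s3 /= fl2; apply: bnd.
have r31 : rg s3 1 = n.+1 by rewrite /s3 /= /upd /= R2.
have N3 : n.+1 <= rg s3 1 by rewrite r31.
have j3 : rg s3 27 < n.+1.
  rewrite /s3 /= upd_same; case/andP: jn => _ jn.
  by rewrite ltnS; apply: leq_trans jn; apply: leq_subr.
apply: wpb_conseq (wpb_framed (add_spec (s := s3) ok2 j3 N3 f3)) _ _ => //.
move=> s4 [[ok4 fl4] [R4 A4 _ _]].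
have {}fl4 : ar s4 14 = upd (ar s2 14) (j - 1) (maxn (ar s2 14 (j - 1)) (c (j - 1))).
  have r27 : rg s3 27 = j - 1 by rewrite /s3 /= upd_same.
  have A5 : ar s3 5 = ar s 5 by rewrite /s3 /= A2.
  have A6 : ar s3 6 = ar s 6 by rewrite /s3 /= A2.
  by rewrite fl4 r27 A5 A6.
apply: wpb_seq; apply: wpb_sym => //=.
rewrite R4 // r31 subn1 [n.+1.-1]/=.
set s5 := set_rg _ _ _.
have f5 i : ar s5 14 i <= 1 by rewrite /s5 /= fl4; apply: bnd.
have N5 : n.+1 <= rg s5 1 by rewrite /s5 /= /upd /= R4 // r31.
have j5 : rg s5 27 < n.+1 by rewrite /s5 /= upd_same.
apply: wpb_conseq (add_spec (s := s5) ok4 j5 N5 f5) _ _ => //.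
move=> s6 [ok6 fl6].
have {}fl6 : ar s6 14 = upd (ar s4 14) n (maxn (ar s4 14 n) (c n)).
  have r27 : rg s5 27 = n by rewrite /s5 /= upd_same.
  have A5 : ar s5 5 = ar s 5 by rewrite /s5 /= A4 // /s3 /= A2.
  have A6 : ar s5 6 = ar s 6 by rewrite /s5 /= A4 // /s3 /= A2.
  by rewrite fl6 r27 A5 A6.
split=> // i; rewrite fl6 fl4 fl2 -/(c i).
have updE (f : nat -> nat) k : upd f k (maxn (f k) (c k)) i =
    if i == k then maxn (f i) (c i) else f i.
  by rewrite /upd; case: eqP => // ->.
rewrite !updE; case: (i == j); case: (i == j - 1); case: (i == n) => //=;
  by rewrite -?maxnA ?maxnn.
Qed.

Lemma report_spec lc0 s : flush_inv lc0 s ->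
  let vs := [:: rg s 22; ar s 6 (2 * rg s 21); ar s 6 (2 * (rg s 21 - 1));
                ar s 6 (2 * (rg s 1 - 1))] in
  wpb report s 84 (fun s' => flush_inv lc0 s' /\
    forall v, ar s' 8 v = if v \in vs then ar s 7 v else ar s 8 v).
Proof.
move=> fi vs.
have -> : 84 = 1 + (20 + (1 + (20 + (1 + (20 + (1 + 20)))))) by [].
have step s0 v : flush_inv lc0 s0 -> wpb flush (set_rg s0 28 v) 20 (fun s' =>
    [/\ flush_inv lc0 s', ar s' 8 = upd (ar s0 8) v (ar s0 7 v), ar s' 7 = ar s0 7,
        ar s' 6 = ar s0 6 &
        forall x, x \notin [:: 0; 5; 28; 29; 30] -> rg s' x = rg s0 x]).
  move=> fi0.
  have fi1 : flush_inv lc0 (set_rg s0 28 v).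
    by case: fi0 => -[h1 h2] h3 h4 h5; split.
  apply: wpb_conseq (wpb_framed (flush_spec fi1)) _ _ => // s' [[h1 h2] [R A _ _]].
  split; [exact: h1 | by rewrite h2 /= upd_same | by rewrite A | by rewrite A |].
  move=> x; rewrite !inE !negb_or => /and5P[k1 k2 k3 k4 k5].
  rewrite R /= ?/upd ?(negPf k3) //.
  by rewrite !inE !negb_or !k1 !k2 !k4 !k5.
apply: wpb_seq; apply: wpb_sym => //=; apply: wpb_seq.
apply: wpb_conseq (step _ _ fi) _ _ => // s1 [fi1 e81 e71 e61 R1].
apply: wpb_seq; apply: wpb_sym => //=; apply: wpb_seq.
apply: wpb_conseq (step _ _ fi1) _ _ => // s2 [fi2 e82 e72 e62 R2].
apply: wpb_seq; apply: wpb_sym => //=; apply: wpb_seq.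
apply: wpb_conseq (step _ _ fi2) _ _ => // s3 [fi3 e83 e73 e63 R3].
apply: wpb_seq; apply: wpb_sym => //=.
apply: wpb_conseq (step _ _ fi3) _ _ => // s4 [fi4 e84 e74 e64 R4].
split=> // v; rewrite e84 e83 e82 e81 e73 e72 e71 e63 e62 e61.
rewrite R3 // !R2 // !R1 // /vs !inE /upd.
by do 4! [case: (v =P _) => [->|_] /=; rewrite ?orbT //].
Qed.

Lemma alpha_inv_eq s s' S cd : alpha_inv s S cd ->
  rg s' 2 = rg s 2 -> rg s' 3 = rg s 3 -> ar s' 15 = ar s 15 -> ar s' 16 = ar s 16 ->
  ar s' 17 = ar s 17 -> (forall i, 0 < i -> ch s' i = ch s i) -> alpha_inv s' S cd.
Proof.
move=> inv e2 e3 e15 e16 e17 ec; have := inv; rewrite /alpha_inv /tree_at e2 e3 e15 e16 e17.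
case=> -[T [ta r3 aT pw pe]] h1 h2; split.
- exists T; split=> //; have iT i : i \in tids T -> ch s' i = ch s i.
    by rewrite (perm_mem pe) mem_iota => /andP[i0 _]; apply: ec.
  have pm (g : nat -> Sigma) u :
      pairwise (fun i j => (g i < g j)%O) u = pairwise <%O [seq g i | i <- u].
    by rewrite pairwise_map.
  rewrite pm (_ : map _ _ = [seq ch s i | i <- tids T]) -?pm //.
  exact/eq_in_map.
- by move=> i ih; rewrite ec ?h1 //; case/andP: ih.
- by move=> c /h2[h3 h4]; split=> //; rewrite ec //; case/andP: h3.
Qed.

End Update.

Section UpdateStep.
Variables (disp : Order.disp_t) (Sigma : finOrderType disp) (dollar : Sigma).
Local Notation chr := (chr dollar).
Implicit Types s : astate Sigma.

(** Old and new frequencies play symmetric roles here, so exchanging them gives the other half of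
    the symmetric difference. *)
Lemma nodes_diff (nodes : nat -> bool) (str : nat -> seq Sigma) (f1 f0 : nat -> nat)
    (P1 P0 : {pred seq Sigma * nat}) (VS : seq nat) :
  (forall u v, nodes u -> nodes v -> str u = str v -> u = v) ->
  (forall w g, (w, g) \in P1 <-> exists v, [/\ nodes v, str v = w, g = f1 v & 0 < f1 v]) ->
  (forall w g, (w, g) \in P0 <-> exists v, [/\ nodes v, str v = w, g = f0 v & 0 < f0 v]) ->
  (forall v, 0 < f1 v -> nodes v) ->
  (forall v, (v \in VS) = (0 < f1 v) && (f1 v != f0 v)) ->
  forall w g, (w, g) \in [predD P1 & P0] <->
    exists v, [/\ v \in VS, str v = w & g = f1 v].
Proof.
move=> inj E1 E0 nz VE w g; rewrite inE; split.
  case/andP=> n0 /E1[v [iv vE gE c1]]; exists v; split=> //.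
  rewrite VE c1; apply/negP=> /eqP E.
  by case/negP: n0; apply/E0; exists v; rewrite -E.
case=> v [vV vE gE]; move: vV; rewrite VE => /andP[c1 ne].
apply/andP; split; last by apply/E1; exists v; split=> //; apply: nz.
apply/negP=> /E0[u [iu uE gE' _]]; case/eqP: ne.
have vu : v = u by apply: inj; rewrite ?vE //; apply: nz.
by rewrite -gE gE' vu.
Qed.

Lemma code_capE : code_cap Sigma < 2 ^ ((trunc_log 2 #|Sigma|).+1 + 1).
Proof.
have := @trunc_log_ltn 2 #|Sigma| isT; rewrite addn1 (expnS 2 (_.+1)) /code_cap.
by move: (2 ^ _); clear; lia.
Qed.

Section Step.
Variables (S : seq Sigma) (a : Sigma).
Local Notation n := (size S).
Local Notation N := n.+1.
Local Notation X := (a :: S).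
Hypothesis tS : terminated dollar S.
Hypothesis ad : a != dollar.

(** Flag [i] looks at the parents of leaves [i] and [i + 1]. Only leaves [j] and [N] have new
    parents, which leaves [j], [j - 1] and [n] to recompute. *)
Lemma flags_update (len len1 par par1 f0 f1 : nat -> nat) j : 0 < j <= n ->
  flags_ok n len par f0 ->
  (forall i, 0 < i <= n -> i <> j -> par1 (2 * i) = par (2 * i)) ->
  (forall i, 0 < i <= n -> len1 (par (2 * i)) = len (par (2 * i))) ->
  (forall i, f1 i = if [|| i == j, i == j - 1 | i == n] then
      maxn (upd (upd f0 j 0) (j - 1) 0 i)
        ((0 < i) && (len1 (par1 (2 * i.+1)) <= len1 (par1 (2 * i))))
      else upd (upd f0 j 0) (j - 1) 0 i) ->
  flags_ok N len1 par1 f1.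
Proof.
move=> jn fok pE lE f1E i; rewrite f1E.
have fn : f0 n = 0 by rewrite fok ltnn andbF.
case: ifP => [|]; last first.
  move=> /negbT; rewrite !negb_or => /and3P[ij ij1 iN].
  rewrite upd_other; last by apply/eqP.
  rewrite upd_other; last by apply/eqP.
  rewrite fok; have -> : (0 < i < N) = (0 < i < n) by move: iN; clear; lia.
  case: (boolP (0 < i < n)) => //= ih.
  have h1 : 0 < i.+1 <= n /\ i.+1 <> j by move: ih ij1 jn; clear; lia.
  have h2 : 0 < i <= n /\ i <> j by move: ih ij; clear; lia.
  by case: h1 h2 => h1 h1' [h2 h2']; rewrite !pE ?lE.
move=> h; have -> : upd (upd f0 j 0) (j - 1) 0 i = 0.
  rewrite /upd; case: eqP => // n1; case: eqP => // n2; move: h.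
  by case/or3P => /eqP // ->.
rewrite max0n; congr (nat_of_bool (_ && _)).
by move: h jn; clear; lia.
Qed.

(** A count changes only through a leaf whose flag or parent changes, and before and after the
    update such a leaf hangs from a node in [vs]. *)
Lemma untouched (par par1 f0 f1 cnt0 cnt1 : nat -> nat) j (vs : seq nat) v :
  0 < j <= n -> cnt_ok N par f0 cnt0 -> cnt_ok N par1 f1 cnt1 ->
  (forall i, 0 < i <= n -> i <> j -> par1 (2 * i) = par (2 * i)) ->
  (forall i, i <> j -> i <> j - 1 -> i <> n -> f1 i = f0 i) ->
  f0 0 = 0 -> f1 0 = 0 ->
  {subset [:: par (2 * j); par1 (2 * j); par1 (2 * (j - 1)); par1 (2 * n)] <= vs} ->
  v \notin vs -> cnt1 v = cnt0 v.
Proof.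
move=> jn ok0 ok1 pE fE f00 f10 sub nv.
have nE u : u \in [:: par (2 * j); par1 (2 * j); par1 (2 * (j - 1)); par1 (2 * n)] ->
    (u == v) = false.
  by move=> /sub uv; apply/negbTE/eqP=> E; rewrite -E uv in nv.
rewrite ok0 ok1; apply: eq_in_count => i; rewrite mem_iota add0n => /= iN.
case: (posnP i) => [->|i0]; first by rewrite f00 f10.
case: (i =P j) => [->|ij]; first by rewrite !nE ?andbF // !inE eqxx ?orbT.
have ih : 0 < i <= n by rewrite i0.
rewrite -(pE i) //; case: (i =P j - 1) => [->|ij1].
  by rewrite !nE ?andbF // !inE eqxx ?orbT.
case: (i =P n) => [->|iN']; first by rewrite !nE ?andbF // !inE eqxx ?orbT.
by rewrite fE.
Qed.

Lemma update_spec s (Lg := (trunc_log 2 #|Sigma|).+1) : state_inv dollar S s ->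
  wpb prepend_body (set_rg (AState (rg s) (ar s) (upd (ch s) 0 a) [::]) 1 N)
    (200 * Lg + (rank S n + 3 - rank X N) * (120 * Lg))
    (fun s' => [/\ state_inv dollar X s', emits_PNF_diff a S (conc s') &
       rank X N <= rank S n + 2]).
Proof.
move=> [cd [ow [dep [m [r1 al [dI D3] inv [txE cok fok [r0 li] lcE]]]]]].
set s0 := set_rg _ _ _; have n0 := terminated_size tS.
have tX := terminated_cons ad tS.
(* Keys have [Lg + 1] bits, and [1 <= Lg] absorbs the additive constants. *)
have T0 : 100 * Lg + (1 + ((rank S n + 3 - rank X N) * (20 * (Lg + 1) + 80) + (15 + 84))) <=
    200 * Lg + (rank S n + 3 - rank X N) * (120 * Lg).
  have h : (rank S n + 3 - rank X N) * (20 * (Lg + 1) + 80) <=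
      (rank S n + 3 - rank X N) * (120 * Lg).
    by rewrite leq_mul2l; apply/orP; right; rewrite /Lg; clear; lia.
  by move: h; move: (_ * (20 * _ + _)) (_ * (120 * _)) => u v; rewrite /Lg; clear; lia.
apply: wpb_conseq (_ : wpb _ _ _ _) T0 (fun s' p => p).
apply: wpb_seq.
have al0 : alpha_inv s0 S cd.
  by apply: alpha_inv_eq al _ _ _ _ _ _ => // i i0; rewrite /= upd_other //; move: i0; clear; lia.
have r10 : rg s0 1 = N by [].
apply: wpb_conseq (wpb_framed (alpha_spec al0 r10)) _ _ => //.
move=> s1 [[cd1 [al1 cdE r17]] [R1 A1 _ O1]].
rewrite [ch s0 0]upd_same in al1 r17.
have inv1 := tree_code inv cdE.
apply: wpb_seq; apply: wpb_sym => //=.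
set s2 := set_ar _ _ _ _.
have r11 : rg s1 1 = N by rewrite R1.
have r21 : rg s2 1 = N by [].
have A2 f : f \notin [:: 13; 15; 16; 17; 18] -> ar s2 f = ar s f.
  rewrite inE negb_or => /andP[/negPf f13 h]; rewrite /= /upd f13 A1 //.
  by apply: contra h; move: f {f13}; apply/allP; vm_compute.
have a213 i : 0 < i <= N -> ar s2 13 i = cd1 (chr X i).
  move=> ih; rewrite /= upd_same r11; case: (i =P N) => [->|iN].
    by rewrite upd_same r17 chr_cons_size.
  have ih' : 0 < i <= n by move: ih iN; clear; lia.
  rewrite upd_other // A1 // txE // chr_cons; last by case/andP: ih'.
  by rewrite cdE // chr_mem //; case/andP: ih'.
have al2 : alpha_inv s2 X cd1 by apply: alpha_inv_eq al1 _ _ _ _ _ _.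
have cI := alpha_code_inj al2.
have codeK c : c \in X -> 2 * cd1 c + 1 <= code_cap Sigma.
  move=> cX; have [_ h] := alpha_size al2; have [_ _ h2] := al2.
  have [/andP[_ h3] _] := h2 c cX; rewrite /code_cap leq_add2r leq_mul2l /=.
  exact: leq_trans h3 h.
have d2 : dict_state s2 (code_cap Sigma) ow dep m.
  by rewrite /dict_state !A2 // /= R1.
have r24 : rg s2 4 = rg s 4 by rewrite /= R1.
have fn : ar s 14 n = 0 by rewrite fok ltnn andbF.
have f1 i : ar s 14 i <= 1 by rewrite fok leq_b1.
(* Leaf [n] was not flagged, so extending the range of the count to it changes nothing. *)
have cok0 : cnt_ok N (ar s 6) (ar s 14) (ar s 7).
  by move=> v; rewrite cok -(addn1 n) iotaD count_cat add0n /= fn !addn0.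
have inv2 : tree_inv dollar S n (branching S) cd1 (ar s2 5) (ar s2 6) m
  by rewrite !A2 //; exact: inv1.
have r217 : rg s2 17 = cd1 a by [].
have D32 : rg s2 4 <= 3 * n by rewrite r24.
have cok2 : cnt_ok N (ar s2 6) (ar s2 14) (ar s2 7) by rewrite !A2.
have f12 i : ar s2 14 i <= 1 by rewrite A2.
have fN2 : ar s2 14 N = 0 by rewrite A2 // fok [N < n]ltnNge leqnSn andbF.
apply: wpb_seq.
apply: wpb_conseq (wpb_framed (insert_suffix_spec inv2 tS ad cI r21 r217 a213 d2
  code_capE codeK D32 cok2 f12 fN2)) _ _ => //.
move=> s3 [[[jn r22 parE lenE] [ow' [dep' [m' [d3 inv3]]]] D33 cok3 f3] [R3 A3 C3 O3]].
rewrite !A2 // in r22 parE lenE f3.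
set j := rg s3 21 in jn r22 parE f3.
apply: wpb_seq.
have r31 : rg s3 1 = N by rewrite R3.
have f13 i : ar s3 14 i <= 1.
  by rewrite f3 /upd; case: eqP => // _; case: eqP => // _; apply: f1.
apply: wpb_conseq (wpb_framed (recount_spec r31 jn cok3 f13)) _ _ => //.
move=> s4 [[cok4 f4] [R4 A4 C4 O4]]; rewrite f3 in f4.
have a45 : ar s4 5 = ar s3 5 by rewrite A4.
have a46 : ar s4 6 = ar s3 6 by rewrite A4.
have r41 : rg s4 1 = N by rewrite R4.
have lE i : 0 < i <= n -> ar s3 5 (ar s 6 (2 * i)) = ar s 5 (ar s 6 (2 * i)).
  by move=> ih; have [h _ _ _] := par_leaf inv tS ih; have [_ ->] := lenE _ h.
have fok4 : flags_ok N (ar s4 5) (ar s4 6) (ar s4 14).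
  by rewrite a45 a46; apply: flags_update jn fok parE lE f4.
have inv4 : tree_inv dollar X N (branching X) cd1 (ar s4 5) (ar s4 6) m' by rewrite a45 a46.
have c4E v : 0 < ar s4 7 v -> inode (ar s4 5) v by apply: (cnt_inode inv4 tX cok4 fok4).
have c0E v : 0 < ar s 7 v -> inode (ar s 5) v by apply: (cnt_inode inv tS cok fok).
have nb v : 0 < ar s 7 v \/ 0 < ar s4 7 v -> inode (ar s4 5) v.
  by case=> [/c0E/lenE[h _]|/c4E //]; rewrite a45.
have A04 f : f \in [:: 0; 1; 2; 3; 4; 8; 9] -> ar s4 f = ar s f.
  move=> h; have /and3P[h1 h2 h3] : [&& f \notin mod_ar recount,
    f \notin mod_ar insert_suffix & f \notin [:: 13; 15; 16; 17; 18]].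
    by move: f h; apply/allP; vm_compute.
  by rewrite A4 // A3 // A2.
have r05 : rg s4 0 = rg s 0 /\ rg s4 5 = rg s 5.
  by rewrite !R4 // !R3 //= !R1.
have ls4 : list_state s4.
  rewrite /list_state; case: r05 => -> ->; split=> //.
  rewrite (A04 0) // (A04 1) // (A04 2) // (A04 3) // (A04 4) // (A04 8) // (A04 9) //.
  by apply: list_len li _ => v; rewrite lcE => /c0E/lenE[_]; rewrite a45.
have O4' : ou s4 = [::] by rewrite O4 // O3 //= O1.
have fi : flush_inv (ar s 7) s4.
  split=> //; last 2 first.
  - by rewrite r41.
  - move=> v /nb iv; have [_ h _] := ti_int inv4 iv; rewrite r41; move: h.
    by rewrite [size X]/=; clear; lia.
  exists [::], [::]; rewrite O4' (A04 8) // lcE; split=> // v; last by left.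
  by rewrite eqxx !andbF.
apply: wpb_conseq (wpb_framed (report_spec fi)) _ _ => //.
move=> s5 [[[ls5 em5 _ _] e58] [R5 A5 C5 O5]].
have a5 f : f \notin mod_ar report -> ar s5 f = ar s4 f by move=> h; rewrite A5.
have r5 x : x \notin mod_rg report -> rg s5 x = rg s4 x by move=> h; rewrite R5.
have lc5 : ar s5 8 = ar s5 7.
  apply: functional_extensionality => v; rewrite e58 (a5 7) //.
  case: ifP => // /negbT nv; rewrite (A04 8) // lcE; apply/esym.
  apply: (untouched jn cok0 cok4 _ _ _ _ _ nv).
  - by rewrite a46.
  - move=> i ij ij1 iN; rewrite f4 !(introF eqP) //=.
    by rewrite !upd_other.
  - by rewrite fok.
  - by rewrite fok4.
  rewrite r41 (R4 22) // (R4 21) // r22 -/j [N - 1]subn1 => u.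
  by rewrite a46.
split; last exact: rank_cons inv2 tS ad cI.
  exists cd1, ow', dep', m'; split.
  - by rewrite r5.
  - apply: alpha_inv_eq al2 _ _ _ _ _ _; rewrite ?r5 ?R4 ?R3 ?a5 ?A4 ?A3 //.
    by move=> i _; rewrite C5 // C4 // C3.
  - by rewrite /dict_state !a5 // !A4 // !r5 // !R4.
  - by rewrite !a5.
  split=> //; [|by rewrite !a5 | by rewrite !a5].
  by move=> i ih; rewrite a5 // A4 // A3 // a213.
have [VF [VT [[UF UT] EF ET M _]]] := em5.
have strE v : inode (ar s 5) v -> nstr X (ar s4 5) v = nstr S (ar s 5) v.
  move=> iv; have [_ lv] := lenE _ iv; have [_ h _] := ti_int inv iv.
  by rewrite /nstr a45 lv suf_cons.
have E1 := PNF_nodes inv4 tX cok4 fok4.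
(* Old nodes keep their strings, so [PNF S] can be read off in the new tree, where both sets are
   compared node by node. *)
have E0 w g : (w, g) \in PNF S <-> exists v, [/\ inode (ar s4 5) v,
    nstr X (ar s4 5) v = w, g = ar s 7 v & 0 < ar s 7 v].
  split=> [/(PNF_nodes inv tS cok fok)|] [v [iv vE gE c0]].
    by exists v; rewrite strE //; split=> //; apply: nb; left.
  apply/(PNF_nodes inv tS cok fok); exists v.
  by split=> //; [apply: c0E | rewrite -strE // c0E].
rewrite !(a5 7) // in EF ET M lc5; rewrite a5 // in EF ET.
rewrite lc5 in M; have inj := ti_inj inv4.
split; rewrite /emitted /= ?EF ?ET; apply: (enum_nodes inv4) => // [v|].
- by have [_ ->] := M v => /andP[/c4E].
- apply: (nodes_diff inj E1 E0 c4E) => v.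
  by have [_ ->] := M v.
- by have [-> _] := M v => /andP[c0 _]; apply: nb; left.
apply: (nodes_diff inj E0 E1) => v; last by have [-> _] := M v; rewrite eq_sym.
by move=> c0; apply: nb; left.
Qed.

End Step.

End UpdateStep.

(** * The state for the end-marker alone *)

Section Start.
Variables (disp : Order.disp_t) (Sigma : finOrderType disp) (dollar : Sigma).
Implicit Types s : astate Sigma.

Definition blank_astate : astate Sigma :=
  AState (fun=> 0) (fun _ _ => 0) (fun=> dollar) [::].

Lemma empty_dict Kmax : dict_inv (fun=> 0) (fun=> 0) (fun=> 0) 1 Kmax
  (fun=> 0) (fun=> 0) (fun _ _ => 0).
Proof. by split=> // -[|e] //; rewrite ltnS ltn0 andbF. Qed.

Lemma root_only v : inode (fun=> 0) v -> v = 1.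
Proof. by rewrite /inode ltnn andbF orbF => /eqP. Qed.

Lemma empty_tree (cd : Sigma -> nat) : tree_inv dollar [:: dollar] 0
  (fun w => w = [::]) cd (fun=> 0) (fun=> 0) (fun _ _ => 0).
Proof.
have nroot v : node (fun=> 0) 0 v -> v = 1.
  case/orP=> [/root_only //|]; case: v => [|[|v]] //.
  by rewrite leqn0 => /and3P[_ _]; rewrite -divn2; clear; lia.
split=> //.
- by move=> i; clear; lia.
- by move=> v /root_only->; rewrite /nstr take0.
- by move=> u v /root_only-> /root_only->.
- by move=> w ->; exists 1; rewrite // /nstr take0.
- by move=> v /nroot.
- by move=> v c u <-.
- by move=> u x w _; rewrite /nstr take0.
- by move=> v c u <-.
- by move=> v /nroot.
Qed.

Lemma branching_single w : w = [::] <-> branching [:: dollar] w.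
Proof.
split=> [->|/branchingP[//|[b [c [_ /size_infix]]]]]; first exact: branching_nil.
by rewrite size_rcons /=; case: w.
Qed.

(** The initial tree is the bare root with one leaf and one dictionary entry added, so the general
    insertion lemmas apply to it. *)
Lemma start_spec : wpb start blank_astate 11 (state_inv dollar [:: dollar]).
Proof.
apply: wpb_sym => //=; set s := set_ar _ _ _ _.
have [ow [dep dI]] : exists ow dep, dict_inv (upd (fun=> 0) 3 1) (upd (fun=> 0) 1 3)
    (upd (fun=> 0) 1 2) 2 (code_cap Sigma) ow dep (upd2 (fun _ _ => 0) 1 3 2).
  have fd : found (fun=> 0) (fun=> 0) 1 (fun=> 0) (fun _ _ => 0) 1 3 3 0.
    by exists 0; split.
  apply: (dict_insert (empty_dict _) fd) => //.
  have : 0 < #|Sigma| by apply/card_gt0P; exists dollar.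
  by rewrite /code_cap; clear; lia.
pose cd := fun _ : Sigma => 1.
have ti : tree_inv dollar [:: dollar] 1 (branching [:: dollar]) cd
    (upd (fun=> 0) 2 1) (upd (fun=> 0) 2 1) (upd2 (fun _ _ => 0) 1 3 2).
  apply: tree_Br branching_single.
  apply: (@add_leaf _ _ _ _ _ cd _ _ _ (empty_tree cd) 1) => //.
exists cd, ow, dep, (upd2 (fun _ _ => 0) 1 3 2); split=> //.
- split.
  + exists (TN 1 1 TE TE); split=> //=; by [split | split=> //; left].
  + by move=> i _; rewrite mem_head.
  by move=> c; rewrite inE => /eqP->.
split=> //.
- by move=> [|[|i]] //=; rewrite andbF.
- by case=> [|i] //=; rewrite andbF.
split=> //; split=> [[|k] |] //.
Qed.

End Start.

(** * Whole runs within the machine bounds *)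

Section Run.
Variables (disp : Order.disp_t) (Sigma : finOrderType disp) (dollar : Sigma).

Lemma online_det init update C S (s s' : state Sigma) t t' :
  online_run dollar init update C S s t -> online_run dollar init update C S s' t' ->
  s = s' /\ t = t'.
Proof.
move=> H; elim: H s' t' => {S s t} [s t E|a S s t s1 t1 ad R IH E] s' t' H.
  inversion H as [? ? E'|? ? ? ? ? ? _ R' _]; subst; last by inversion R'.
  by have [-> ->] := exec_det E E'.
inversion H as [? ? E'|? ? s2 t2 ? ? _ R' E']; subst; first by inversion R.
have [? ?] := IH _ _ R'; subst.
by have [-> ->] := exec_det E E'.
Qed.

(** The type check bounds all values linearly, while the machine allows words up to a power; this
    compares the two. *)
Lemma leq_mul_exp C N : C * N <= N.+1 ^ C.
Proof.
elim: C => [|C IH]; first by rewrite mul0n.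
by rewrite expnS !mulSn addnC leq_add // leq_pmulr // expn_gt0.
Qed.

Variable C : nat.
Hypothesis C_large : 1200 <= C.

Definition feed_astate a (s : astate Sigma) : astate Sigma :=
  AState (rg s) (ar s) (upd (ch s) 0 a) [::].

Lemma exec_prepend a (S : seq Sigma) (s : astate Sigma) t s' : rg s 1 = size S ->
  bounded reg_bound fld_bound (size S) s ->
  aexec prepend_body (set_rg (feed_astate a s) 1 (size S).+1) t s' ->
  exec (C * (size S).+1) ((size S).+2 ^ C) (compile prepend) (feed a (conc s))
    (1 + t) (conc s') /\ bounded reg_bound fld_bound (size S).+1 s'.
Proof.
move=> r1 [bR bA] E; set N := (size S).+1.
have QW : 1100 * N <= N.+1 ^ C.
  apply: leq_trans (leq_mul_exp C N); rewrite leq_mul2r; apply/orP; right.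
  by move: C_large; clear; lia.
have QM : 1100 * N < C * N by rewrite ltn_pmul2r //; move: C_large; clear; lia.
have NW : N <= N.+1 ^ C by apply: leq_trans QW; apply: leq_pmull.
have b1 : bounded reg_bound fld_bound N (set_rg (feed_astate a s) 1 N).
  split=> [x|f i] /=; last by apply: leq_trans (bA f i) _; rewrite leq_mul2l leqnSn orbT.
  rewrite /upd; case: (x =P 1) => [->|_]; first by rewrite mul1n.
  by apply: leq_trans (bR x) _; rewrite leq_mul2l leqnSn orbT.
have B0 : 0 < N by [].
have [E2 b2] := exec_compile B0 QM QW isT E wt_prepend b1.
split=> //; apply: ExecSeq E2.
have -> : conc (set_rg (feed_astate a s) 1 N) =
    State (upd (regs (feed a (conc s))) 1 (eval (feed a (conc s)) (cexpr (AAdd (AReg 1) (ACst 1)))))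
      (heap (feed a (conc s))) (text (feed a (conc s))) (out (feed a (conc s))).
  by rewrite /= r1 addn1.
apply: ExecSetReg; rewrite /= r1 addn1 -/N NW.
by rewrite (leq_trans _ NW) // (leq_trans _ NW) // -/N.
Qed.

(** The potential is [120 * Lg] per explicit node on the path. Besides the change of potential, an
    update costs at most [1 + 200 * Lg + 360 * Lg], within the allowance of [600 * Lg]. *)
Lemma online_exists T (S := rcons T dollar) (Lg := (trunc_log 2 #|Sigma|).+1) :
  dollar \notin T -> exists (s : astate Sigma) t,
  [/\ online_run dollar (compile start) (compile prepend) C S (conc s) t,
      state_inv dollar S s, bounded reg_bound fld_bound (size S) s,
      t + 120 * Lg * rank S (size S) <= 600 * size S * Lg &
      forall a T', T = a :: T' -> emits_PNF_diff a (rcons T' dollar) (conc s)].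
Proof.
rewrite /S {S}; elim: T => [|a T IH] /= dT.
  have [t [s [E tT inv]]] := start_spec dollar.
  have b0 : bounded reg_bound fld_bound 1 (blank_astate dollar) by split.
  have QM : 1100 * 1 < C * 1 by rewrite !muln1; move: C_large; clear; lia.
  have QW : 1100 * 1 <= 2 ^ C.
    by rewrite muln1 ltnW // (leq_trans _ (ltnW (ltn_expl C (isT : 1 < 2)))) //;
      move: C_large; clear; lia.
  have [E' b'] := exec_compile (ltn0Sn 0) QM QW isT E wt_start b0.
  exists s, t; split=> //; first exact: RunInit.
  have h : rank [:: dollar] 1 <= 1 := count_size _ _.
  have h2 : 120 * Lg * rank [:: dollar] 1 <= 120 * Lg * 1 by rewrite leq_mul2l h orbT.
  by rewrite /= muln1; move: tT h2; rewrite /Lg; clear; lia.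
rewrite inE negb_or in dT; case/andP: dT => da dT.
have ad : a != dollar by rewrite eq_sym.
have [s [t [R inv b tT _]]] := IH dT.
set S := rcons T dollar in R inv b tT *.
have tS : terminated dollar S by exists T.
have r1 : rg s 1 = size S by case: inv => [? [? [? [? []]]]].
have [tb [s' [E tbT [inv' em rc]]]] := update_spec tS ad inv.
have [E' b'] := exec_prepend r1 b E.
exists s', (t + (1 + tb)); split=> //.
- exact: RunPrepend ad R E'.
- move: tT tbT rc; rewrite -/Lg.
  move: (size S) => n; move: (rank S n) (rank (a :: S) n.+1) => r r' tT tbT rc.
  (* The subtraction is exact because the rank grows by at most 2. *)
  have h : (r + 3 - r') * (120 * Lg) + 120 * Lg * r' = 120 * Lg * r + 360 * Lg.
    rewrite [_ * (120 * Lg)]mulnC -mulnDr subnK; last by move: rc; clear; lia.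
    by rewrite mulnDr; clear; lia.
  have e : 600 * n.+1 * Lg = 600 * n * Lg + 600 * Lg by rewrite mulnS mulnDl addnC.
  have L0 : 0 < Lg by [].
  by rewrite e; move: (600 * n * Lg) (_ * r) (_ * r') (_ * (120 * Lg)) L0 tT tbT h; clear; lia.
by move=> a' T' [<- <-].
Qed.

End Run.

Theorem theorem1 :
  exists (init update : cmd) (C : nat),
  forall (disp : Order.disp_t) (Sigma : finOrderType disp) (dollar : Sigma)
         (T : seq Sigma),
    dollar \notin T ->
    let S := rcons T dollar in
    (exists (s : state Sigma) (t : nat),
       online_run dollar init update C S s t) /\
    (forall (s : state Sigma) (t : nat),
       online_run dollar init update C S s t ->
       [/\ t <= C * size S * (trunc_log 2 #|Sigma|).+1,
           stores_PNF S s &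
           forall (a : Sigma) (T' : seq Sigma),
             T = a :: T' -> emits_PNF_diff a (rcons T' dollar) s]).
Proof.
(* 1200 exceeds the typing cap 1100 strictly, as addresses must stay below the memory size, and
   covers the factor 600 of the running time. *)
exists (compile start), (compile prepend), 1200 => disp Sigma dollar T dT S.
have [s [t [R inv _ tT em]]] := online_exists (leqnn 1200) dT.
split; first by exists (conc s), t.
(* Execution is deterministic, so the run constructed above is the only one. *)
move=> s' t' R'; have [<- <-] := online_det R R'; split=> //.
  apply: leq_trans (leq_trans (leq_addr _ _) tT) _.
  by rewrite !leq_mul2r; apply/orP; right; apply/orP; right.
by apply: state_stores inv; exists T.
Qed.
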